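(* Let $\mathbf{Fans}$ be the category of locally finite type fans. Then the category of spaces $(\mathbf{Fans},\mathrm{Spec}\, \mathbb{N})$ is the initial object in the $2$-category $\mathbf{Univ}$ of categories of spaces; that is, for every category of spaces $(\mathbf{Esp},\mathbb{A}^1)$ there is a $1$-morphism $(\mathbf{Fans},\mathrm{Spec}\,\mathbb{N})\to(\mathbf{Esp},\mathbb{A}^1)$, and for any two such $1$-morphisms there is a unique invertible $2$-morphism from the first to the second.
   Context: Monoids are commutative with unit, written additively; $P^*$ denotes units. $h:P\to Q$ is local if $h(P\setminus P^* )\subseteq Q\setminus Q^*$. A locally monoidal space is a topological space with a sheaf of monoids $\mathcal{M}_X$; morphisms are continuous maps $f$ together with a map $f^{-1}\mathcal{M}_Y\to\mathcal{M}_X$ of sheaves of monoids that is local on stalks. $\mathrm{Spec}\,P$ is the set of prime ideals of $P$ (subsets $\mathfrak{p}$ with $\mathfrak{p}+P\subseteq\mathfrak{p}$ and $P\setminus\mathfrak{p}$ a submonoid) with basic opens $U_p=\{\mathfrak p:p\notin\mathfrak p\}$ and structure sheaf $\mathcal{M}_P$ with $\mathcal{M}_P(U_p)=P_p$ (localization). A fan is a locally monoidal space locally isomorphic to $\mathrm{Spec}\,P$ for varying $P$; locally finite type if the $P$ can be taken finitely generated. Since $\mathrm{Hom}(X,\mathrm{Spec}\,\mathbb{N})=\mathcal{M}_X(X)$, $\mathrm{Spec}\,\mathbb{N}$ is a monoid object in fans; $|\cdot|$ on fans is the underlying topological space. A category of spaces $(\mathbf{Esp},\mathbb{A}^1)$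 is a category $\mathbf{Esp}$ with a functor $X\mapsto|X|$ to topological spaces and a monoid object $\mathbb{A}^1$ such that: (S1) $\mathbf{Esp}$ has finite inverse limits; (S2) it has small coproducts; (S3) coproducts commute with $|\cdot|$; (S4) for $X\in\mathbf{Esp}$ and open $|U|\subseteq|X|$ the presheaf $Y\mapsto\{f:Y\to X\mid |f|(|Y|)\subseteq|U|\}$ is represented by some $U\to X$ (such maps are called open embeddings) whose underlying map is (isomorphic to) the inclusion $|U|\subseteq|X|$, and $X$ is initial if $|X|=\emptyset$; (S5) Zariski covers ($f:X\to Y$ with $|f|$ surjective such that every point of $X$ lies in the image of an open embedding $U\to X$ whose composition with $f$ is an open embedding) are covers for a subcanonical topology; (S6) the maps $X_i\to\coprod_iX_i$ are open embeddings; (S7) the direct limit of any Zariski gluing datum (a pair of open embeddings $X_0\to X_1$, $X_0\to X_2$, or a functor from a well-ordered set with all transition maps open embeddings) exists, its structure maps are open embeddings, and it is preserved by $|\cdot|$; (S8) the presheaf $\mathbb{G}_m:X\mapsto\mathrm{Hom}(X,\mathbb{A}^1)^*$ is representable and $\mathbb{G}_m\to\mathbb{A}^1$ is an open embedding. A $1$-morphism $(F,\eta):(\mathbf{Esp},\mathbb{A}^1)\to(\mathbf{Esp}',(\mathbb{A}^1)')$ is a functor $F:\mathbf{Esp}\to\mathbf{Esp}'$ with a natural transformation $\eta:|F(\cdot)|\to|\cdot|$ of functors $\mathbf{Esp}\to\mathbf{Top}$ such that (M1) $F$ preserves finite inverse limits and coproducts; (M2) $F(\mathbb{A}^1)=(\mathbb{A}^1)'$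 as monoid objects; (M3) the image $FU\to FX$ of an open embedding $U\to X$ is the open embedding corresponding to $\eta_X^{-1}(|U|)\subseteq|FX|$. A $2$-morphism $\gamma:(F,\eta)\to(F',\eta')$ is a natural transformation $\gamma:F\to F'$ with $\gamma(\mathbb{A}^1)=\mathrm{Id}$ and $\eta'_X\circ|\gamma(X)|=\eta_X$ for each $X\in\mathbf{Esp}$. *)

(* Defs.v *)
From HB Require Import structures.
From mathcomp Require Import all_boot all_algebra all_classical.
From mathcomp Require Import topology wochoice.

Set Implicit Arguments.
Unset Strict Implicit.
Unset Printing Implicit Defensive.

Import GRing.Theory.

Local Open Scope classical_set_scope.
Local Open Scope ring_scope.

(* Small sets live in the universe of the carriers of topological spaces. *)
Definition smallType := Type@{Topological.axioms_.u0}.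

Record category := Category {
  obj :> Type;
  hom : obj -> obj -> Type;
  idm : forall X, hom X X;
  compm : forall X Y Z, hom Y Z -> hom X Y -> hom X Z;
  comp1m : forall X Y (f : hom X Y), compm (idm Y) f = f;
  compm1 : forall X Y (f : hom X Y), compm f (idm X) = f;
  compmA : forall X Y Z T (h : hom Z T) (g : hom Y Z) (f : hom X Y),
    compm h (compm g f) = compm (compm h g) f }.

Notation "g ∘ f" := (compm g f) (at level 40, left associativity).
Arguments idm {_} _.

Definition inverses (C : category) (X Y : C) (f : hom X Y) (g : hom Y X) :=
  g ∘ f = idm X /\ f ∘ g = idm Y.

Definition is_iso (C : category) (X Y : C) (f : hom X Y) :=
  exists g : hom Y X, inverses f g.

Definition eq_hom (C : category) (X Y : C) (e : X = Y) : hom X Y :=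
  match e in _ = Y return hom X Y with erefl => idm X end.

Record functor (C D : category) := Functor {
  fobj :> C -> D;
  fmap : forall X Y, hom X Y -> hom (fobj X) (fobj Y);
  fmap1 : forall X, fmap (idm X) = idm (fobj X);
  fmapM : forall X Y Z (g : hom Y Z) (f : hom X Y),
    fmap (g ∘ f) = fmap g ∘ fmap f }.
Arguments fmap {C D} _ {X Y} _.

Lemma comp_functor1 (C D E : category) (G : functor D E) (F : functor C D) X :
  fmap G (fmap F (idm X)) = idm (G (F X)).
Proof. by rewrite !fmap1. Qed.

Lemma comp_functorM (C D E : category) (G : functor D E) (F : functor C D)
    X Y Z (g : hom Y Z) (f : hom X Y) :
  fmap G (fmap F (g ∘ f)) = fmap G (fmap F g) ∘ fmap G (fmap F f).
Proof. by rewrite !fmapM. Qed.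

Definition comp_functor (C D E : category) (G : functor D E) (F : functor C D)
    : functor C E :=
  Functor (comp_functor1 G F) (comp_functorM G F).

Record nat_trans (C D : category) (F G : functor C D) := NatTrans {
  ncomp :> forall X, hom (F X) (G X);
  ncomp_nat : forall X Y (f : hom X Y),
    ncomp Y ∘ fmap F f = fmap G f ∘ ncomp X }.

(* [finite_set] would force the objects of every category to be small. *)
Definition finite_type (T : Type) :=
  exists (n : nat) (e : 'I_n -> T), forall x, exists i, e i = x.

Definition finite_category (J : category) :=
  finite_type J /\ forall i j : J, finite_type (hom i j).

Record cone (J C : category) (D : functor J C) := Cone {
  apex : C;
  leg : forall j, hom apex (D j);
  leg_nat : forall i j (u : hom i j), fmap D u ∘ leg i = leg j }.

Definition is_limit (J C : category) (D : functor J C) (c : cone D) :=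
  forall c' : cone D, exists! h : hom (apex c') (apex c),
    forall j, leg c j ∘ h = leg c' j.

Lemma map_cone_nat (J C C' : category) (D : functor J C) (F : functor C C')
    (c : cone D) i j (u : hom i j) :
  fmap (comp_functor F D) u ∘ fmap F (leg c i) = fmap F (leg c j).
Proof. by rewrite /= -fmapM leg_nat. Qed.

Definition map_cone (J C C' : category) (D : functor J C) (F : functor C C')
    (c : cone D) : cone (comp_functor F D) := Cone (map_cone_nat F c).

Definition has_finite_limits (C : category) :=
  forall (J : category) (D : functor J C), finite_category J ->
    exists c : cone D, is_limit c.

Definition preserves_finite_limits (C C' : category) (F : functor C C') :=
  forall (J : category) (D : functor J C) (c : cone D),
    finite_category J -> is_limit c -> is_limit (map_cone F c).

Record cocone (J C : category) (D : functor J C) := Cocone {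
  coapex : C;
  coleg : forall j, hom (D j) coapex;
  coleg_nat : forall i j (u : hom i j), coleg j ∘ fmap D u = coleg i }.

Definition is_colimit (J C : category) (D : functor J C) (c : cocone D) :=
  forall c' : cocone D, exists! h : hom (coapex c) (coapex c'),
    forall j, h ∘ coleg c j = coleg c' j.

Lemma map_cocone_nat (J C C' : category) (D : functor J C) (F : functor C C')
    (c : cocone D) i j (u : hom i j) :
  fmap F (coleg c j) ∘ fmap (comp_functor F D) u = fmap F (coleg c i).
Proof. by rewrite /= -fmapM coleg_nat. Qed.

Definition map_cocone (J C C' : category) (D : functor J C) (F : functor C C')
    (c : cocone D) : cocone (comp_functor F D) := Cocone (map_cocone_nat F c).

Definition is_initial (C : category) (X : C) :=
  forall Y : C, exists! f : hom X Y, True.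

Definition is_coproduct (C : category) (I : smallType) (X : I -> C) (Q : C)
    (inj : forall i, hom (X i) Q) :=
  forall (Y : C) (g : forall i, hom (X i) Y),
    exists! h : hom Q Y, forall i, h ∘ inj i = g i.

Definition preserves_coproducts (C C' : category) (F : functor C C') :=
  forall (I : smallType) (X : I -> C) (Q : C) (inj : forall i, hom (X i) Q),
    is_coproduct inj -> is_coproduct (fun i => fmap F (inj i)).

Definition is_pushout (C : category) (X0 X1 X2 Q : C)
    (f1 : hom X0 X1) (f2 : hom X0 X2) (q1 : hom X1 Q) (q2 : hom X2 Q) :=
  q1 ∘ f1 = q2 ∘ f2 /\
  forall (Y : C) (g1 : hom X1 Y) (g2 : hom X2 Y), g1 ∘ f1 = g2 ∘ f2 ->
    exists! h : hom Q Y, h ∘ q1 = g1 /\ h ∘ q2 = g2.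

Definition order_category (I : Type) (R : rel I)
    (Rxx : reflexive R) (Rtr : transitive R) : category.
Proof.
refine (@Category I (fun i j => R i j) Rxx (fun i j k v u => Rtr j i k u v)
          _ _ _); by move=> *; exact: Prop_irrelevance.
Defined.

Record sieve (C : category) (X : C) := Sieve {
  sieve_mem :> forall Y, hom Y X -> Prop;
  sieve_closed : forall Y Z (f : hom Y X) (g : hom Z Y),
    sieve_mem f -> sieve_mem (f ∘ g) }.

Definition max_sieve (C : category) (X : C) : sieve X :=
  @Sieve C X (fun _ _ => True) (fun _ _ _ _ _ => I).

Definition pull_sieve (C : category) (X Y : C) (h : hom Y X) (S : sieve X) :
  sieve Y.
Proof.
refine (@Sieve C Y (fun Z f => S Z (h ∘ f)) _).
by move=> Z T f g Shf; rewrite compmA; exact: sieve_closed.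
Defined.

Definition gen_sieve (C : category) (X Y : C) (f : hom X Y) : sieve Y.
Proof.
refine (@Sieve C Y (fun Z g => exists h : hom Z X, g = f ∘ h) _).
by move=> Z T _ k [h ->]; exists (h ∘ k); rewrite compmA.
Defined.

Definition grothendieck_topology (C : category)
    (J : forall X : C, sieve X -> Prop) :=
  [/\ forall X, J X (max_sieve X),
      forall X Y (h : hom Y X) (S : sieve X), J X S -> J Y (pull_sieve h S)
    & forall X (S T : sieve X), J X S ->
        (forall Y (f : hom Y X), S Y f -> J Y (pull_sieve f T)) -> J X T].

(* The presheaf [hom _ Z] satisfies the sheaf condition for the sieve [S]. *)
Definition sheaf_for (C : category) (Z X : C) (S : sieve X) :=
  forall s : (forall Y (f : hom Y X), S Y f -> hom Y Z),
    (forall Y Y' (f : hom Y X) (g : hom Y' Y) (Sf : S Y f) (Sfg : S Y' (f ∘ g)),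
       s Y' (f ∘ g) Sfg = s Y f Sf ∘ g) ->
    exists! t : hom X Z, forall Y (f : hom Y X) (Sf : S Y f), t ∘ f = s Y f Sf.

Definition subcanonical (C : category) (J : forall X : C, sieve X -> Prop) :=
  forall (Z X : C) (S : sieve X), J X S -> sheaf_for Z S.

Definition top_id (X : topologicalType) : continuousType X X := idfun.

Definition top_comp (X Y Z : topologicalType)
  (g : continuousType Y Z) (f : continuousType X Y) : continuousType X Z :=
  g \o f.

Definition Top : category.
Proof.
refine (@Category topologicalType continuousType top_id top_comp _ _ _);
  by move=> *; apply/continuousEP.
Defined.

Definition incl_map (X : topologicalType) (O : set X) :
  continuousType (set_type O) X := mkcts (@initial_continuous _ _ set_val).

(* A commutative monoid object as a natural commutative monoid structure on
   the presheaf [hom _ A]; by Yoneda, when [A * A] and a terminal object exist,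
   this is a multiplication [A * A -> A] (the sum of the two projections) and a
   unit. *)
Record monoid_object (C : category) (A : C) := MonoidObject {
  madd : forall X : C, hom X A -> hom X A -> hom X A;
  mzero : forall X : C, hom X A;
  maddA : forall X, associative (@madd X);
  maddC : forall X, commutative (@madd X);
  madd0 : forall X, left_id (mzero X) (@madd X);
  madd_comp : forall X Y (f g : hom X A) (h : hom Y X),
    madd f g ∘ h = madd (f ∘ h) (g ∘ h);
  mzero_comp : forall X Y (h : hom Y X), mzero X ∘ h = mzero Y }.
Arguments mzero {C A} _ _.

Record space_data := SpaceData {
  sp_cat :> category;
  sp_top : functor sp_cat Top;
  A1 : sp_cat;
  A1_monoid : monoid_object A1 }.
Arguments A1 : clear implicits.

Section SpaceData.
Variable E : space_data.
Local Notation "`| X |" := (sp_top E X : topologicalType).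
Local Notation "`| f |_1" := (fmap (sp_top E) f : continuousType _ _).

(* [j : U -> X] represents the subpresheaf [P] of [hom _ X]. *)
Definition represents (X : E) (P : forall Y : E, hom Y X -> Prop)
    (U : E) (j : hom U X) :=
  (forall Y (g : hom Y U), P Y (j ∘ g)) /\
  forall Y (f : hom Y X), P Y f -> exists! g : hom Y U, j ∘ g = f.

(* This determines [j] up to a unique isomorphism over [X]; that the underlying
   map is then the inclusion of [O] is part of [open_subspaces_axiom]. *)
Definition open_embedding_onto (X : E) (O : set `|X|) (U : E) (j : hom U X) :=
  open O /\ represents (fun Y f => range `|f|_1 `<=` O) j.

Definition open_embedding (U X : E) (j : hom U X) :=
  exists O : set `|X|, open_embedding_onto O j.

Definition zariski_cover (X Y : E) (f : hom X Y) :=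
  range `|f|_1 = setT /\
  forall x : `|X|, exists (U : E) (j : hom U X),
    [/\ open_embedding j, range `|j|_1 x & open_embedding (f ∘ j)].

Definition finite_limits_axiom := has_finite_limits E.

Definition coproducts_axiom := forall (I : smallType) (X : I -> E),
  exists (Q : E) (inj : forall i, hom (X i) Q), is_coproduct inj.

Definition top_coproducts_axiom := preserves_coproducts (sp_top E).

Definition open_subspaces_axiom :=
  (forall (X : E) (O : set `|X|), open O ->
    exists (U : E) (j : hom U X), open_embedding_onto O j /\
      exists phi : @hom Top `|U| (set_type O : topologicalType),
        is_iso phi /\ @compm Top _ _ _ (incl_map O) phi = `|j|_1) /\
  (forall X : E, [set: `|X|] = set0 -> is_initial X).

Definition zariski_covers_axiom := exists J : (forall X : E, sieve X -> Prop),
  [/\ grothendieck_topology J, subcanonical J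
    & forall (X Y : E) (f : hom X Y), zariski_cover f -> J Y (gen_sieve f)].

Definition coproduct_inclusions_axiom := forall (I : smallType) (X : I -> E) (Q : E)
    (inj : forall i, hom (X i) Q),
  is_coproduct inj -> forall i, open_embedding (inj i).

Definition zariski_gluing_axiom :=
  (forall (X0 X1 X2 : E) (f1 : hom X0 X1) (f2 : hom X0 X2),
    open_embedding f1 -> open_embedding f2 ->
    exists (Q : E) (q1 : hom X1 Q) (q2 : hom X2 Q),
      [/\ is_pushout f1 f2 q1 q2,
          [/\ open_embedding q1, open_embedding q2 & open_embedding (q1 ∘ f1)]
        & @is_pushout Top _ _ _ _ `|f1|_1 `|f2|_1 `|q1|_1 `|q2|_1]) /\
  (forall (I : smallType) (R : rel I) (Rxx : reflexive R) (Rtr : transitive R)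
      (D : functor (order_category Rxx Rtr) E),
    well_order R ->
    (forall i j (u : hom i j), open_embedding (fmap D u)) ->
    exists c : cocone D,
      [/\ is_colimit c, forall i, open_embedding (coleg c i)
        & is_colimit (map_cocone (sp_top E) c)]).

Definition units_axiom := exists (G : E) (j : hom G (A1 E)),
  represents (fun Y f => exists g, madd (A1_monoid E) f g = mzero (A1_monoid E) Y) j
  /\ open_embedding j.

Definition category_of_spaces :=
  [/\ [/\ finite_limits_axiom, coproducts_axiom, top_coproducts_axiom & open_subspaces_axiom],
      zariski_covers_axiom, coproduct_inclusions_axiom, zariski_gluing_axiom & units_axiom].

End SpaceData.

Record one_morphism (E E' : space_data) := OneMorphism {
  om_fun :> functor E E';
  om_eta : nat_trans (comp_functor (sp_top E') om_fun) (sp_top E);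
  om_lim : preserves_finite_limits om_fun;
  om_coprod : preserves_coproducts om_fun;
  om_A1 : om_fun (A1 E) = A1 E';
  (* As [om_fun] preserves finite products, [om_madd] and [om_mzero] say that
     it maps the multiplication and the unit of [A1 E] to those of [A1 E']. *)
  om_madd : forall (X : E) (f g : hom X (A1 E)),
    eq_hom om_A1 ∘ fmap om_fun (madd (A1_monoid E) f g)
    = madd (A1_monoid E') (eq_hom om_A1 ∘ fmap om_fun f)
                          (eq_hom om_A1 ∘ fmap om_fun g);
  om_mzero : forall X : E,
    eq_hom om_A1 ∘ fmap om_fun (mzero (A1_monoid E) X)
    = mzero (A1_monoid E') (om_fun X);
  om_open : forall (X : E) (O : set (sp_top E X : topologicalType))
      (U : E) (j : hom U X), open_embedding_onto O j ->
    open_embedding_onto ((om_eta X : continuousType _ _) @^-1` O)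
      (fmap om_fun j) }.

Record two_morphism (E E' : space_data) (F G : one_morphism E E') :=
  TwoMorphism {
  tm_nat :> nat_trans F G;
  (* [gamma (A1) = Id] once [F A1] and [G A1] are both identified with [A1']. *)
  tm_A1 : eq_hom (om_A1 G) ∘ tm_nat (A1 E) = eq_hom (om_A1 F);
  tm_eta : forall X : E,
    om_eta G X ∘ fmap (sp_top E') (tm_nat X) = om_eta F X }.

Definition invertible (E E' : space_data) (F G : one_morphism E E')
    (gamma : two_morphism F G) :=
  exists delta : two_morphism G F, forall X, inverses (gamma X) (delta X).

Definition unit (P : nmodType) (x : P) := exists y, x + y = 0.

Definition local (P Q : nmodType) (h : P -> Q) :=
  forall x, ~ unit x -> ~ unit (h x).

Definition finitely_generated (P : nmodType) :=
  exists (n : nat) (g : 'I_n -> P), forall x, exists c : 'I_n -> nat,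
    x = \sum_i g i *+ c i.

(* A commutative monoid up to a congruence; see [quot_monoid]. *)
Record premonoid := Premonoid {
  pm_sort :> Type;
  pm_eqv : pm_sort -> pm_sort -> Prop;
  pm_add : pm_sort -> pm_sort -> pm_sort;
  pm_zero : pm_sort;
  pm_refl : forall x, pm_eqv x x;
  pm_sym : forall x y, pm_eqv x y -> pm_eqv y x;
  pm_trans : forall x y z, pm_eqv x y -> pm_eqv y z -> pm_eqv x z;
  pm_congr : forall x y z, pm_eqv x y -> pm_eqv (pm_add x z) (pm_add y z);
  pm_addA : forall x y z,
    pm_eqv (pm_add x (pm_add y z)) (pm_add (pm_add x y) z);
  pm_addC : forall x y, pm_eqv (pm_add x y) (pm_add y x);
  pm_add0 : forall x, pm_eqv (pm_add pm_zero x) x }.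

HB.instance Definition _ (M : premonoid) := gen_eqMixin (pm_sort M).
HB.instance Definition _ (M : premonoid) := gen_choiceMixin (pm_sort M).

Section QuotMonoid.
Variable M : premonoid.

Let eqv (x y : M) : bool := `[<pm_eqv x y>].
Let eqv_refl : reflexive eqv.
Proof. by move=> x; apply/asboolP/pm_refl. Qed.
Let eqv_sym : symmetric eqv.
Proof. by move=> x y; apply/asboolP/asboolP; exact: pm_sym. Qed.
Let eqv_trans : transitive eqv.
Proof.
by move=> y x z /asboolP xy /asboolP yz; apply/asboolP; exact: pm_trans yz.
Qed.
Canonical pm_equiv := EquivRel eqv eqv_refl eqv_sym eqv_trans.

Definition quot_monoid := {eq_quot pm_equiv}%qT.
HB.instance Definition _ := Choice.on quot_monoid.

Definition cls (x : M) : quot_monoid := (\pi_quot_monoid x)%qT.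

Lemma clsP x y : cls x = cls y <-> pm_eqv x y.
Proof.
split=> [/eqP|xy]; first by rewrite eqmodE => /asboolP.
by apply/eqP; rewrite eqmodE; apply/asboolP.
Qed.

Lemma cls_surj (u : quot_monoid) : exists x, u = cls x.
Proof. by exists (repr u); rewrite /cls reprK. Qed.

Let qadd (u v : quot_monoid) : quot_monoid := cls (pm_add (repr u) (repr v)).

Let congr2 (x x' y y' : M) :
  pm_eqv x x' -> pm_eqv y y' -> pm_eqv (pm_add x y) (pm_add x' y').
Proof.
move=> xx' yy'; apply: (pm_trans (pm_congr y xx')).
apply: (pm_trans (pm_addC _ _)); apply: (pm_trans (pm_congr x' yy')).
exact: pm_addC.
Qed.

Let repr_cls (x : M) : pm_eqv (repr (cls x)) x.
Proof. by apply/clsP; rewrite /cls reprK. Qed.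

Let qaddE x y : qadd (cls x) (cls y) = cls (pm_add x y).
Proof. by apply/clsP/congr2; exact: repr_cls. Qed.

Let qaddA : associative qadd.
Proof.
move=> u v w; have [x ->] := cls_surj u; have [y ->] := cls_surj v.
have [z ->] := cls_surj w.
by rewrite !qaddE; apply/clsP/pm_addA.
Qed.

Let qaddC : commutative qadd.
Proof.
move=> u v; have [x ->] := cls_surj u; have [y ->] := cls_surj v.
by rewrite !qaddE; apply/clsP/pm_addC.
Qed.

Let qadd0 : left_id (cls (pm_zero M)) qadd.
Proof.
by move=> u; have [x ->] := cls_surj u; rewrite qaddE; apply/clsP/pm_add0.
Qed.

HB.instance Definition _ := GRing.isNmodule.Build quot_monoid qaddA qaddC qadd0.

Lemma cls0 : cls (pm_zero M) = 0. Proof. by []. Qed.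

Lemma clsD x y : cls (pm_add x y) = cls x + cls y.
Proof. by rewrite [RHS]qaddE. Qed.

End QuotMonoid.

Record opens (X : topologicalType) := Opens {
  oset :> set X;
  oset_open : open oset }.

Lemma opens_eq (X : topologicalType) (U V : opens X) :
  (U = V :> set X) -> U = V.
Proof.
case: U V => U oU [V oV] /= UV; rewrite -UV in oV *.
by congr Opens; exact: Prop_irrelevance.
Qed.

Definition oT (X : topologicalType) : opens X := Opens openT.
Definition oI (X : topologicalType) (U V : opens X) : opens X :=
  Opens (openI (oset_open U) (oset_open V)).
Lemma oIl (X : topologicalType) (U V : opens X) : oI U V `<=` U.
Proof. by move=> x []. Qed.
Lemma oIr (X : topologicalType) (U V : opens X) : oI U V `<=` V.
Proof. by move=> x []. Qed.
Lemma subo (X : topologicalType) (U : opens X) : U `<=` U.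
Proof. by []. Qed.
Lemma suboT (X : topologicalType) (U : opens X) : U `<=` oT X.
Proof. by []. Qed.

Definition opre (X Y : topologicalType) (f : continuousType X Y) (V : opens Y) :
  opens X := Opens ((continuousP f).1 cts_fun V (oset_open V)).

Record presheaf (X : topologicalType) := Presheaf {
  psec :> opens X -> nmodType;
  res : forall U V : opens X, V `<=` U -> psec U -> psec V;
  res_add : forall (U V : opens X) (VU : V `<=` U), GRing.nmod_morphism (res VU);
  res_id : forall (U : opens X) (UU : U `<=` U) (s : psec U), res UU s = s;
  res_comp : forall (U V W : opens X) (VU : V `<=` U) (WV : W `<=` V)
    (WU : W `<=` U) (s : psec U), res WV (res VU s) = res WU s }.

Lemma subpre (X Y : topologicalType) (f : continuousType X Y) (V : opens Y) :
  opre f V `<=` f @^-1` V.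
Proof. by []. Qed.

Section PresheafTheory.
Variables (X : topologicalType) (F : presheaf X).
Implicit Types U V W : opens X.

Lemma res0 U V (VU : V `<=` U) : res VU (0 : F U) = 0.
Proof. by case: (res_add F VU). Qed.

Lemma resD U V (VU : V `<=` U) (s t : F U) : res VU (s + t) = res VU s + res VU t.
Proof. by case: (res_add F VU). Qed.

Lemma res_res U V W (VU : V `<=` U) (WV : W `<=` V) (s : F U) :
  res WV (res VU s) = res (subset_trans WV VU) s.
Proof. exact: res_comp. Qed.

Lemma res_irr U V (VU VU' : V `<=` U) (s : F U) : res VU s = res VU' s.
Proof. by congr res; exact: Prop_irrelevance. Qed.

End PresheafTheory.

(* Two sections agree on an overlap [U `&` V] iff they agree on every open set
   contained in it. *)
Definition is_sheaf (X : topologicalType) (F : presheaf X) :=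
  forall (U : opens X) (I : Type) (V : I -> opens X) (VU : forall i, V i `<=` U),
    U `<=` \bigcup_i V i ->
  forall s : (forall i, F (V i)),
    (forall i j (W : opens X) (Wi : W `<=` V i) (Wj : W `<=` V j),
       res Wi (s i) = res Wj (s j)) ->
  exists! t : F U, forall i, res (VU i) t = s i.

Record lms := Lms {
  lms_top :> topologicalType;
  lms_sh : presheaf lms_top;
  lms_sheafP : is_sheaf lms_sh }.

Section Stalk.
Variables (X : topologicalType) (F : presheaf X) (x : X).

Record local_section := LocalSection {
  ls_dom : opens X;
  ls_in : oset ls_dom x;
  ls_sec : F ls_dom }.

Definition ls_eqv (s t : local_section) :=
  exists (W : opens X) (Ws : W `<=` ls_dom s) (Wt : W `<=` ls_dom t),
    oset W x /\ res Ws (ls_sec s) = res Wt (ls_sec t).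

Definition ls_add (s t : local_section) : local_section :=
  @LocalSection (oI (ls_dom s) (ls_dom t)) (conj (ls_in s) (ls_in t))
    (res (@oIl _ _ _) (ls_sec s) + res (@oIr _ _ _) (ls_sec t)).

Definition ls_zero : local_section := @LocalSection (oT X) Logic.I 0.

Let ls_refl s : ls_eqv s s.
Proof. by exists (ls_dom s), (@subo _ _), (@subo _ _); split=> //; exact: ls_in. Qed.

Let ls_sym s t : ls_eqv s t -> ls_eqv t s.
Proof. by move=> [W [Ws [Wt [Wx st]]]]; exists W, Wt, Ws. Qed.

Let ls_trans s t u : ls_eqv s t -> ls_eqv t u -> ls_eqv s u.
Proof.
move=> [W [Ws [Wt [Wx st]]]] [W' [W't [W'u [W'x tu]]]].
exists (oI W W'), (subset_trans (@oIl _ _ _) Ws),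
  (subset_trans (@oIr _ _ _) W'u); split=> //.
rewrite -!res_res st -tu !res_res; exact: res_irr.
Qed.

Let ls_congr s t u : ls_eqv s t -> ls_eqv (ls_add s u) (ls_add t u).
Proof.
move=> [W [Ws [Wt [Wx st]]]].
have Wsu : oI W (ls_dom u) `<=` ls_dom (ls_add s u) by move=> y [/Ws].
have Wtu : oI W (ls_dom u) `<=` ls_dom (ls_add t u) by move=> y [/Wt].
exists (oI W (ls_dom u)), Wsu, Wtu; split; first by split=> //; exact: ls_in.
rewrite !resD !res_res; congr (_ + _); last exact: res_irr.
rewrite (res_irr _ (subset_trans (@oIl _ _ _) Ws)) -res_res st res_res.
exact: res_irr.
Qed.

Let ls_eqvS s t (st : ls_dom t `<=` ls_dom s) :
  res st (ls_sec s) = ls_sec t -> ls_eqv s t.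
Proof.
move=> e; exists (ls_dom t), st, (@subo _ _); split; first exact: ls_in.
by rewrite e res_id.
Qed.

Let ls_addA s t u : ls_eqv (ls_add s (ls_add t u)) (ls_add (ls_add s t) u).
Proof.
have sub : ls_dom (ls_add (ls_add s t) u) `<=` ls_dom (ls_add s (ls_add t u)).
  by move=> y [[]].
apply: (@ls_eqvS _ _ sub); rewrite /= !resD addrA !res_res.
by congr (_ + _ + _); exact: res_irr.
Qed.

Let ls_addC s t : ls_eqv (ls_add s t) (ls_add t s).
Proof.
have sub : ls_dom (ls_add t s) `<=` ls_dom (ls_add s t) by move=> y [].
apply: (@ls_eqvS _ _ sub); rewrite /= resD addrC !res_res.
by congr (_ + _); exact: res_irr.
Qed.

Let ls_add0 s : ls_eqv (ls_add ls_zero s) s.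
Proof.
have sub : ls_dom s `<=` ls_dom (ls_add ls_zero s) by [].
by apply: (@ls_eqvS _ _ sub); rewrite /= resD !res0 add0r res_res res_id.
Qed.

Definition stalk_premonoid : premonoid :=
  Premonoid ls_refl ls_sym ls_trans ls_congr ls_addA ls_addC ls_add0.

Definition stalk : nmodType := quot_monoid stalk_premonoid.

Definition germ (U : opens X) (Ux : oset U x) (s : F U) : stalk :=
  @cls stalk_premonoid (LocalSection Ux s).

Lemma germ_surj (g : stalk) :
  exists (U : opens X) (Ux : oset U x) (s : F U), g = germ Ux s.
Proof. by have [[U Ux s] ->] := @cls_surj stalk_premonoid g; exists U, Ux, s. Qed.

Lemma germP (U V : opens X) (Ux : oset U x) (Vx : oset V x) (s : F U) (t : F V) :
  germ Ux s = germ Vx t <->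
  exists (W : opens X) (WU : W `<=` U) (WV : W `<=` V),
    oset W x /\ res WU s = res WV t.
Proof. exact: clsP. Qed.

Lemma germ_res (U V : opens X) (VU : V `<=` U) (Ux : oset U x) (Vx : oset V x) (s : F U) :
  germ Vx (res VU s) = germ Ux s.
Proof.
apply/germP; exists V, (@subo _ _), VU; split=> //; exact: res_id.
Qed.

Lemma germ0 (U : opens X) (Ux : oset U x) : germ Ux (0 : F U) = 0.
Proof.
apply/germP; exists U, (@subo _ _), (@suboT _ _).
by split=> //; rewrite !res0.
Qed.

Lemma germD (U : opens X) (Ux : oset U x) (s t : F U) :
  germ Ux (s + t) = germ Ux s + germ Ux t.
Proof.
rewrite -[RHS](@clsD stalk_premonoid) /=; apply/germP.
have UU : U `<=` oI U U by [].
exists U, (@subo _ _), UU; split=> //.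
by rewrite !resD !res_res; congr (_ + _); exact: res_irr.
Qed.

End Stalk.

Section LmsMorphism.
Variables X Y : lms.

(* A map from the inverse image sheaf of [lms_sh Y] to [lms_sh X] is a
   compatible family of homomorphisms [lms_sh Y V -> lms_sh X U], for [U] and
   [V] open with [f U] contained in [V]. *)
Record pre_lms_hom := PreLmsHom {
  lh_fun : continuousType X Y;
  lh_sh : forall (V : opens Y) (U : opens X), U `<=` lh_fun @^-1` V ->
    lms_sh Y V -> lms_sh X U;
  lh_add : forall (V : opens Y) (U : opens X) (UV : U `<=` lh_fun @^-1` V), GRing.nmod_morphism (lh_sh UV);
  lh_res : forall (V V' : opens Y) (U U' : opens X)
    (UV : U `<=` lh_fun @^-1` V) (UV' : U' `<=` lh_fun @^-1` V')
    (V'V : V' `<=` V) (U'U : U' `<=` U) (s : lms_sh Y V),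
    res U'U (lh_sh UV s) = lh_sh UV' (res V'V s) }.

Section StalkMap.
Variables (f : pre_lms_hom) (x : X).

Definition stalk_map (g : stalk (lms_sh Y) (lh_fun f x)) : stalk (lms_sh X) x :=
  let s := repr g in
  @germ X (lms_sh X) x (opre (lh_fun f) (ls_dom s)) (ls_in s)
    (lh_sh (@subpre _ _ (lh_fun f) _) (ls_sec s)).

Lemma stalk_mapE (V : opens Y) (U : opens X) (Vx : oset V (lh_fun f x))
    (Ux : oset U x) (UV : U `<=` lh_fun f @^-1` V) (s : lms_sh Y V) :
  stalk_map (germ Vx s) = germ Ux (lh_sh UV s).
Proof.
rewrite /stalk_map; set r := repr _.
have /germP[W [WV [Wr [Wx sr]]]] : germ Vx s = germ (ls_in r) (ls_sec r).
  have -> : germ (ls_in r) (ls_sec r) = @cls (stalk_premonoid _ _) r by case: (r).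
  by rewrite /cls /r reprK.
apply/germP; pose W' := oI (opre (lh_fun f) W) U.
have W'W : W' `<=` lh_fun f @^-1` W by move=> y [].
have W'r : W' `<=` opre (lh_fun f) (ls_dom r) by move=> y /W'W /Wr.
exists W', W'r, (@oIr _ _ _); split=> //.
by rewrite (lh_res _ W'W Wr) (lh_res _ W'W WV) sr.
Qed.

End StalkMap.

Record lms_hom := LmsHom {
  lms_pre :> pre_lms_hom;
  lms_local : forall x, local (@stalk_map lms_pre x) }.

Lemma lh_irr (f : pre_lms_hom) (V : opens Y) (U : opens X)
    (UV UV' : U `<=` lh_fun f @^-1` V) (s : lms_sh Y V) :
  lh_sh UV s = lh_sh UV' s.
Proof. by congr lh_sh; exact: Prop_irrelevance. Qed.

Lemma pre_lms_hom_eq (f g : pre_lms_hom) :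
  (forall x, lh_fun f x = lh_fun g x) ->
  (forall (V : opens Y) (U : opens X) (fUV : U `<=` lh_fun f @^-1` V)
     (gUV : U `<=` lh_fun g @^-1` V) (s : lms_sh Y V),
     lh_sh fUV s = lh_sh gUV s) ->
  f = g.
Proof.
case: f g => f fs fa fr [g gs ga gr] /= /continuousEP fg; case: _ / fg gs ga gr.
move=> gs ga gr e; have fsgs : fs = gs.
  by apply: functional_extensionality_dep => V;
     apply: functional_extensionality_dep => U;
     apply: functional_extensionality_dep => UV; apply/funext => s; exact: e.
case: _ / fsgs ga gr {e} => ga gr.
by congr PreLmsHom; exact: Prop_irrelevance.
Qed.

Lemma lms_hom_eq (f g : lms_hom) :
  (forall x, lh_fun f x = lh_fun g x) ->
  (forall (V : opens Y) (U : opens X) (fUV : U `<=` lh_fun f @^-1` V)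
     (gUV : U `<=` lh_fun g @^-1` V) (s : lms_sh Y V),
     lh_sh fUV s = lh_sh gUV s) ->
  f = g.
Proof.
case: f g => f fl [g gl] /= fg /(pre_lms_hom_eq fg) e.
by case: _ / e gl => gl; congr LmsHom; exact: Prop_irrelevance.
Qed.

End LmsMorphism.

Section LmsId.
Variable X : lms.

Definition pre_lms_id : pre_lms_hom X X.
Proof.
refine (@PreLmsHom X X idfun (fun V U UV => @res _ (lms_sh X) V U UV) _ _).
  by move=> V U UV; exact: res_add.
by move=> V V' U U' *; rewrite !res_res; exact: res_irr.
Defined.

Lemma lms_id_local x : local (@stalk_map _ _ pre_lms_id x).
Proof.
move=> g; have [U [Ux [s ->]]] := germ_surj g.
by rewrite (stalk_mapE (f := pre_lms_id) Ux Ux (@subo _ U)) /= res_id.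
Qed.

Definition lms_id : lms_hom X X := LmsHom lms_id_local.
End LmsId.

Section LmsComp.
Variables (X Y Z : lms) (g : lms_hom Y Z) (f : lms_hom X Y).

Definition pre_lms_comp : pre_lms_hom X Z.
Proof.
refine (@PreLmsHom X Z (lh_fun g \o lh_fun f)
  (fun W U (UW : U `<=` lh_fun f @^-1` opre (lh_fun g) W) s =>
     lh_sh UW (lh_sh (@subpre _ _ (lh_fun g) W) s)) _ _).
  move=> V U UV.
  have [f0 fD] := lh_add (UV : U `<=` lh_fun f @^-1` opre (lh_fun g) V).
  have [g0 gD] := lh_add (@subpre _ _ (lh_fun g) V).
  by split=> [|s t] /=; [rewrite g0 f0|rewrite gD fD].
move=> V V' U U' UV UV' V'V U'U s /=.
have VV : opre (lh_fun g) V' `<=` opre (lh_fun g) V by move=> y /V'V.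
rewrite (lh_res (UV : U `<=` lh_fun f @^-1` opre (lh_fun g) V)
  (UV' : U' `<=` lh_fun f @^-1` opre (lh_fun g) V') VV).
by rewrite (lh_res _ (@subpre _ _ (lh_fun g) V') V'V).
Defined.

Lemma lms_comp_local x : local (@stalk_map _ _ pre_lms_comp x).
Proof.
move=> h; have [V [Vx [s ->]]] := germ_surj h.
pose VY := opre (lh_fun g) V; pose VX := opre (lh_fun f) VY.
rewrite (stalk_mapE (f := pre_lms_comp) (U := VX) Vx Vx (@subpre _ _ _ _)) /=.
move=> /(lms_local (l := g)).
rewrite (stalk_mapE (f := g) (U := VY) Vx Vx (@subpre _ _ _ _)).
move=> /(lms_local (l := f)).
by rewrite (stalk_mapE (f := f) (V := VY) (U := VX) Vx Vx (@subpre _ _ _ _)).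
Qed.

Definition lms_comp : lms_hom X Z := LmsHom lms_comp_local.
End LmsComp.

(* Two compositions that go through equal open sets agree. *)
Lemma lh_eqr (X Y : lms) (f : pre_lms_hom X Y) (V V' : opens Y) (U : opens X)
    (UV : U `<=` lh_fun f @^-1` V) (UV' : U `<=` lh_fun f @^-1` V')
    (V'V : V' `<=` V) (s : lms_sh Y V) :
  lh_sh UV' (res V'V s) = lh_sh UV s.
Proof. by rewrite -(lh_res UV UV' V'V (@subo _ _)) res_id. Qed.

Lemma lh_eql (X Y : lms) (f : pre_lms_hom X Y) (V : opens Y) (U U' : opens X)
    (UV : U `<=` lh_fun f @^-1` V) (UV' : U' `<=` lh_fun f @^-1` V)
    (U'U : U' `<=` U) (s : lms_sh Y V) :
  res U'U (lh_sh UV s) = lh_sh UV' s.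
Proof. by rewrite (lh_res UV UV' (@subo _ _)) res_id. Qed.

Definition LMS : category.
Proof.
refine (@Category lms lms_hom lms_id lms_comp _ _ _).
- by move=> X Y f; apply: lms_hom_eq => //= V U UV UV' s; exact: lh_eqr.
- by move=> X Y f; apply: lms_hom_eq => //= V U UV UV' s; exact: lh_eql.
move=> X Y Z T h g f; apply: lms_hom_eq => //= W U UW UW' s.
pose V := opre (lh_fun g) (opre (lh_fun h) W).
have VV : opre (lh_fun h \o lh_fun g) W `<=` V by [].
rewrite -(@lh_eqr _ _ f V (opre (lh_fun h \o lh_fun g) W) U UW UW' VV).
by congr lh_sh; exact: lh_eql.
Defined.

Section Restriction.
Variables (X : lms) (U : opens X).

Lemma set_val_open (V : opens (set_type U)) : open (set_val @` V).
Proof.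
case: V => V /= [A oA AV].
suff -> : set_val @` V = A `&` U by apply: openI => //; exact: oset_open.
rewrite -AV; apply/seteqP; split=> [_ [y Ay <-]|x [Ax Ux]].
  by split=> //; exact: set_valP.
by exists (SigSub (mem_set Ux)).
Qed.

Definition oimg (V : opens (set_type U)) : opens X := Opens (set_val_open V).

Lemma oimgS (V W : opens (set_type U)) : W `<=` V -> oimg W `<=` oimg V.
Proof. exact: image_subset. Qed.

Lemma oimgP (V W : opens (set_type U)) : oimg W `<=` oimg V -> W `<=` V.
Proof.
by move=> WV y Wy; have [z Vz /val_inj <-] := WV _ (imageP set_val Wy).
Qed.

Definition restr_presheaf : presheaf (set_type U).
Proof.
refine (@Presheaf (set_type U) (fun V => lms_sh X (oimg V))
  (fun V W WV s => res (oimgS WV) s) _ _ _).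
- by move=> V W WV; exact: res_add.
- by move=> V VV s; exact: res_id.
- by move=> V W T WV TW TV s; exact: res_comp.
Defined.

Lemma restr_sheafP : is_sheaf restr_presheaf.
Proof.
move=> V I W WV VW s sW.
have cov : oimg V `<=` \bigcup_i oimg (W i).
  by move=> _ [y /VW[i _ Wy] <-]; exists i => //; exists y.
apply: (@lms_sheafP X (oimg V) I (fun i => oimg (W i))
  (fun i => oimgS (WV i)) cov s) => i j T Ti Tj.
have TE : T = oimg (opre (incl_map U) T).
  apply: opens_eq; apply/seteqP; split=> [x Tx|_ [y Ty <-] //].
  by have [y _ yx] := Ti x Tx; exists y => //; rewrite -yx in Tx.
rewrite TE in Ti Tj *.
have := sW i j _ (oimgP Ti) (oimgP Tj) => /= e.
by rewrite (res_irr Ti (oimgS (oimgP Ti))) e; exact: res_irr.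
Qed.

Definition restr_lms : lms := Lms restr_sheafP.
End Restriction.

Record submonoid (P : nmodType) := Submonoid {
  sm_set :> set P;
  sm0 : sm_set 0;
  smD : forall x y, sm_set x -> sm_set y -> sm_set (x + y) }.

Section Localization.
Variables (P : nmodType) (S : submonoid P).

Record fraction := Fraction {
  fnum : P;
  fden : P;
  fdenP : sm_set S fden }.

Definition frac_eqv (a b : fraction) := exists u, sm_set S u /\
  u + (fnum a + fden b) = u + (fnum b + fden a).

Definition frac_add (a b : fraction) :=
  @Fraction (fnum a + fnum b) _ (smD (fdenP a) (fdenP b)).

Let frac_refl a : frac_eqv a a.
Proof. by exists 0; split=> //; exact: sm0. Qed.

Let frac_sym a b : frac_eqv a b -> frac_eqv b a.
Proof. by move=> [u [Su e]]; exists u. Qed.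

Let frac_trans a b c : frac_eqv a b -> frac_eqv b c -> frac_eqv a c.
Proof.
move=> [u [Su e]] [v [Sv f]]; exists (u + v + fden b); split.
  by apply: smD; [exact: smD|exact: fdenP].
rewrite !addrA (ACl ((2*5)*(1*(4*3)))%AC) /= e.
rewrite !addrA (ACl ((3*5)*(1*(4*2)))%AC) /= f.
by rewrite !addrA (ACl (1*3*5*4*2)%AC).
Qed.

Let frac_congr a b c : frac_eqv a b -> frac_eqv (frac_add a c) (frac_add b c).
Proof.
move=> [u [Su e]]; exists u; split=> //=.
rewrite !addrA (ACl ((1*(2*4))*3*5)%AC) /= e.
by rewrite !addrA (ACl (1*2*4*3*5)%AC).
Qed.

Let frac_eq a b : fnum a = fnum b -> fden a = fden b -> frac_eqv a b.
Proof. by move=> e f; exists 0; split; [exact: sm0|rewrite e f]. Qed.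

Let frac_addA a b c :
  frac_eqv (frac_add a (frac_add b c)) (frac_add (frac_add a b) c).
Proof. by apply: frac_eq => /=; rewrite addrA. Qed.

Let frac_addC a b : frac_eqv (frac_add a b) (frac_add b a).
Proof. by apply: frac_eq => /=; rewrite addrC. Qed.

Let frac_add0 a : frac_eqv (frac_add (Fraction 0 (sm0 S)) a) a.
Proof. by apply: frac_eq => /=; rewrite add0r. Qed.

Definition localization_premonoid : premonoid :=
  Premonoid frac_refl frac_sym frac_trans frac_congr
    frac_addA frac_addC frac_add0.

Definition localization : nmodType := quot_monoid localization_premonoid.

Definition frac (a s : P) (Ss : sm_set S s) : localization :=
  @cls localization_premonoid (Fraction a Ss).

Lemma frac_surj (g : localization) :
  exists (a s : P) (Ss : sm_set S s), g = frac a Ss.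
Proof.
have [[a s Ss] ->] := @cls_surj localization_premonoid g.
by exists a, s, Ss.
Qed.

Lemma fracP (a b s t : P) (Ss : sm_set S s) (St : sm_set S t) :
  frac a Ss = frac b St <->
  exists u, sm_set S u /\ u + (a + t) = u + (b + s).
Proof. exact: clsP. Qed.

Lemma fracD (a b s t : P) (Ss : sm_set S s) (St : sm_set S t) :
  frac a Ss + frac b St = frac (a + b) (smD Ss St).
Proof. by rewrite -(@clsD localization_premonoid). Qed.

Lemma frac00 : frac 0 (sm0 S) = 0.
Proof. by []. Qed.

End Localization.

Record spec (P : nmodType) := Spec {
  prime_set :> set P;
  prime_ideal : forall x y, prime_set x -> prime_set (x + y);
  prime0 : ~ prime_set 0;
  primeD : forall x y, ~ prime_set x -> ~ prime_set y -> ~ prime_set (x + y) }.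

Section Spectrum.
Variable P : nmodType.

HB.instance Definition _ := gen_eqMixin (spec P).
HB.instance Definition _ := gen_choiceMixin (spec P).

Definition basic_set (p : P) : set (spec P) := [set q | ~ prime_set q p].

(* The topology with basis the [basic_set p]. *)
Definition spec_open : set_system (spec P) :=
  [set O | forall q, O q -> exists p, basic_set p q /\ basic_set p `<=` O].

Lemma spec_openT : spec_open setT.
Proof. by move=> q _; exists 0; split=> //; exact: prime0. Qed.

Lemma spec_openI : setI_closed spec_open.
Proof.
move=> A B oA oB q [/oA[a [qa aA]] /oB[b [qb bB]]].
exists (a + b); split; first exact: primeD.
move=> r rab; split; [apply: aA|apply: bB] => rx; apply: rab.
  exact: prime_ideal.
by rewrite addrC; exact: prime_ideal.
Qed.

Lemma spec_open_bigU (I : Type) (f : I -> set (spec P)) :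
  (forall i, spec_open (f i)) -> spec_open (\bigcup_i f i).
Proof.
move=> of_ q [i _ /of_[p [qp pf]]]; exists p; split=> //.
by move=> r /pf; exists i.
Qed.

HB.instance Definition _ := isOpenTopological.Build (spec P)
  spec_openT spec_openI spec_open_bigU.

Lemma spec_openE (O : set (spec P)) : open O = spec_open O.
Proof. by []. Qed.

Lemma open_basic (p : P) : open (basic_set p).
Proof. by rewrite spec_openE => q qp; exists p; split. Qed.

Definition basic_open (p : P) : opens (spec P) := Opens (@open_basic p).

Definition prime_compl (q : spec P) : submonoid P :=
  @Submonoid P (~` q) (prime0 (s := q)) (@primeD P q).

(* Sections over [U] : families of elements of the localizations at the points
   of [U] that are locally a constant fraction. *)
Definition locally_fraction (U : opens (spec P))
    (s : forall q, oset U q -> localization (prime_compl q)) :=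
  forall q, oset U q -> exists V : opens (spec P), [/\ oset V q, V `<=` U
    & exists (a t : P), forall r (Ur : oset U r), oset V r ->
        exists rt : sm_set (prime_compl r) t, s r Ur = frac a rt].

Record spec_section (U : opens (spec P)) := SpecSection {
  ssec : forall q, oset U q -> localization (prime_compl q);
  ssec_loc : locally_fraction ssec }.

Section Sections.
Variable U : opens (spec P).
HB.instance Definition _ := gen_eqMixin (spec_section U).
HB.instance Definition _ := gen_choiceMixin (spec_section U).

Lemma spec_section_eq (s t : spec_section U) :
  (forall q (Uq : oset U q), ssec s Uq = ssec t Uq) -> s = t.
Proof.
case: s t => s sP [t tP] /= st.
have e : s = t by do 2!apply: functional_extensionality_dep => ?; exact: st.
by case: _ / e tP => tP; congr SpecSection; exact: Prop_irrelevance.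
Qed.

Definition ssec_add (s t : spec_section U) : spec_section U.
Proof.
exists (fun q Uq => ssec s Uq + ssec t Uq) => q Uq.
have [V [Vq VU [a [x sE]]]] := ssec_loc s Uq.
have [W [Wq WU [b [y tE]]]] := ssec_loc t Uq.
exists (oI V W); split=> //; first by move=> r [/VU].
exists (a + b), (x + y) => r Ur [Vr Wr].
have [rx ->] := sE r Ur Vr; have [ry ->] := tE r Ur Wr.
by rewrite fracD; exists (smD rx ry).
Defined.

Definition ssec_const (a : P) : spec_section U.
Proof.
exists (fun q _ => frac a (sm0 (prime_compl q))) => q Uq.
by exists U; split=> //; exists a, 0 => r Ur _; exists (sm0 _).
Defined.

Let ssec_addA : associative ssec_add.
Proof. by move=> s t u; apply: spec_section_eq => q Uq /=; rewrite addrA. Qed.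
Let ssec_addC : commutative ssec_add.
Proof. by move=> s t; apply: spec_section_eq => q Uq /=; rewrite addrC. Qed.
Let ssec_add0 : left_id (ssec_const 0) ssec_add.
Proof. by move=> s; apply: spec_section_eq => q Uq /=; rewrite frac00 add0r. Qed.

HB.instance Definition _ :=
  GRing.isNmodule.Build (spec_section U) ssec_addA ssec_addC ssec_add0.

Lemma ssecD (s t : spec_section U) q (Uq : oset U q) :
  ssec (s + t) Uq = ssec s Uq + ssec t Uq.
Proof. by []. Qed.

End Sections.

Definition ssec_res (U V : opens (spec P)) (VU : V `<=` U) (s : spec_section U) :
  spec_section V.
Proof.
exists (fun q Vq => ssec s (VU q Vq)) => q Vq.
have [W [Wq WU [a [t sE]]]] := ssec_loc s (VU q Vq).
exists (oI W V); split=> //; first exact: oIr.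
by exists a, t => r Vr [Wr _]; exact: sE.
Defined.

Definition spec_presheaf : presheaf (spec P).
Proof.
refine (@Presheaf (spec P) (fun U => spec_section U) ssec_res _ _ _).
- by move=> U V VU; split=> [|s t]; exact: spec_section_eq.
- move=> U UU s; apply: spec_section_eq => q Uq /=.
  by congr ssec; exact: Prop_irrelevance.
- move=> U V W VU WV WU s; apply: spec_section_eq => q Uq /=.
  by congr ssec; exact: Prop_irrelevance.
Defined.

Lemma spec_sheafP : is_sheaf spec_presheaf.
Proof.
move=> U I V VU cov s sV.
have pt q (Uq : oset U q) : {i | oset (V i) q}.
  by apply: cid; have [i _ Viq] := cov q Uq; exists i.
have sE i j q (Viq : oset (V i) q) (Vjq : oset (V j) q) :
    ssec (s i) Viq = ssec (s j) Vjq.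
  have /(congr1 (fun u => @ssec (oI (V i) (V j)) u q (conj Viq Vjq))) /= :=
    sV i j (oI (V i) (V j)) (@oIl _ _ _) (@oIr _ _ _).
  by rewrite (Prop_irrelevance (oIl _) Viq) (Prop_irrelevance (oIr _) Vjq).
pose t q (Uq : oset U q) := ssec (s (projT1 (pt q Uq))) (projT2 (pt q Uq)).
have tP : locally_fraction t.
  move=> q Uq; have [i Viq] := pt q Uq.
  have [W [Wq WV [a [x siE]]]] := ssec_loc (s i) Viq.
  exists W; split=> //; first exact: (subset_trans WV).
  exists a, x => r Ur Wr; have [rx e] := siE r (WV r Wr) Wr.
  by exists rx; rewrite -e; exact: sE.
exists (SpecSection tP); split=> [i|t' t'E].
  by apply: spec_section_eq => q Viq /=; exact: sE.
apply: spec_section_eq => q Uq /=; rewrite /t.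
case: (pt q Uq) => i Viq /=; rewrite -(t'E i) /=.
by congr ssec; exact: Prop_irrelevance.
Qed.

Definition spec_lms : lms := Lms spec_sheafP.

End Spectrum.

(* [X] is covered by open subsets isomorphic to spectra of finitely generated
   monoids. *)
Definition locally_finite_type_fan (X : lms) :=
  forall x : X, exists U : opens X, oset U x /\
    exists P : nmodType, finitely_generated P /\
      exists f : @hom LMS (restr_lms U) (spec_lms P), is_iso f.

Lemma unitD (P : nmodType) (x y : P) : unit (x + y) <-> unit x /\ unit y.
Proof.
split=> [[z e]|[[z ez] [t et]]].
  by split; [exists (y + z); rewrite addrA|exists (x + z); rewrite addrCA addrA].
by exists (z + t); rewrite addrACA ez et addr0.
Qed.

Lemma unit0 (P : nmodType) : unit (0 : P).
Proof. by exists 0; rewrite addr0. Qed.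

Lemma unit_cancel (P : nmodType) (x y z : P) : unit z -> x + z = y + z -> x = y.
Proof.
by move=> [v e] /(congr1 (+%R^~ v)); rewrite /= -!addrA e !addr0.
Qed.

Lemma unit_hom (P Q : nmodType) (h : P -> Q) (x : P) :
  GRing.nmod_morphism h -> unit x -> unit (h x).
Proof. by move=> [h0 hD] [y e]; exists (h y); rewrite -hD e h0. Qed.

Section SheafGerms.
Variable X : lms.
Let F := lms_sh X.

Lemma germ_ext (U : opens X) (s t : F U) :
  (forall x (Ux : oset U x), germ Ux s = germ Ux t) -> s = t.
Proof.
move=> st; pose I := {x : X | oset U x}.
have /choice[W WP] (i : I) : exists W : opens X, W `<=` U /\ oset W (sval i) /\
    forall WU : W `<=` U, res WU s = res WU t.
  case: i => x Ux /=; have /germP[W [WU [WU' [Wx e]]]] := st x Ux.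
  by exists W; split=> //; split=> // WU''; rewrite (res_irr _ WU) e; exact: res_irr.
have WU i : W i `<=` U by case: (WP i).
have cov : U `<=` \bigcup_i W i.
  by move=> x Ux; exists (exist _ x Ux) => //; case: (WP (exist _ x Ux)) => _ [].
have [|r [rE r_uniq]] := @lms_sheafP X U I W WU cov (fun i => res (WU i) s).
  by move=> i j V Vi Vj; rewrite !res_res; exact: res_irr.
rewrite -(r_uniq s) //; apply: r_uniq => i.
by case: (WP i) => _ [_ ->].
Qed.

Lemma germ_glue (U : opens X) (g : forall x, oset U x -> stalk F x) :
  (forall x, oset U x -> exists (W : opens X) (s : F W), [/\ W `<=` U, oset W x &
     forall y (Uy : oset U y) (Wy : oset W y), g y Uy = germ Wy s]) ->
  exists s : F U, forall x (Ux : oset U x), germ Ux s = g x Ux.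
Proof.
move=> gP; pose I := {x : X | oset U x}.
have /choice[W WP] (i : I) : exists Ws : {W : opens X & F W},
    [/\ projT1 Ws `<=` U, oset (projT1 Ws) (sval i) &
     forall y (Uy : oset U y) (Wy : oset (projT1 Ws) y),
       g y Uy = germ Wy (projT2 Ws)].
  by case: i => x Ux /=; have [W [s sP]] := gP x Ux; exists (existT _ W s).
pose V i := projT1 (W i).
have VU i : V i `<=` U by case: (WP i).
have cov : U `<=` \bigcup_i V i.
  by move=> x Ux; exists (exist _ x Ux) => //; case: (WP (exist _ x Ux)).
have [|r [rE _]] := @lms_sheafP X U I V VU cov (fun i => projT2 (W i)).
  move=> i j T Ti Tj; apply: germ_ext => x Tx.
  rewrite (germ_res _ (Ti x Tx)) (germ_res _ (Tj x Tx)).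
  have [_ _ <-] := WP i; first exact: (VU i _ (Ti x Tx)).
  by move=> Ux; have [_ _ <-] := WP j.
exists r => x Ux; have [i _ Vx] := cov x Ux.
by have [_ _ /(_ x Ux Vx) ->] := WP i; rewrite -(germ_res (VU i) Ux Vx) rE.
Qed.

Lemma unit_germ (U : opens X) x (Ux : oset U x) (s : F U) :
  unit (germ Ux s) -> exists (W : opens X) (WU : W `<=` U) (t : F W),
    oset W x /\ res WU s + t = 0.
Proof.
move=> [g]; have [V [Vx [t ->]]] := germ_surj g.
have UVx : oset (oI U V) x by split.
rewrite -(germ_res (@oIl _ U V) Ux UVx) -(germ_res (@oIr _ U V) Vx UVx) -germD.
rewrite -(germ0 F UVx) => /germP[W [WV [WV' [Wx]]]].
rewrite resD !res_res res0 => e.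
by exists W, (subset_trans WV (@oIl _ _ _)), (res (subset_trans WV (@oIr _ _ _)) t).
Qed.

End SheafGerms.

Lemma stalk_map_add (X Y : lms) (f : pre_lms_hom X Y) (x : X) :
  GRing.nmod_morphism (@stalk_map X Y f x).
Proof.
split.
  have Tx : oset (oT Y) (lh_fun f x) by [].
  rewrite -(germ0 _ Tx) (@stalk_mapE _ _ f x _ (opre (lh_fun f) (oT Y)) Tx Tx (@subpre _ _ (lh_fun f) _)).
  by have [-> _] := lh_add (@subpre _ _ (lh_fun f) (oT Y)); rewrite germ0.
move=> g h; have [U [Ux [s ->]]] := germ_surj g.
have [V [Vx [t ->]]] := germ_surj h.
have UVx : oset (oI U V) (lh_fun f x) by split.
rewrite -(germ_res (@oIl _ U V) Ux UVx) -(germ_res (@oIr _ U V) Vx UVx) -germD.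
rewrite !(@stalk_mapE _ _ f x _ (opre (lh_fun f) (oI U V)) UVx UVx
  (@subpre _ _ (lh_fun f) _)) -germD.
by have [_ ->] := lh_add (@subpre _ _ (lh_fun f) (oI U V)).
Qed.

Section SpecGlobal.
Variables (X : lms) (P : nmodType).

Definition global_section (f : pre_lms_hom X (spec_lms P)) (a : P) :
    lms_sh X (oT X) :=
  @lh_sh _ _ f (oT (spec_lms P)) (oT X) (fun _ _ => Logic.I)
    (ssec_const (oT (spec P)) a).

End SpecGlobal.

Section SpecStalk.
Variable P : nmodType.

Definition ssec_frac (W : opens (spec P)) (a t : P) (Wt : W `<=` basic_set t) :
  spec_section W.
Proof.
exists (fun q Wq => @frac P (prime_compl q) a t (Wt q Wq)) => q Wq.
by exists W; split=> //; exists a, t => r Wr _; exists (Wt r Wr).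
Defined.

Lemma ssec_constD (U : opens (spec P)) (a b : P) :
  ssec_const U (a + b) = ssec_const U a + ssec_const U b.
Proof.
apply: spec_section_eq => q Uq /=; rewrite fracD; apply/fracP; exists 0.
by split; [exact: (sm0 (prime_compl q))|rewrite addr0].
Qed.

(* Near each point a section [s] satisfies [s + t = a] with [t] invertible. *)
Lemma ssec_germ (V : opens (spec P)) (q : spec P) (Vq : oset V q)
    (s : spec_presheaf P V) :
  exists a t : P, [/\ ~ prime_set q t, exists tq, ssec s Vq = @frac P (prime_compl q) a t tq &
    germ Vq s + @germ _ (spec_presheaf P) q (oT _) Logic.I (ssec_const _ t)
    = @germ _ (spec_presheaf P) q (oT _) Logic.I (ssec_const _ a)].
Proof.
have [W [Wq WV [a [t sE]]]] := ssec_loc s Vq.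
exists a, t; have [tq e] := sE q Vq Wq; split=> //; first by exists tq.
rewrite -(germ_res WV Vq Wq) -!(germ_res (@suboT _ W) Logic.I Wq) -germD.
congr germ; apply: spec_section_eq => r Wr /=.
have [rt ->] := sE r (WV r Wr) Wr; rewrite fracD; apply/fracP; exists 0.
by split; [exact: (sm0 (prime_compl r))|rewrite !(addr0, add0r)].
Qed.

Lemma unit_germ_const (q : spec P) (p : P) :
  unit (@germ _ (spec_presheaf P) q (oT _) Logic.I (ssec_const _ p)) <->
  ~ prime_set q p.
Proof.
split=> [/(@unit_germ (spec_lms P))[W [WT [t [Wq e]]]] pq|qp].
  have := congr1 (fun u : spec_section W => ssec u Wq) e => /=.
  have [a [x [xx ->]]] := frac_surj (ssec t Wq).
  rewrite fracD => /fracP[u [Su]]; rewrite !add0r addr0.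
  move=> e'; apply: (primeD Su xx); rewrite -e' addrCA.
  exact: prime_ideal.
pose s := @ssec_frac (basic_open p) 0 p (@subo _ _).
have pq : oset (basic_open p) q := qp.
exists (@germ _ (spec_presheaf P) q (basic_open p) pq s).
rewrite -(germ_res (@suboT _ (basic_open p)) Logic.I pq) -germD -(germ0 _ pq).
congr germ; apply: spec_section_eq => r rp /=; rewrite fracD -[RHS]frac00.
apply/fracP; exists 0.
by split; [exact: (sm0 (prime_compl r))|rewrite !(addr0, add0r)].
Qed.

End SpecStalk.

Section Adjunction.
Variables (X : lms) (P : nmodType) (phi : P -> lms_sh X (oT X)).
Hypothesis phiM : GRing.nmod_morphism phi.
Let F := lms_sh X.
Let gphi (x : X) (p : P) : stalk F x := @germ _ F x (oT X) Logic.I (phi p).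

Let gphi0 x : gphi x 0 = 0.
Proof. by rewrite /gphi phiM.1 germ0. Qed.

Let gphiD x a b : gphi x (a + b) = gphi x a + gphi x b.
Proof. by rewrite /gphi phiM.2 germD. Qed.

Definition spec_pt (x : X) : spec P.
Proof.
exists [set p | ~ unit (gphi x p)].
- by move=> a b /= ua; rewrite gphiD => /unitD[].
- by rewrite /= gphi0; apply; exact: unit0.
- move=> a b /contrapT ua /contrapT ub; rewrite /= gphiD; apply.
  by apply/unitD.
Defined.

Let spec_ptP x p : ~ prime_set (spec_pt x) p <-> unit (gphi x p).
Proof. by split=> [/contrapT|u]. Qed.

Lemma spec_pt_continuous : continuous spec_pt.
Proof.
apply/continuousP => A oA; rewrite openE => x /= Ax.
have [p [/spec_ptP px pA]] := oA _ Ax.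
have [W [WT [t [Wx e]]]] := unit_germ px.
rewrite /interior nbhsE; exists W; first by split=> //; exact: oset_open.
move=> y Wy; apply: pA; apply/spec_ptP; exists (germ Wy t).
by rewrite /gphi -(germ_res WT Logic.I Wy) -germD e germ0.
Qed.

Definition spec_cts : continuousType X (spec P) := mkcts spec_pt_continuous.

Let loc_rel (x : X) (c : localization (prime_compl (spec_pt x)))
    (g : stalk F x) :=
  forall a t (tx : sm_set (prime_compl (spec_pt x)) t),
    c = frac a tx -> g + gphi x t = gphi x a.

Let loc_relP x a t (tx : sm_set (prime_compl (spec_pt x)) t) g :
  g + gphi x t = gphi x a -> loc_rel (frac a tx) g.
Proof.
move=> ge b s sx /fracP[u [/spec_ptP ux e]].
apply: (unit_cancel ux); move/spec_ptP: (tx) => ut.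
apply: (unit_cancel ut).
rewrite -!addrA -!gphiD.
have -> : gphi x (b + (u + t)) = gphi x (u + (a + s)).
  by rewrite e; congr gphi; rewrite addrCA.
rewrite addrCA !gphiD -ge.
by rewrite !addrA [LHS](ACl (2*1*4*3)%AC).
Qed.

Let loc_exists x (c : localization (prime_compl (spec_pt x))) :
  exists g, loc_rel c g.
Proof.
have [a [t [tx ->]]] := frac_surj c.
have /spec_ptP[v e] := tx.
by exists (gphi x a + v); apply: loc_relP; rewrite -addrA [v + _]addrC e addr0.
Qed.

Definition loc_map x (c : localization (prime_compl (spec_pt x))) : stalk F x :=
  projT1 (cid (loc_exists c)).

Lemma loc_mapE x a t (tx : sm_set (prime_compl (spec_pt x)) t) :
  loc_map (frac a tx) + gphi x t = gphi x a.
Proof. by rewrite /loc_map; case: cid => g /= gP; exact: gP. Qed.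

Lemma loc_map_uniq x a t (tx : sm_set (prime_compl (spec_pt x)) t) g :
  g + gphi x t = gphi x a -> loc_map (frac a tx) = g.
Proof.
by move=> ge; move/spec_ptP: (tx) => /unit_cancel; apply; rewrite loc_mapE.
Qed.

Lemma loc_map_add x : GRing.nmod_morphism (@loc_map x).
Proof.
split.
  by rewrite -frac00; apply: loc_map_uniq; rewrite gphi0 addr0.
move=> c d; have [a [t [tx ->]]] := frac_surj c.
have [b [s [sx ->]]] := frac_surj d.
by rewrite fracD; apply: loc_map_uniq; rewrite !gphiD addrACA !loc_mapE.
Qed.

Let sec_exists (V : opens (spec P)) (U : opens X) (UV : U `<=` spec_cts @^-1` V)
    (s : spec_section V) :
  exists t : F U, forall x (Ux : oset U x),
    germ Ux t = loc_map (ssec s (UV x Ux)).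
Proof.
apply: germ_glue => x Ux.
have [W [Wx WV [a [d sE]]]] := ssec_loc s (UV x Ux).
have [dx e] := sE _ (UV x Ux) Wx; have /spec_ptP/unit_germ := dx.
move=> [T [TT [v [Tx ve]]]].
pose S := oI (oI U T) (opre spec_cts W).
have SX : S `<=` oT X by [].
have ST : S `<=` T by move=> y [[]].
exists S, (res SX (phi a) + res ST v); split=> //; first by move=> y [[]].
move=> y Uy Sy; have Wy : oset W (spec_pt y) by case: Sy.
have [dy ->] := sE _ (UV y Uy) Wy; apply: loc_map_uniq.
rewrite germD (germ_res SX Logic.I Sy) (germ_res ST (ST y Sy) Sy) -addrA.
rewrite [X in _ + X = _]addrC /gphi.
rewrite -(germ_res TT Logic.I (ST y Sy) (phi d)) -germD.
by rewrite ve germ0 addr0.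
Qed.

Let sec_map (V : opens (spec P)) (U : opens X) (UV : U `<=` spec_cts @^-1` V)
    (s : spec_section V) : F U := projT1 (cid (sec_exists UV s)).

Let sec_mapE (V : opens (spec P)) (U : opens X) (UV : U `<=` spec_cts @^-1` V)
    (s : spec_section V) x (Ux : oset U x) :
  germ Ux (sec_map UV s) = loc_map (ssec s (UV x Ux)).
Proof. by rewrite /sec_map; case: cid. Qed.

Definition pre_spec_hom : pre_lms_hom X (spec_lms P).
Proof.
refine (@PreLmsHom X (spec_lms P) spec_cts sec_map _ _).
- move=> V U UV; split=> [|s t]; apply: germ_ext => x Ux.
    by rewrite sec_mapE germ0 -(loc_map_add x).1.
  by rewrite germD !sec_mapE -(loc_map_add x).2.
move=> V V' U U' UV UV' V'V U'U s; apply: germ_ext => x Ux.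
rewrite (germ_res U'U (U'U x Ux) Ux) !sec_mapE /=.
by congr loc_map; congr ssec; exact: Prop_irrelevance.
Defined.

Lemma spec_hom_local x : local (@stalk_map _ _ pre_spec_hom x).
Proof.
move=> g; have [V [Vx [s ->]]] := germ_surj g.
apply: contra_not.
rewrite (@stalk_mapE _ _ pre_spec_hom x _ (opre spec_cts V) Vx Vx
  (@subpre _ _ spec_cts V)) /= sec_mapE.
have [a [t [tx [tq e] se]]] := ssec_germ (P := P) Vx s.
move=> u; have ua : unit (gphi x a).
  rewrite -(loc_mapE a tq); apply/unitD; split; last exact/spec_ptP.
  rewrite -e; move: u.
  by rewrite (_ : subpre _ = Vx) //; exact: Prop_irrelevance.
have /spec_ptP/unit_germ_const := ua.
by rewrite -se => /unitD[].
Qed.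

Definition spec_hom : lms_hom X (spec_lms P) := LmsHom spec_hom_local.

Lemma global_section_spec_hom a : global_section spec_hom a = phi a.
Proof.
apply: germ_ext => x []; rewrite [LHS]sec_mapE /=; apply: loc_map_uniq.
by rewrite gphi0 addr0.
Qed.

End Adjunction.

Section GlobalSection.
Variables (X : lms) (P : nmodType).

Lemma global_section_add (f : pre_lms_hom X (spec_lms P)) :
  GRing.nmod_morphism (global_section f).
Proof.
have [h0 hD] := lh_add (p := f) (V := oT (spec_lms P)) (fun (x : X) (_ : oset (oT X) x) => Logic.I).
by split=> [|a b]; rewrite /global_section ?ssec_constD.
Qed.

Lemma germ_global_section (f : pre_lms_hom X (spec_lms P)) (a : P) (x : X) :
  @germ _ _ x (oT X) Logic.I (global_section f a) =
  @stalk_map X (spec_lms P) f x (@germ _ (spec_presheaf P) (lh_fun f x) (oT _) Logic.I (ssec_const _ a)).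
Proof. by rewrite (@stalk_mapE _ _ f x (oT (spec P)) (oT X) Logic.I Logic.I
  (fun _ _ => Logic.I)). Qed.

Lemma prime_global_section (f : lms_hom X (spec_lms P)) (x : X) (p : P) :
  prime_set (lh_fun f x) p <->
  ~ unit (@germ _ _ x (oT X) Logic.I (global_section f p)).
Proof.
rewrite germ_global_section; split=> [fp|nu].
  by apply: (lms_local (l := f)) => /unit_germ_const.
apply: contrapT => /unit_germ_const u; apply: nu.
exact: (unit_hom (stalk_map_add f x)).
Qed.

Lemma global_section_inj (f g : lms_hom X (spec_lms P)) :
  (forall a, global_section f a = global_section g a) -> f = g.
Proof.
move=> fg; have pt x : lh_fun f x = lh_fun g x.
  have : prime_set (lh_fun f x) = prime_set (lh_fun g x).
    apply/seteqP; split=> p /prime_global_section nu.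
      by apply/prime_global_section; rewrite -fg.
    by apply/prime_global_section; rewrite fg.
  case: (lh_fun f x) (lh_fun g x) => A Ai A0 AD [B Bi B0 BD] /= e.
  by case: _ / e Bi B0 BD => *; congr Spec; exact: Prop_irrelevance.
apply: lms_hom_eq => // V U fUV gUV s; apply: germ_ext => x Ux.
have [a [t [/unit_germ_const ut [tf se] fe]]] :=
  ssec_germ (P := P) (fUV x Ux) s.
have ge : germ (gUV x Ux) s
    + @germ _ (spec_presheaf P) (lh_fun g x) (oT _) Logic.I (ssec_const _ t)
    = @germ _ (spec_presheaf P) (lh_fun g x) (oT _) Logic.I (ssec_const _ a).
  have gV : oset V (lh_fun g x) := gUV x Ux.
  rewrite (Prop_irrelevance (gUV x Ux) gV).
  move: gV; rewrite -pt => gV; rewrite -fe.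
  by congr (germ _ s + _); exact: Prop_irrelevance.
have push (h : lms_hom X (spec_lms P)) (hUV : U `<=` lh_fun h @^-1` V) :
    germ (hUV x Ux) s
      + @germ _ (spec_presheaf P) (lh_fun h x) (oT _) Logic.I (ssec_const _ t)
    = @germ _ (spec_presheaf P) (lh_fun h x) (oT _) Logic.I (ssec_const _ a) ->
    germ Ux (lh_sh hUV s) + germ (U := oT X) Logic.I (global_section h t)
    = germ (U := oT X) (x := x) Logic.I (global_section h a).
  move=> /(congr1 (@stalk_map X (spec_lms P) h x)).
  rewrite (stalk_map_add h x).2 !germ_global_section.
  by rewrite (@stalk_mapE _ _ h x V U (hUV x Ux) Ux hUV s).
have uft : unit (germ (U := oT X) (x := x) Logic.I (global_section f t)).
  rewrite germ_global_section; exact: (unit_hom (stalk_map_add f x)).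
apply: (unit_cancel uft); rewrite (push f fUV fe) [in RHS]fg (push g gUV ge).
by rewrite fg.
Qed.

End GlobalSection.

Definition multiples (P : nmodType) (p : P) : submonoid P.
Proof.
exists [set x | exists n, x = p *+ n]; first by exists 0%N; rewrite mulr0n.
by move=> _ _ [m ->] [n ->]; exists (m + n)%N; rewrite mulrnDr.
Defined.

Lemma multiples_mem (P : nmodType) (p : P) n : sm_set (multiples p) (p *+ n).
Proof. by exists n. Qed.

Section BasicSections.
Variables (P : nmodType) (p : P).

Lemma basic_set_mulrn n : basic_set p `<=` basic_set (p *+ n).
Proof.
move=> q qp; elim: n => [|n IHn]; first exact: prime0.
by rewrite /basic_set /= mulrS; exact: primeD.
Qed.

Let face (x : P) := exists r n, x + r = p *+ n.

Let closed_pt : spec P.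
Proof.
exists [set x | ~ face x].
- by move=> x y /= nx [r [n e]]; apply: nx; exists (y + r), n; rewrite addrA.
- by apply; exists 0, 0%N; rewrite addr0.
- move=> x y /contrapT[r [m e]] /contrapT[s [n f]]; apply.
  by exists (r + s), (m + n)%N; rewrite addrACA e f mulrnDr.
Defined.

Let closed_ptP : basic_set p closed_pt.
Proof. by apply; exists 0, 1%N; rewrite addr0. Qed.

Let face_notin x q : face x -> basic_set p q -> ~ prime_set q x.
Proof.
move=> [r [n e]] qp qx; apply: (@basic_set_mulrn n q qp).
by rewrite -e; exact: prime_ideal.
Qed.

(* The sections over [basic_open p] are the localization of [P] at the
   multiples of [p]. *)
Lemma basic_section_surj (s : spec_section (basic_open p)) :
  exists a n, s = @ssec_frac P (basic_open p) a _ (@basic_set_mulrn n).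
Proof.
have [V [Vp0 _ [a [t sE]]]] := ssec_loc s (closed_ptP : oset (basic_open p) _).
have := oset_open V; rewrite spec_openE => /(_ _ Vp0)[c [cc cV]].
have Vp : basic_set p `<=` V.
  by move=> q qp; apply: cV; apply: face_notin qp; exact: contrapT.
have [tt _] := sE _ closed_ptP (Vp _ closed_ptP).
have [r [n e]] := contrapT tt.
exists (a + r), n; apply: spec_section_eq => q qp.
have [tq ->] := sE q qp (Vp _ qp); apply/fracP; exists 0.
split; first exact: (sm0 (prime_compl q)).
by rewrite !add0r -e addrA addrAC.
Qed.

Lemma basic_section_inj a b m n :
  @ssec_frac P (basic_open p) a _ (@basic_set_mulrn m) =
  @ssec_frac P (basic_open p) b _ (@basic_set_mulrn n) <->
  frac a (multiples_mem p m) = frac b (multiples_mem p n).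
Proof.
split=> [/(congr1 (fun s => ssec s (closed_ptP : oset (basic_open p) _)))|].
  move=> /fracP[u [/contrapT[r [k e]] f]]; apply/fracP; exists (p *+ k).
  by split; [exists k|rewrite -e addrAC f addrAC].
move=> /fracP[_ [[k ->] e]]; apply: spec_section_eq => q qp; apply/fracP.
by exists (p *+ k); split=> //; exact: basic_set_mulrn.
Qed.

End BasicSections.

Lemma global_section_comp (X Y : lms) (P : nmodType)
    (f : lms_hom Y (spec_lms P)) (h : lms_hom X Y) a :
  global_section (lms_comp f h) a
  = lh_sh (p := h) (V := oT Y) (U := oT X) (fun _ _ => Logic.I) (global_section f a).
Proof.
have TV : oT Y `<=` opre (lh_fun f) (oT (spec_lms P)) by [].
rewrite /global_section /=.
rewrite -(@lh_eqr _ _ h _ (oT Y) (oT X) _ (fun _ _ => Logic.I) TV).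
by congr lh_sh; exact: lh_eql.
Qed.

(* The monoid structure on [hom X (Spec P)] given by its identification with
   the homomorphisms from [P] to the global sections of [X]. *)
Section SpecMonoid.
Variables (X : lms) (P : nmodType).
Let F := lms_sh X (oT X).

Lemma spec_add_subproof (f g : lms_hom X (spec_lms P)) :
  GRing.nmod_morphism (fun a => global_section f a + global_section g a : F).
Proof.
have [f0 fD] := global_section_add f; have [g0 gD] := global_section_add g.
by split=> [|a b]; rewrite ?f0 ?g0 ?addr0 // fD gD addrACA.
Qed.

Lemma spec_zero_subproof : GRing.nmod_morphism (fun _ : P => 0 : F).
Proof. by split=> [|a b]; rewrite ?addr0. Qed.

Definition spec_add (f g : lms_hom X (spec_lms P)) : lms_hom X (spec_lms P) :=
  spec_hom (spec_add_subproof f g).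

Definition spec_zero : lms_hom X (spec_lms P) := spec_hom spec_zero_subproof.

Lemma global_section_spec_add f g a :
  global_section (spec_add f g) a = global_section f a + global_section g a.
Proof. exact: (global_section_spec_hom (spec_add_subproof f g)). Qed.

Lemma global_section_spec_zero a : global_section spec_zero a = 0.
Proof. exact: (global_section_spec_hom spec_zero_subproof). Qed.

End SpecMonoid.

Section SpecMonoidTheory.
Variables (X : lms) (P : nmodType).
Implicit Types f g : lms_hom X (spec_lms P).

Lemma spec_addA : associative (@spec_add X P).
Proof.
move=> f g h; apply: global_section_inj => a.
by rewrite !global_section_spec_add addrA.
Qed.

Lemma spec_addC : commutative (@spec_add X P).
Proof.
move=> f g; apply: global_section_inj => a.
by rewrite !global_section_spec_add addrC.
Qed.

Lemma spec_add0 : left_id (spec_zero X P) (@spec_add X P).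
Proof.
move=> f; apply: global_section_inj => a.
by rewrite global_section_spec_add global_section_spec_zero add0r.
Qed.

End SpecMonoidTheory.

Lemma spec_add_comp (X Y : lms) (P : nmodType) (f g : lms_hom X (spec_lms P))
    (h : lms_hom Y X) :
  lms_comp (spec_add f g) h = spec_add (lms_comp f h) (lms_comp g h).
Proof.
apply: global_section_inj => a.
rewrite global_section_spec_add !global_section_comp global_section_spec_add.
by have [_ ->] := lh_add (p := h) (V := oT X) (U := oT Y) (fun _ _ => Logic.I).
Qed.

Lemma spec_zero_comp (X Y : lms) (P : nmodType) (h : lms_hom Y X) :
  lms_comp (spec_zero X P) h = spec_zero Y P.
Proof.
apply: global_section_inj => a.
rewrite global_section_comp !global_section_spec_zero.
by have [-> _] := lh_add (p := h) (V := oT X) (U := oT Y) (fun _ _ => Logic.I).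
Qed.

(* In particular [hom X (Spec nat)] is the monoid of global sections of [X]. *)
Lemma global_section1_bij (X : lms) :
  bijective (fun f : lms_hom X (spec_lms nat) => global_section f 1%N).
Proof.
have phiM (s : lms_sh X (oT X)) : GRing.nmod_morphism (fun n : nat => s *+ n).
  by split=> // m n; exact: mulrnDr.
exists (fun s => spec_hom (phiM s)) => [f|s]; last exact: global_section_spec_hom.
apply: global_section_inj => n; rewrite global_section_spec_hom.
have [f0 fD] := global_section_add f.
elim: n => [|n IHn]; first by rewrite mulr0n f0.
by rewrite mulrS IHn -fD.
Qed.

Section RestrictionHom.
Variables (X : lms) (U : opens X).

Lemma sub_oimg (V : opens X) (W : opens (restr_lms U)) :
  W `<=` incl_map U @^-1` V -> oimg W `<=` V.
Proof. by move=> WV _ [y /WV Vy <-]. Qed.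

Definition pre_restr_incl : pre_lms_hom (restr_lms U) X.
Proof.
refine (@PreLmsHom (restr_lms U) X (incl_map U)
  (fun V W WV s => res (sub_oimg WV) s) _ _).
  by move=> V W WV; exact: res_add.
by move=> V V' W W' WV WV' V'V W'W s /=; rewrite !res_res; exact: res_irr.
Defined.

Lemma restr_incl_local x : local (@stalk_map _ _ pre_restr_incl x).
Proof.
move=> g; have [V [Vx [s ->]]] := germ_surj g; apply: contra_not.
rewrite (@stalk_mapE _ _ pre_restr_incl x V (opre (incl_map U) V) Vx Vx
  (@subpre _ _ (incl_map U) V)) => /(@unit_germ (restr_lms U)).
move=> [W [WV [t [Wx /= e]]]].
have Wx' : oset (oimg W) (set_val x) by exists x.
exists (germ Wx' t); move: e; rewrite res_res; set VW := subset_trans _ _ => e.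
by rewrite -(germ_res VW Vx Wx') -germD e germ0.
Qed.

Definition restr_incl : lms_hom (restr_lms U) X := LmsHom restr_incl_local.

End RestrictionHom.

Section RestrictionTop.
Variable X : lms.
Local Notation XT := (restr_lms (oT X)).

Definition to_restr_fun (x : X) : XT := SigSub (mem_set (Logic.I : [set: X] x)).

Lemma to_restr_continuous : continuous to_restr_fun.
Proof.
apply/continuousP => _ [A oA <-].
by rewrite (_ : _ @^-1` _ = A).
Qed.

Definition to_restr_map : continuousType X XT := mkcts to_restr_continuous.

Lemma to_restr_sub (V : opens XT) (W : opens X) :
  W `<=` to_restr_map @^-1` V -> W `<=` oimg V.
Proof. by move=> WV x /WV Vx; exists (to_restr_fun x). Qed.

Definition pre_to_restr : pre_lms_hom X XT.
Proof.
refine (@PreLmsHom X XT to_restr_map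
  (fun V W WV s => res (to_restr_sub WV) s) _ _).
  by move=> V W WV; exact: res_add.
by move=> V V' W W' WV WV' V'V W'W s /=; rewrite !res_res; exact: res_irr.
Defined.

Lemma to_restr_local x : local (@stalk_map _ _ pre_to_restr x).
Proof.
move=> g; have [V [Vx [s ->]]] := germ_surj g; apply: contra_not.
rewrite (@stalk_mapE _ _ pre_to_restr x V (opre to_restr_map V) Vx Vx
  (@subpre _ _ to_restr_map V)) => /unit_germ[W [WV [t [Wx /= e]]]].
pose W' : opens XT := opre (incl_map (oT X)) W.
have W'W : oimg W' `<=` W by exact: sub_oimg.
have W'V : W' `<=` V.
  apply: oimgP => y /W'W /WV Vy; exact: to_restr_sub Vy.
have Wx' : oset W' (to_restr_fun x) by [].
exists (@germ _ (lms_sh XT) _ W' Wx' (res W'W t)).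
rewrite -(germ_res W'V Vx Wx') -germD -(germ0 _ Wx'); congr germ => /=.
move: (congr1 (res W'W) e); rewrite resD res0 !res_res => <-.
by congr (_ + _); exact: res_irr.
Qed.

Definition to_restr : lms_hom X XT := LmsHom to_restr_local.

Lemma restr_top_iso : @is_iso LMS XT X (restr_incl (oT X)).
Proof.
exists to_restr; split; apply: lms_hom_eq => /=.
- by move=> x; exact: val_inj.
- by move=> V W WV WV' s /=; rewrite !res_res; exact: res_irr.
- by [].
- by move=> V W WV WV' s /=; rewrite !res_res; exact: res_irr.
Qed.

End RestrictionTop.

Lemma spec_fan (P : nmodType) :
  finitely_generated P -> locally_finite_type_fan (spec_lms P).
Proof.
move=> fgP x; exists (oT _); split=> //; exists P; split=> //.
by exists (restr_incl (oT (spec_lms P))); exact: restr_top_iso.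
Qed.

Lemma nat_finitely_generated : finitely_generated nat.
Proof.
exists 1%N, (fun _ => 1%N) => n; exists (fun _ => n).
by rewrite big_ord1; elim: n => // n IHn; rewrite mulrS -IHn.
Qed.

Record fan := Fan {
  fan_lms :> lms;
  fanP : locally_finite_type_fan fan_lms }.

Definition Fans : category :=
  @Category fan (fun X Y => lms_hom X Y) (fun X => lms_id X)
    (fun X Y Z g f => lms_comp g f)
    (fun X Y f => @comp1m LMS X Y f) (fun X Y f => @compm1 LMS X Y f)
    (fun X Y Z T h g f => @compmA LMS X Y Z T h g f).

Definition Fans_top : functor Fans Top.
Proof.
by refine (@Functor Fans Top (fun X => lms_top X) (fun X Y f => lh_fun f) _ _)
  => *; exact/continuousEP.
Defined.

Definition SpecN : Fans := Fan (spec_fan nat_finitely_generated).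

Definition SpecN_monoid : @monoid_object Fans SpecN :=
  @MonoidObject Fans SpecN
    (fun X => @spec_add X nat) (fun X => spec_zero X nat)
    (fun X => @spec_addA X nat) (fun X => @spec_addC X nat)
    (fun X => @spec_add0 X nat) (fun X Y => @spec_add_comp X Y nat)
    (fun X Y => @spec_zero_comp X Y nat).

Definition FansSpecN : space_data := SpaceData Fans_top SpecN_monoid.

(* Main.v *)
From HB Require Import structures.
From mathcomp Require Import all_boot all_algebra all_classical.
From mathcomp Require Import topology wochoice.
Require Import Defs.

(** A locally finite type fan is glued from spectra of finitely generated
    monoids, so that a structure preserving gluing and finite limits should be
    determined by its value on [Spec N]. The proof makes this precise by an
    adjunction.

    Fans form a category of spaces. Each point of a fan is the closed point of a
    chart [Spec P] with [P] finitely generated, and this chart is its smallest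
    neighbourhood ([fan_chart], [chart_min]). So the morphisms of a finite
    diagram map charts into charts, and a finite limit in locally monoidal
    spaces, whose stalks are colimits of stalks, is again a fan ([lim_fan]).
    Coproducts, pushouts of open embeddings and unions of chains are colimits
    over preorders whose down-sets are chains, constructed in [forest_colimit].

    A category of spaces [E] has a functor [lms_of] to locally monoidal spaces:
    the sections of [lms_of Y] over an open subset are the morphisms from this
    open subspace to [A1]. They form a sheaf because the Zariski topology is
    subcanonical. Every 1-morphism from fans to [E] is a partial right adjoint of
    [lms_of]: morphisms from [Y] to [F X] are morphisms from [lms_of Y] to [X].

    Existence. If [X = Spec P], these are the homomorphisms from [P] to the
    functions on [Y]. This functor of [Y] is represented by a finite limit of
    copies of [A1], because finitely generated commutative monoids are finitely
    presented ([redei], [affine_model]). In general, the representing spaces of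
    the charts of [X] are glued. As only pushouts and unions of well-ordered
    chains are given, this is a transfinite induction ([representable_union],
    [representable_chain], [representable_cover]). The properties of a 1-morphism
    then follow from the adjunction.

    Uniqueness. A 1-morphism [F] has a counit from [lms_of (F X)] to [X]. On
    points it is the transformation [eta]; on sections, which are morphisms from
    open subspaces of [X] to [Spec N], it is [F]. It is local on stalks because
    [F] preserves the localization that inverts all elements of [N] ([Gm_eta]).
    The counit is universal ([counit_univ]): in the affine case because [F]
    preserves the finite limit representing [Spec P], in general because
    universality can be checked on an open cover ([universal_local]). Hence two
    1-morphisms [F] and [G] are related by a unique natural transformation that
    is compatible with the counits; it is invertible, and every 2-morphism is
    compatible with the counits ([two_morphism_counit]). *)

Set Implicit Arguments.
Unset Strict Implicit.
Unset Printing Implicit Defensive.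

Import GRing.Theory.

Local Open Scope classical_set_scope.
Local Open Scope ring_scope.

(** * Morphisms of locally monoidal spaces and open immersions *)
Section StalkBasics.
Variables (X : topologicalType) (F : presheaf X).

Lemma germ_irr (x : X) (U : opens X) (Ux Ux' : oset U x) (s : F U) :
  germ Ux s = germ Ux' s.
Proof. by congr germ; exact: Prop_irrelevance. Qed.

(** Points of the form [f x] and [g x] are often equal only propositionally;
    this moves germs between their stalks. *)
Definition cast_stalk (x y : X) (e : x = y) (g : stalk F x) : stalk F y :=
  eq_rect x (fun z => stalk F z : Type) g y e.

Lemma cast_germ (x y : X) (e : x = y) (U : opens X) (Ux : oset U x)
    (Uy : oset U y) (s : F U) : cast_stalk e (germ Ux s) = germ Uy s.
Proof. by case: _ / e Uy => Uy; exact: germ_irr. Qed.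

Lemma cast_stalkM (x y : X) (e : x = y) : GRing.nmod_morphism (cast_stalk e).
Proof. by case: _ / e; split. Qed.

Lemma cast_stalk_unit (x y : X) (e : x = y) (g : stalk F x) :
  unit (cast_stalk e g) -> unit g.
Proof. by case: _ / e. Qed.

Lemma germ_eq_near (x : X) (U V : opens X) (Ux : oset U x) (Vx : oset V x)
    (s : F U) (t : F V) : germ Ux s = germ Vx t ->
  exists W : opens X, oset W x /\ forall y (Uy : oset U y) (Vy : oset V y),
    oset W y -> germ Uy s = germ Vy t.
Proof.
move=> /germP[W [WU [WV [Wx e]]]]; exists W; split=> // y Uy Vy Wy.
by apply/germP; exists W, WU, WV.
Qed.

End StalkBasics.

(** A morphism can be given by maps on points and on stalks, provided that each
    section goes, locally, to the germs of one section: since the source is a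
    sheaf, these germs glue. All morphisms that are not evident on sections are
    built in this way. *)
Section MakeHom.
Variables (X Y : lms) (f : continuousType X Y).
Variable phi : forall x, stalk (lms_sh Y) (f x) -> stalk (lms_sh X) x.
Hypothesis phiM : forall x, GRing.nmod_morphism (@phi x).
Hypothesis phi_local : forall x, local (@phi x).
Hypothesis phi_coh : forall (V : opens Y) (s : lms_sh Y V) x, oset V (f x) ->
  exists (W : opens X) (t : lms_sh X W), oset W x /\
    forall y (Wy : oset W y) (Vy : oset V (f y)), phi (germ Vy s) = germ Wy t.

Let mk_exists (V : opens Y) (U : opens X) (UV : U `<=` f @^-1` V)
    (s : lms_sh Y V) :
  exists t : lms_sh X U, forall x (Ux : oset U x),
    germ Ux t = phi (germ (UV x Ux : oset V (f x)) s).
Proof.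
apply: germ_glue => x Ux; have [W [t [Wx Wt]]] := phi_coh s (UV x Ux).
exists (oI U W), (res (@oIr _ U W) t); split=> [||y Uy Wy]; first exact: oIl.
  by [].
by rewrite (germ_res _ (oIr Wy)); exact: Wt.
Qed.

Let mk_sh (V : opens Y) (U : opens X) (UV : U `<=` f @^-1` V) (s : lms_sh Y V) :=
  projT1 (cid (mk_exists UV s)).

Let mk_shE (V : opens Y) (U : opens X) (UV : U `<=` f @^-1` V) (s : lms_sh Y V)
    x (Ux : oset U x) :
  germ Ux (mk_sh UV s) = phi (germ (UV x Ux : oset V (f x)) s).
Proof. by rewrite /mk_sh; case: cid. Qed.

Definition pre_mk_hom : pre_lms_hom X Y.
Proof.
refine (@PreLmsHom X Y f mk_sh _ _).
- move=> V U UV; split=> [|s t]; apply: germ_ext => x Ux.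
    by rewrite mk_shE !germ0 (phiM x).1.
  by rewrite germD !mk_shE germD (phiM x).2.
move=> V V' U U' UV UV' V'V U'U s; apply: germ_ext => x Ux.
rewrite (germ_res U'U (U'U x Ux) Ux) !mk_shE; congr phi.
by rewrite (germ_res V'V (UV x (U'U x Ux))).
Defined.

Lemma pre_mk_hom_stalk x g : @stalk_map _ _ pre_mk_hom x g = phi g.
Proof.
have [V [Vx [s ->]]] := germ_surj g.
rewrite (@stalk_mapE _ _ pre_mk_hom x V (opre f V) Vx Vx (@subpre _ _ f V)).
by rewrite /= mk_shE; congr phi; exact: germ_irr.
Qed.

Lemma mk_hom_local x : local (@stalk_map _ _ pre_mk_hom x).
Proof. by move=> g /phi_local; rewrite pre_mk_hom_stalk. Qed.

Definition mk_hom : lms_hom X Y := LmsHom mk_hom_local.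

Lemma mk_hom_stalk x g : @stalk_map _ _ mk_hom x g = phi g.
Proof. exact: pre_mk_hom_stalk. Qed.

End MakeHom.

Section HomBasics.
Variables X Y : lms.
Implicit Types f g : lms_hom X Y.

Lemma germ_pull f (V : opens Y) (s : lms_sh Y V) (U : opens X)
    (UV : U `<=` lh_fun f @^-1` V) x (Ux : oset U x) (Vx : oset V (lh_fun f x)) :
  germ Ux (lh_sh UV s) = @stalk_map _ _ f x (germ Vx s).
Proof. by rewrite -(@stalk_mapE _ _ f x V U Vx Ux UV). Qed.

(** The two stalks [stalk (f x)] and [stalk (g x)] are compared through the
    germs of a common section, so that no transport along [f x = g x] occurs. *)
Lemma lms_hom_ext f g : (forall x, lh_fun f x = lh_fun g x) ->
  (forall x (V : opens Y) (s : lms_sh Y V) (Vf : oset V (lh_fun f x))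
     (Vg : oset V (lh_fun g x)),
     @stalk_map _ _ f x (germ Vf s) = @stalk_map _ _ g x (germ Vg s)) ->
  f = g.
Proof.
move=> fg st; apply: lms_hom_eq => // V U fUV gUV s.
apply: germ_ext => x Ux.
by rewrite (germ_pull s fUV Ux (fUV x Ux)) (germ_pull s gUV Ux (gUV x Ux)).
Qed.

Lemma hom_eq_stalk f g : f = g ->
  forall x (V : opens Y) (s : lms_sh Y V) (Vf : oset V (lh_fun f x))
     (Vg : oset V (lh_fun g x)),
     @stalk_map _ _ f x (germ Vf s) = @stalk_map _ _ g x (germ Vg s).
Proof. by move=> -> x V s Vf Vg; congr stalk_map; exact: germ_irr. Qed.

(** Locality in the form in which it is used: units are reflected. *)
Lemma stalk_unit f x (g : stalk (lms_sh Y) (lh_fun f x)) :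
  unit (@stalk_map _ _ f x g) -> unit g.
Proof.
move=> u; apply: contrapT => nu; exact: (lms_local (l := f) nu) u.
Qed.

End HomBasics.

Lemma stalk_comp (X Y Z : lms) (g : lms_hom Y Z) (f : lms_hom X Y) x
    (a : stalk (lms_sh Z) (lh_fun g (lh_fun f x))) :
  @stalk_map _ _ (lms_comp g f) x a =
  @stalk_map _ _ f x (@stalk_map _ _ g (lh_fun f x) a).
Proof.
have [V [Vx [s ->]]] := germ_surj a.
pose VY := opre (lh_fun g) V; pose VX := opre (lh_fun f) VY.
rewrite (@stalk_mapE _ _ (lms_comp g f) x V VX Vx Vx (@subpre _ _ _ _)) /=.
rewrite (@stalk_mapE _ _ g (lh_fun f x) V VY Vx Vx (@subpre _ _ _ _)).
by rewrite (@stalk_mapE _ _ f x VY VX Vx Vx (@subpre _ _ _ _)).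
Qed.

Lemma stalk_id (X : lms) x (a : stalk (lms_sh X) x) :
  @stalk_map _ _ (lms_id X) x a = a.
Proof.
have [V [Vx [s ->]]] := germ_surj a.
by rewrite (@stalk_mapE _ _ (lms_id X) x V V Vx Vx (@subo _ V)) /= res_id.
Qed.

(** The intrinsic form of an inclusion of an open subspace: an open injection
    that is bijective on stalks. *)
Record open_immersion (A X : lms) (j : lms_hom A X) : Prop := OpenImmersion {
  oe_inj : injective (lh_fun j);
  oe_open : forall O : set A, open O -> open (lh_fun j @` O);
  oe_stalk_inj : forall a, injective (@stalk_map _ _ j a);
  oe_stalk_surj : forall a g, exists G, @stalk_map _ _ j a G = g }.

Definition oe_img (A X : lms) (j : lms_hom A X) (J : open_immersion j) (V : opens A) :
  opens X := Opens (oe_open J (oset_open V)).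

Lemma oe_comp (A B C : lms) (g : lms_hom B C) (f : lms_hom A B) :
  open_immersion g -> open_immersion f -> open_immersion (lms_comp g f).
Proof.
move=> G F; split=> /=.
- by move=> x y /(oe_inj G)/(oe_inj F).
- move=> O oO; rewrite (_ : _ @` O = lh_fun g @` (lh_fun f @` O)); last by rewrite image_comp.
  by apply: (oe_open G); exact: (oe_open F).
- move=> a u v; rewrite !(@stalk_comp _ _ _ g f a).
  by move=> /(oe_stalk_inj F)/(oe_stalk_inj G).
- move=> a u; have [v <-] := oe_stalk_surj F u.
  have [w <-] := oe_stalk_surj G v; exists w; exact: (@stalk_comp _ _ _ g f a).
Qed.

Lemma oe_iso (A B : lms) (f : lms_hom A B) (g : lms_hom B A) :
  lms_comp g f = lms_id A -> lms_comp f g = lms_id B -> open_immersion f.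
Proof.
move=> gf fg.
have gfE x : lh_fun g (lh_fun f x) = x by rewrite -[RHS]/(lh_fun (lms_id A) x) -gf.
have fgE x : lh_fun f (lh_fun g x) = x by rewrite -[RHS]/(lh_fun (lms_id B) x) -fg.
split.
- exact: can_inj gfE.
- move=> O oO; rewrite (_ : _ @` O = lh_fun g @^-1` O).
    by apply: (continuousP (lh_fun g)).1 => //; exact: cts_fun.
  apply/seteqP; split=> [_ [x Ox <-]|y Oy] /=; first by rewrite gfE.
  by exists (lh_fun g y).
- move=> a u v; have [U [Ux [s ->]]] := germ_surj u.
  have [V [Vx [t ->]]] := germ_surj v.
  have Ua : oset (opre (lh_fun f) U) a := Ux.
  have Va : oset (opre (lh_fun f) V) a := Vx.
  rewrite -(germ_pull s (@subpre _ _ _ _) Ua) -(germ_pull t (@subpre _ _ _ _) Va).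
  move=> /germ_eq_near[W [Wa Wst]].
  have Ub : oset U (lh_fun f (lh_fun g (lh_fun f a))) by rewrite gfE.
  have Vb : oset V (lh_fun f (lh_fun g (lh_fun f a))) by rewrite gfE.
  have Wb : oset W (lh_fun g (lh_fun f a)) by rewrite gfE.
  have := congr1 (@stalk_map _ _ g (lh_fun f a)) (Wst _ Ub Vb Wb).
  rewrite (germ_pull s _ _ Ub) (germ_pull t _ _ Vb).
  rewrite -!(@stalk_comp _ _ _ f g (lh_fun f a)).
  rewrite (@hom_eq_stalk _ _ _ _ fg (lh_fun f a) U s Ub Ux).
  rewrite (@hom_eq_stalk _ _ _ _ fg (lh_fun f a) V t Vb Vx).
  by rewrite !stalk_id.
- move=> a u; have [V [Va [s ->]]] := germ_surj u.
  have Vb : oset V (lh_fun g (lh_fun f a)) by rewrite gfE.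
  exists (@stalk_map _ _ g (lh_fun f a) (germ Vb s)).
  rewrite -(@stalk_comp _ _ _ g f a).
  by rewrite (@hom_eq_stalk _ _ _ _ gf a V s Vb Va) stalk_id.
Qed.

Lemma oe_mono (A X Y : lms) (j : lms_hom A X) (h k : lms_hom Y A) :
  open_immersion j -> lms_comp j h = lms_comp j k -> h = k.
Proof.
move=> J e.
have pt y : lh_fun h y = lh_fun k y.
  apply: (oe_inj J); by rewrite -[LHS]/(lh_fun (lms_comp j h) y) e.
apply: lms_hom_ext => // y V s Vh Vk.
have [G] := oe_stalk_surj J (germ Vh s).
have [T [Th [t ->]]] := germ_surj G => e1.
have Tk : oset T (lh_fun j (lh_fun k y)) by rewrite -pt.
have e2 : @stalk_map _ _ j (lh_fun k y) (germ Tk t) = germ Vk s.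
  by move: (pt y) Tk Vk => <- Tk Vk; rewrite (germ_irr Tk Th) e1; exact: germ_irr.
rewrite -e1 -e2 -(@stalk_comp _ _ _ j h y) -(@stalk_comp _ _ _ j k y).
exact: hom_eq_stalk.
Qed.

(** The factorization is forced on points by injectivity and on stalks by
    inverting the stalk maps of [j]. It respects sections since a section of [A]
    comes, near each point, from a section of [X], which [f] pulls back. *)
Lemma oe_factor (A X Y : lms) (j : lms_hom A X) (f : lms_hom Y X) :
  open_immersion j -> (forall y, exists a, lh_fun j a = lh_fun f y) ->
  exists h : lms_hom Y A, lms_comp j h = f.
Proof.
move=> J /choice[p pE].
have pc : continuous p.
  apply/continuousP => O oO; rewrite (_ : _ @^-1` _ = lh_fun f @^-1` (lh_fun j @` O)).
    by apply: (continuousP (lh_fun f)).1; [exact: cts_fun|exact: (oe_open J)].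
  apply/seteqP; split=> [y Oy|y [a Oa /=]]; first by exists (p y).
  by rewrite -pE => /(oe_inj J) <-.
pose inv a g := projT1 (cid (oe_stalk_surj J (a := a) g)).
have invE a g : @stalk_map _ _ j a (inv a g) = g by rewrite /inv; case: cid.
have invK a G : inv a (@stalk_map _ _ j a G) = G by apply: (oe_stalk_inj J).
pose phi y (g : stalk (lms_sh A) (mkcts pc y)) : stalk (lms_sh Y) y :=
  @stalk_map _ _ f y (cast_stalk (pE y) (inv (p y) g)).
have invM a : GRing.nmod_morphism (inv a).
  have [j0 jD] := stalk_map_add j a.
  split=> [|u v]; apply: (oe_stalk_inj J); first by rewrite invE j0.
  by rewrite jD !invE.
have phiM y : GRing.nmod_morphism (@phi y).
  have [f0 fD] := stalk_map_add f y; have [i0 iD] := invM (p y).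
  have [c0 cD] := cast_stalkM (lms_sh X) (pE y).
  by split=> [|u v]; rewrite /phi ?i0 ?c0 ?f0 // iD cD fD.
have phil y : local (@phi y).
  move=> g; apply: contra_not => /stalk_unit/cast_stalk_unit u.
  by rewrite -(invE (p y) g); apply: unit_hom u; exact: stalk_map_add.
have phic (V : opens A) (s : lms_sh A V) y : oset V (mkcts pc y) ->
  exists (W : opens Y) (t : lms_sh Y W), oset W y /\
    forall z (Wz : oset W z) (Vz : oset V (mkcts pc z)), phi z (germ Vz s) = germ Wz t.
  move=> Vy; have [T [Ty [t tE]]] := germ_surj (inv (p y) (germ Vy s)).
  have Ty' : oset (opre (lh_fun j) T) (p y) := Ty.
  have : germ Vy s = germ Ty' (lh_sh (@subpre _ _ _ _) t).
    by rewrite (germ_pull t _ _ Ty) -tE invE.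
  move=> /germ_eq_near[N [Ny NE]].
  exists (opre (lh_fun f) (oI T (oe_img J N))).
  have TT : opre (lh_fun f) (oI T (oe_img J N)) `<=` lh_fun f @^-1` T by move=> z [].
  exists (lh_sh TT t); split=> [|z Wz Vz].
    split; first by have := Ty; rewrite /= pE.
    by exists (p y).
  have [Tz [a Na az]] := Wz.
  have ap : a = p z by apply: (oe_inj J); rewrite az pE.
  have Tz' : oset T (lh_fun j (p z)) by rewrite pE.
  rewrite (germ_pull t TT Wz Tz) /phi; congr stalk_map.
  rewrite ap in Na; rewrite (NE _ Vz Tz' Na) (germ_pull t _ _ Tz') invK.
  exact: cast_germ.
exists (mk_hom phiM phil phic); apply: lms_hom_ext => [y|y V s Vf Vg] /=.
  exact: pE.
rewrite (@stalk_comp _ _ _ j (mk_hom phiM phil phic) y) mk_hom_stalk /phi.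
by rewrite invK (cast_germ _ _ Vg).
Qed.

(** * Gluing morphisms along open immersions *)

(** The [q i] form an open cover of [X]. The hypothesis [compat] asks for
    agreement on some open subspace around each point of each overlap, rather
    than on fibre products, so that it applies where these do not exist. *)
Section Glue.
Variables (I : Type) (A : I -> lms) (X B : lms).
Variables (q : forall i, lms_hom (A i) X) (g : forall i, lms_hom (A i) B).
Hypothesis Q : forall i, open_immersion (q i).
Hypothesis cov : forall x, exists i a, lh_fun (q i) a = x.
Hypothesis compat : forall i k a b, lh_fun (q i) a = lh_fun (q k) b ->
  exists (C : lms) (c : C) (u : lms_hom C (A i)) (v : lms_hom C (A k)),
  [/\ lh_fun u c = a, lh_fun v c = b, open_immersion u, open_immersion v
    & lms_comp (q i) u = lms_comp (q k) v /\ lms_comp (g i) u = lms_comp (g k) v].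

Lemma lms_joint_epi (h k : lms_hom X B) :
  (forall i, lms_comp h (q i) = lms_comp k (q i)) -> h = k.
Proof.
move=> hk; apply: lms_hom_ext => x; have [i [a <-]] := cov x.
  by rewrite -[LHS]/(lh_fun (lms_comp h (q i)) a) hk.
move=> V s Vh Vk; apply: (oe_stalk_inj (Q i)).
rewrite -(@stalk_comp _ _ _ h (q i) a) -(@stalk_comp _ _ _ k (q i) a).
exact: hom_eq_stalk.
Qed.

Let compat_pt i k a b : lh_fun (q i) a = lh_fun (q k) b ->
  lh_fun (g i) a = lh_fun (g k) b.
Proof.
move=> /compat[C [c [u [v [<- <- _ _ [_ e]]]]]].
by rewrite -[LHS]/(lh_fun (lms_comp (g i) u) c) e.
Qed.

(** A germ on [X] should be the image of a germ on [B] if both have the same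
    pull-back at a point of the cover. This can be tested at any point above the
    given one ([same_pull_indep]), and it holds near a point where it holds
    ([same_pull_near]): thus it defines a morphism of sheaves. *)
Let same_pull i a V (s : lms_sh B V) U (S : lms_sh X U) :=
  exists (Ua : oset U (lh_fun (q i) a)) (Va : oset V (lh_fun (g i) a)),
    @stalk_map _ _ (q i) a (germ Ua S) = @stalk_map _ _ (g i) a (germ Va s).

Let same_pull_indep i k a b V (s : lms_sh B V) U (S : lms_sh X U) :
  lh_fun (q i) a = lh_fun (q k) b -> same_pull a s S -> same_pull b s S.
Proof.
move=> e [Ua [Va E]]; have Ub := Ua; rewrite e in Ub.
have Vb := Va; rewrite (compat_pt e) in Vb; exists Ub, Vb.
have [C [c [u [v [ua vb ou ov [qe ge]]]]]] := compat e.
case: _ / ua Ua Va E {e} => Ua Va E; case: _ / vb Ub Vb => Ub Vb.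
apply: (oe_stalk_inj ov).
rewrite -(@stalk_comp _ _ _ (q k) v c) -(@stalk_comp _ _ _ (g k) v c).
rewrite -(hom_eq_stalk qe S Ua Ub) -(hom_eq_stalk ge s Va Vb).
rewrite (@stalk_comp _ _ _ (q i) u c) (@stalk_comp _ _ _ (g i) u c).
by congr stalk_map.
Qed.

Let same_pull_near i a V (s : lms_sh B V) U (S : lms_sh X U) : same_pull (i := i) a s S ->
  exists W : opens X, oset W (lh_fun (q i) a) /\
    forall k b, oset W (lh_fun (q k) b) -> same_pull b s S.
Proof.
move=> [Ua [Va]].
have Ua' : oset (opre (lh_fun (q i)) U) a := Ua.
have Va' : oset (opre (lh_fun (g i)) V) a := Va.
rewrite -(germ_pull S (@subpre _ _ _ _) Ua') -(germ_pull s (@subpre _ _ _ _) Va').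
move=> /germ_eq_near[N [Na NE]].
exists (oe_img (Q i) (oI N (oI (opre (lh_fun (q i)) U) (opre (lh_fun (g i)) V)))).
split=> [|k b [d [Nd [Ud Vd]] db]]; first by exists a.
apply: (same_pull_indep db); exists Ud, Vd.
by rewrite -(germ_pull S (@subpre _ _ _ _) Ud) -(germ_pull s (@subpre _ _ _ _) Vd); exact: NE.
Qed.

Lemma lms_glue : exists h : lms_hom X B, forall i, lms_comp h (q i) = g i.
Proof.
have /choice[p pP] (x : X) : exists y : B, forall i a, lh_fun (q i) a = x -> lh_fun (g i) a = y.
  have [i [a ax]] := cov x; exists (lh_fun (g i) a) => k b bx.
  by apply: compat_pt; rewrite ax.
have pc : continuous p.
  apply/continuousP => O oO; rewrite openE => x /= Ox; have [i [a ax]] := cov x.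
  rewrite /interior nbhsE /=.
  exists (lh_fun (q i) @` (lh_fun (g i) @^-1` O)).
    split; last by exists a; rewrite //= (pP x).
    apply: (oe_open (Q i)); apply: (continuousP (lh_fun (g i))).1 => //.
    exact: cts_fun.
  by move=> _ [b Ob <-]; rewrite /= -(pP _ i b).
have pE i a : p (lh_fun (q i) a) = lh_fun (g i) a by rewrite -(pP _ i a).
(* [q i] is injective on stalks: at most one germ on [X] corresponds to [s]. *)
have sameE x V (s : lms_sh B V) U (Ux Ux' : oset U x) U' (Ux'' : oset U' x)
    (S : lms_sh X U) (S' : lms_sh X U') i a :
    lh_fun (q i) a = x -> same_pull a s S -> same_pull a s S' -> germ Ux S = germ Ux'' S'.
  move=> e; case: _ / e Ux Ux' Ux'' => Ux _ Ux'' [Ua [Va E]] [Ua' [Va' E']].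
  apply: (oe_stalk_inj (Q i)); rewrite (germ_irr Ux Ua) E (germ_irr Ux'' Ua') E'.
  by congr stalk_map; exact: germ_irr.
(* [q i] is surjective on stalks: each germ on [B] corresponds to one on [X]. *)
have ex x (g0 : stalk (lms_sh B) (mkcts pc x)) :
    exists G : stalk (lms_sh X) x, forall V Vx (s : lms_sh B V),
      g0 = germ Vx s -> exists U Ux (S : lms_sh X U), G = germ Ux S /\
      exists i a, lh_fun (q i) a = x /\ same_pull a s S.
  have [V0 [V0x [s0 g0E]]] := germ_surj g0.
  have [i [a ax]] := cov x.
  have V0a : oset V0 (lh_fun (g i) a) by rewrite -pE ax.
  have [G] := oe_stalk_surj (Q i) (@stalk_map _ _ (g i) a (germ V0a s0)).
  have [U [Ua [S ->]]] := germ_surj G => E.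
  have Ux : oset U x by rewrite -ax.
  exists (germ Ux S) => V Vx s; rewrite g0E => /germ_eq_near[W [Wx WE]].
  exists U, Ux, S; split=> //; exists i, a; split=> //.
  have Va : oset V (lh_fun (g i) a) by rewrite -pE ax.
  exists Ua, Va; rewrite E (WE _ V0a Va) //.
  by rewrite -pE ax.
pose phi x g0 := projT1 (cid (ex x g0)).
have phi_ex x V Vx (s : lms_sh B V) : exists U Ux (S : lms_sh X U),
    phi x (germ Vx s) = germ Ux S /\
      exists i a, lh_fun (q i) a = x /\ same_pull a s S.
  by rewrite /phi; case: cid => G /= /(_ V Vx s erefl).
have phiE x V Vx (s : lms_sh B V) U Ux (S : lms_sh X U) i a :
    lh_fun (q i) a = x -> same_pull a s S -> phi x (germ Vx s) = germ Ux S.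
  move=> ax sS.
  have [U' [Ux' [S' [-> [k [b [bx sS']]]]]]] := phi_ex x V Vx s.
  apply: (sameE x V s U' Ux' Ux' U Ux S' S k b bx sS').
  by apply: same_pull_indep sS; rewrite ax.
have phiM x : GRing.nmod_morphism (phi x).
  split=> [|u v].
    rewrite -(germ0 (lms_sh B) (Logic.I : oset (oT B) (mkcts pc x))).
    have [i [a ax]] := cov x.
    rewrite -(germ0 (lms_sh X) (Logic.I : oset (oT X) x)).
    apply: (phiE _ _ _ _ _ _ _ i a) => //.
    by exists Logic.I, Logic.I; rewrite !germ0 !(stalk_map_add _ _).1.
  have [V [Vx [s ->]]] := germ_surj u; have [V' [Vx' [s' ->]]] := germ_surj v.
  have [U [Ux [S [-> [i [a [ax [Ua [Va E]]]]]]]]] := phi_ex x V Vx s.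
  have [U' [Ux' [S' [-> [k [b [bx sS']]]]]]] := phi_ex x V' Vx' s'.
  have [|Ua' [Va' E']] := @same_pull_indep _ i _ a _ _ _ _ _ sS'; first by rewrite ax.
  have Vxx : oset (oI V V') (mkcts pc x) by [].
  have Uxx : oset (oI U U') x by [].
  rewrite -(germ_res (@oIl _ V V') Vx Vxx) -(germ_res (@oIr _ V V') Vx' Vxx).
  rewrite -(germ_res (@oIl _ U U') Ux Uxx) -(germ_res (@oIr _ U U') Ux' Uxx).
  rewrite -!germD; apply: (phiE _ _ _ _ _ _ _ i a) => //.
  have Uaa : oset (oI U U') (lh_fun (q i) a) by [].
  have Vaa : oset (oI V V') (lh_fun (g i) a) by [].
  exists Uaa, Vaa; rewrite !germD !(stalk_map_add _ _).2.
  rewrite (germ_res (@oIl _ V V') Va Vaa) (germ_res (@oIr _ V V') Va' Vaa).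
  rewrite (germ_res (@oIl _ U U') Ua Uaa) (germ_res (@oIr _ U U') Ua' Uaa).
  by rewrite E E'.
have phil x : local (phi x).
  move=> u; apply: contra_not; have [V [Vx [s ->]]] := germ_surj u.
  have [U [Ux [S [-> [i [a [ax [Ua [Va E]]]]]]]]] := phi_ex x V Vx s.
  case: _ / ax Vx Ux => Vx Ux.
  move=> /(unit_hom (stalk_map_add (q i) a)); rewrite (germ_irr Ux Ua) E.
  move=> /stalk_unit; rewrite -(cast_germ (pE i a) Vx Va).
  exact: cast_stalk_unit.
have phic (V : opens B) (s : lms_sh B V) x : oset V (mkcts pc x) ->
    exists (W : opens X) (t : lms_sh X W), oset W x /\
      forall z (Wz : oset W z) (Vz : oset V (mkcts pc z)), phi z (germ Vz s) = germ Wz t.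
  move=> Vx; have [U [Ux [S [_ [i [a [ax sS]]]]]]] := phi_ex x V Vx s.
  have [W [Wx Wsame]] := same_pull_near sS; rewrite ax in Wx.
  exists (oI U W), (res (@oIl _ U W) S); split=> // z Wz Vz.
  rewrite (germ_res _ (oIl Wz)); have [k [b bz]] := cov z.
  apply: (phiE _ _ _ _ _ _ _ k b) => //; apply: Wsame; rewrite bz.
  by case: Wz.
exists (mk_hom phiM phil phic) => i; apply: lms_hom_ext => [a|a V s Vf Vg] /=.
  exact: pE.
rewrite (@stalk_comp _ _ _ (mk_hom phiM phil phic) (q i) a) mk_hom_stalk.
have [U [Ux [S [-> [k [b [ba sS]]]]]]] := phi_ex (lh_fun (q i) a) V Vf s.
have [Ua [Va E]] := same_pull_indep ba sS.
by rewrite (germ_irr Ux Ua) E; congr stalk_map; exact: germ_irr.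
Qed.

End Glue.

(** * Gluing locally monoidal spaces over a forest *)
Lemma restr_oe (X : lms) (U : opens X) : open_immersion (restr_incl U).
Proof.
split.
- exact: val_inj.
- by move=> O oO; exact: (@set_val_open X U (Opens oO)).
- move=> y g h; have [V [Vx [s ->]]] := germ_surj g.
  have [W [Wx [t ->]]] := germ_surj h.
  rewrite (@stalk_mapE _ _ (restr_incl U) y V (opre (incl_map U) V) Vx Vx (@subpre _ _ _ _)).
  rewrite (@stalk_mapE _ _ (restr_incl U) y W (opre (incl_map U) W) Wx Wx (@subpre _ _ _ _)).
  move=> /germP[O [OV [OW [Oy /=]]]]; rewrite !res_res => e; apply/germP.
  exists (oimg O), (subset_trans (oimgS OV) (sub_oimg (@subpre _ _ (incl_map U) V))),
    (subset_trans (oimgS OW) (sub_oimg (@subpre _ _ (incl_map U) W))).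
  by split; [exists y|].
- move=> y g; have [W [Wy [s ->]]] := germ_surj g.
  have Wy' : oset (oimg W) (set_val y) by exists y.
  exists (@germ _ (lms_sh X) _ (oimg W) Wy' s).
  have WW : W `<=` incl_map U @^-1` oimg W by move=> z Wz; exists z.
  rewrite (@stalk_mapE _ _ (restr_incl U) y (oimg W) W Wy' Wy WW) /=.
  by congr germ; exact: (@res_id _ (lms_sh X) (oimg W)).
Qed.

Lemma restr_factor (X Y : lms) (U : opens X) (f : lms_hom Y X) :
  (forall y, oset U (lh_fun f y)) -> exists h, lms_comp (restr_incl U) h = f.
Proof.
move=> fU; apply: (oe_factor (restr_oe U)) => y.
by exists (SigSub (mem_set (fU y))).
Qed.

Lemma restr_incl_in (X : lms) (U : opens X) (y : restr_lms U) :
  oset U (lh_fun (restr_incl U) y).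
Proof. exact: set_valP. Qed.

(** The index preorder is a forest: the elements below a given one are pairwise
    comparable. Coproducts, pushouts of open immersions and unions of chains are
    all colimits over forests, so that one construction serves for them. *)
Section Forest.
Variables (I : smallType) (R : I -> I -> Prop).
Hypothesis Rxx : forall i, R i i.
Hypothesis Rtr : forall i j k, R i j -> R j k -> R i k.
Hypothesis Rforest : forall i j k, R i k -> R j k -> R i j \/ R j i.
Variables (A : I -> lms) (t : forall i j, R i j -> lms_hom (A i) (A j)).
Hypothesis t_id : forall i (r : R i i), t r = lms_id (A i).
Hypothesis t_comp : forall i j k (r : R i j) (r' : R j k) (r'' : R i k),
  lms_comp (t r') (t r) = t r''.
Hypothesis t_oe : forall i j (r : R i j), open_immersion (t r).

Let t_idE i (r : R i i) a : lh_fun (t r) a = a.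
Proof. by rewrite t_id. Qed.

Let t_compE i j k (r : R i j) (r' : R j k) (r'' : R i k) a :
  lh_fun (t r') (lh_fun (t r) a) = lh_fun (t r'') a.
Proof. by rewrite -(t_comp r r'). Qed.

(** Two points are glued as soon as they have a common ancestor; over a forest
    this is already transitive. *)
Definition forest_rel (z w : {i & A i}) := exists k (c : A k)
  (r : R k (projT1 z)) (r' : R k (projT1 w)),
  lh_fun (t r) c = projT2 z /\ lh_fun (t r') c = projT2 w.

Let rel_refl z : forest_rel z z.
Proof. by case: z => i a; exists i, a, (Rxx i), (Rxx i); rewrite !t_idE. Qed.

Let rel_sym z w : forest_rel z w -> forest_rel w z.
Proof. by move=> [k [c [r [r' [e e']]]]]; exists k, c, r', r. Qed.

(** The forest condition makes [i] and [k] comparable, and an open immersion is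
    injective, so that one of the two ancestors is the image of the other. *)
Lemma forest_common i k j (r : R i j) (r' : R k j) (a : A i) (b : A k) :
  lh_fun (t r) a = lh_fun (t r') b ->
  (exists s : R i k, b = lh_fun (t s) a) \/ (exists s : R k i, a = lh_fun (t s) b).
Proof.
move=> e; have [s|s] := Rforest r r'; [left|right]; exists s.
  by apply: (oe_inj (t_oe r')); rewrite -e (t_compE s r' r).
by apply: (oe_inj (t_oe r)); rewrite e (t_compE s r r').
Qed.

Let rel_trans z w v : forest_rel z w -> forest_rel w v -> forest_rel z v.
Proof.
move=> [k [c [r [r' [e e']]]]] [l [d [s [s' [f f']]]]].
have [|[u cd]|[u cd]] := @forest_common _ _ _ r' s c d; first by rewrite e' f.
  exists k, c, r, (Rtr u s'); split=> //.
  by rewrite -(t_compE u s') -cd.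
exists l, d, (Rtr u r), s'; split=> //.
by rewrite -(t_compE u r) -cd.
Qed.

(** The quotient, as the type of equivalence classes. *)
Record glued := Glued {
  gl_set : set {i & A i};
  gl_setP : exists z, gl_set = forest_rel z }.

Let glued_eq (x y : glued) : gl_set x = gl_set y -> x = y.
Proof.
case: x y => [x xP] [y yP] /= e; case: _ / e yP => yP.
by congr Glued; exact: Prop_irrelevance.
Qed.

Definition gl_fun i (a : A i) : glued :=
  @Glued (forest_rel (existT _ i a)) (ex_intro _ _ erefl).

Lemma gl_surj (x : glued) : exists i a, x = gl_fun (i := i) a.
Proof.
by case: x => s [[i a] e]; exists i, a; apply: glued_eq.
Qed.

Lemma gl_eq i j (a : A i) (b : A j) :
  gl_fun a = gl_fun b <-> forest_rel (existT _ i a) (existT _ j b).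
Proof.
split=> [[e]|ab]; first by rewrite e; exact: rel_refl.
apply: glued_eq; apply/seteqP; split=> z /=; first exact/rel_trans/rel_sym.
exact: rel_trans.
Qed.

Lemma gl_inj i : injective (@gl_fun i).
Proof.
move=> a b /gl_eq[k [c [r [r' /= [<- <-]]]]].
by rewrite (Prop_irrelevance r r').
Qed.

Lemma gl_t i j (r : R i j) a : gl_fun (lh_fun (t r) a) = gl_fun a.
Proof. by apply/gl_eq; exists i, a, r, (Rxx i); rewrite t_idE. Qed.

HB.instance Definition _ := gen_eqMixin glued.
HB.instance Definition _ := gen_choiceMixin glued.

Definition gl_open : set_system glued :=
  [set O | forall i, open (@gl_fun i @^-1` O)].

Let gl_openT : gl_open setT.
Proof. by move=> i; exact: openT. Qed.

Let gl_openI : setI_closed gl_open.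
Proof. by move=> U V oU oV i; exact: openI. Qed.

Let gl_open_bigU (K : Type) (f : K -> set glued) :
  (forall k, gl_open (f k)) -> gl_open (\bigcup_k f k).
Proof.
move=> of_ i; rewrite (_ : _ @^-1` _ = \bigcup_k (@gl_fun i @^-1` f k)).
  by apply: bigcup_open => k _; exact: of_.
by apply/seteqP; split=> x [k _ ?]; exists k.
Qed.

HB.instance Definition _ := isOpenTopological.Build glued
  gl_openT gl_openI gl_open_bigU.

Lemma gl_openE (O : set glued) : open O = gl_open O.
Proof. by []. Qed.

Lemma gl_continuous i : continuous (@gl_fun i).
Proof. by apply/continuousP => O oO; exact: oO. Qed.

Definition gl_map i : continuousType (A i) glued := mkcts (@gl_continuous i).

(** The trace on [A j] of the image of [O] is the union, over the common
    predecessors [k] of [i] and [j], of the open sets obtained by pulling [O]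
    back to [A k] and pushing it forward to [A j]. *)
Lemma gl_open_map i (O : set (A i)) : open O -> open (@gl_fun i @` O).
Proof.
rewrite gl_openE => oO j.
rewrite (_ : _ @^-1` _ = \bigcup_(k in [set k : {k & (R k i * R k j)%type} | True])
   (lh_fun (t (projT2 k).2) @` (lh_fun (t (projT2 k).1) @^-1` O))).
  apply: bigcup_open => -[k [r r']] _ /=; apply: (oe_open (t_oe r')).
  by apply: (continuousP (lh_fun (t r))).1 => //; exact: cts_fun.
apply/seteqP; split=> b /=.
  move=> [a Oa /gl_eq[k [c [r [r' /= [e e']]]]]].
  by exists (existT _ k (r, r')) => //=; exists c => //=; rewrite e.
move=> [[k [r r']] _ /= [c Oc <-]]; exists (lh_fun (t r) c) => //.
by rewrite !gl_t.
Qed.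

Definition gl_img i (V : opens (A i)) : opens glued :=
  Opens (@gl_open_map i V (oset_open V)).

(** A section of the limit of the push-forwards of the structure sheaves. *)
Record gl_sec (W : opens glued) := GlSec {
  gsec : forall i, lms_sh (A i) (opre (gl_map i) W);
  gsecP : forall i j (r : R i j) b (Wb : oset W (gl_fun b))
      (Wb' : oset W (gl_fun (lh_fun (t r) b))),
    @germ _ _ b (opre (gl_map i) W) Wb (gsec i) =
    @stalk_map _ _ (t r) b (@germ _ _ _ (opre (gl_map j) W) Wb' (gsec j)) }.

Lemma gl_sec_eq W (s s' : gl_sec W) : (forall i, gsec s i = gsec s' i) -> s = s'.
Proof.
case: s s' => s sP [s' s'P] /= e.
have {}e : s = s' by apply: functional_extensionality_dep.
by case: _ / e s'P => s'P; congr GlSec; exact: Prop_irrelevance.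
Qed.

Definition gl_zero W : gl_sec W.
Proof.
exists (fun i => 0) => i j r b Wb Wb'.
by rewrite !germ0 (stalk_map_add (t r) b).1.
Defined.

Definition gl_add W (s s' : gl_sec W) : gl_sec W.
Proof.
exists (fun i => gsec s i + gsec s' i) => i j r b Wb Wb'.
by rewrite !germD (stalk_map_add (t r) b).2 -!gsecP.
Defined.

Section GlSecMonoid.
Variable W : opens glued.
HB.instance Definition _ := gen_eqMixin (gl_sec W).
HB.instance Definition _ := gen_choiceMixin (gl_sec W).

Let gl_addA : associative (@gl_add W).
Proof. by move=> s u v; apply: gl_sec_eq => i /=; rewrite addrA. Qed.
Let gl_addC : commutative (@gl_add W).
Proof. by move=> s u; apply: gl_sec_eq => i /=; rewrite addrC. Qed.
Let gl_add0 : left_id (gl_zero W) (@gl_add W).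
Proof. by move=> s; apply: gl_sec_eq => i /=; rewrite add0r. Qed.

HB.instance Definition _ :=
  GRing.isNmodule.Build (gl_sec W) gl_addA gl_addC gl_add0.
End GlSecMonoid.

Let pre_sub (W V : opens glued) (VW : V `<=` W) i :
  opre (gl_map i) V `<=` opre (gl_map i) W.
Proof. by move=> a /VW. Qed.

Definition gl_res (W V : opens glued) (VW : V `<=` W) (s : gl_sec W) : gl_sec V.
Proof.
exists (fun i => res (@pre_sub _ _ VW i) (gsec s i)) => i j r b Vb Vb'.
rewrite (germ_res (@pre_sub _ _ VW i) (VW _ Vb)) (germ_res (@pre_sub _ _ VW j) (VW _ Vb')).
exact: gsecP.
Defined.

Definition gl_presheaf : presheaf glued.
Proof.
refine (@Presheaf glued (fun W => gl_sec W) gl_res _ _ _).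
- move=> U V VU; split=> [|s s']; apply: gl_sec_eq => i /=; first exact: res0.
  exact: resD.
- by move=> U UU s; apply: gl_sec_eq => i /=; exact: res_id.
- by move=> U V W VU WV WU s; apply: gl_sec_eq => i /=; exact: res_comp.
Defined.

Lemma gl_sheafP : is_sheaf gl_presheaf.
Proof.
move=> U K V VU cov s sV.
have covi i : opre (gl_map i) U `<=` \bigcup_k opre (gl_map i) (V k).
  by move=> a /cov[k _ ?]; exists k.
have gl i : exists! u : lms_sh (A i) (opre (gl_map i) U),
    forall k, res (@pre_sub _ _ (VU k) i) u = gsec (s k) i.
  apply: (@lms_sheafP (A i) _ K _ _ (covi i)) => k l W Wk Wl.
  apply: germ_ext => a Wa.
  have Va : oset (oI (V k) (V l)) (gl_fun a) by split; [exact: Wk|exact: Wl].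
  have := congr1 (fun u => @germ _ _ a (opre (gl_map i) (oI (V k) (V l))) Va (gsec u i))
    (sV k l (oI (V k) (V l)) (@oIl _ _ _) (@oIr _ _ _)).
  rewrite /= (germ_res _ (Wk _ Wa)) (germ_res _ (Wl _ Wa)).
  by rewrite (germ_res _ (Wk _ Wa)) (germ_res _ (Wl _ Wa)).
pose u i := projT1 (cid (gl i)).
have uE i k : res (@pre_sub _ _ (VU k) i) (u i) = gsec (s k) i.
  by rewrite /u; case: cid => /= ? [].
have uP i j (r : R i j) b (Wb : oset U (gl_fun b))
      (Wb' : oset U (gl_fun (lh_fun (t r) b))) :
    @germ _ _ b (opre (gl_map i) U) Wb (u i) =
    @stalk_map _ _ (t r) b (@germ _ _ _ (opre (gl_map j) U) Wb' (u j)).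
  have [k _ Vb] := cov _ Wb; have Vb' := Vb; rewrite /= -(gl_t r) in Vb'.
  rewrite -(germ_res (@pre_sub _ _ (VU k) i) Wb Vb) -(germ_res (@pre_sub _ _ (VU k) j) Wb' Vb').
  by rewrite !uE; exact: gsecP.
exists (GlSec uP); split=> [k|u' u'E]; apply: gl_sec_eq => i /=; first exact: uE.
rewrite /u; case: cid => v /= [_]; apply => k.
by rewrite -u'E.
Qed.

Definition gl_lms : lms := Lms gl_sheafP.

Let leg_sub i (V : opens gl_lms) (U : opens (A i)) (UV : U `<=` gl_map i @^-1` V) :
  U `<=` opre (gl_map i) V := UV.

Definition pre_gl_hom i : pre_lms_hom (A i) gl_lms.
Proof.
refine (@PreLmsHom (A i) gl_lms (gl_map i)
  (fun V U UV s => res (leg_sub UV) (gsec s i)) _ _).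
- by move=> V U UV; split=> [|s s'] /=; [exact: res0|exact: resD].
- by move=> V V' U U' UV UV' V'V U'U s /=; rewrite !res_res; exact: res_irr.
Defined.

Lemma pre_gl_stalk i a (V : opens gl_lms) (Va : oset V (gl_fun a))
    (Va' : oset (opre (gl_map i) V) a) (s : gl_sec V) :
  @stalk_map _ _ (pre_gl_hom i) a (@germ _ gl_presheaf _ V Va s) =
  germ Va' (gsec s i).
Proof.
rewrite (@stalk_mapE _ _ (pre_gl_hom i) a V (opre (gl_map i) V) Va Va' (@subpre _ _ _ _)).
by rewrite /= res_id.
Qed.

Lemma gl_stalk_inj i a : injective (@stalk_map _ _ (pre_gl_hom i) a).
Proof.
move=> g h; have [V [Va [s ->]]] := germ_surj g.
have [W [Wa [s' ->]]] := germ_surj h.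
rewrite (pre_gl_stalk Va Va) (pre_gl_stalk Wa Wa) => /germ_eq_near[N [Na NE]].
pose O := oI (gl_img N) (oI V W).
have OV : O `<=` V by move=> x [_ []].
have OW : O `<=` W by move=> x [_ []].
apply/germP; exists O, OV, OW; split; first by split=> //; exists a.
apply: gl_sec_eq => j; apply: germ_ext => b Ob /=.
have [[a' Na' /gl_eq[k [c [r [r' /= [ca cb]]]]]] [Vb Wb]] := Ob.
apply: etrans (germ_res (@pre_sub _ _ OV j) Vb Ob (gsec s j)) _.
apply: etrans (esym (germ_res (@pre_sub _ _ OW j) Wb Ob (gsec s' j))).
have ab : gl_fun a' = gl_fun b by rewrite -ca -cb !gl_t.
have Va' : oset V (gl_fun a') by rewrite ab.
have Wa' : oset W (gl_fun a') by rewrite ab.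
have := NE a' Va' Wa' Na'.
case: _ / ca Na' Va' Wa' {ab} => _ Va' Wa' e; case: _ / cb Ob Vb Wb => _ Vb Wb.
apply: (oe_stalk_inj (t_oe r')).
have Vc : oset V (gl_fun c) by rewrite -(gl_t r).
have Wc : oset W (gl_fun c) by rewrite -(gl_t r).
rewrite -(@gsecP _ s _ _ r' c Vc Vb) -(@gsecP _ s' _ _ r' c Wc Wb).
rewrite (@gsecP _ s _ _ r c Vc Va') (@gsecP _ s' _ _ r c Wc Wa').
by rewrite e.
Qed.

(** A section [s] on an open part of [A i] extends to the image of this part in
    the colimit: on [A j] it is the section obtained by transporting [s] along
    all roofs from [A i] to [A j]. This makes the inclusions surjective on
    stalks. *)
Section Extend.
Variables (i : I) (N : opens (A i)) (s : lms_sh (A i) N).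

(** A roof [A i <- A k -> A j] identifies a germ of [s] with the germ of [u]. *)
Let ext_at j (b : A j) (V : opens (A j)) (u : lms_sh (A j) V) :=
  exists k c (r : R k i) (r' : R k j) (Nc : oset N (lh_fun (t r) c))
    (Vc : oset V (lh_fun (t r') c)), lh_fun (t r') c = b /\
    @stalk_map _ _ (t r) c (germ Nc s) = @stalk_map _ _ (t r') c (germ Vc u).

(** Two roofs over [b] are comparable by [forest_common], and then both give the
    same germ. *)
Let ext_at_uniq j b (V : opens (A j)) (Vb : oset V b) (u : lms_sh (A j) V)
  (V' : opens (A j)) (Vb' : oset V' b) (u' : lms_sh (A j) V') :
  ext_at b u -> ext_at b u' -> germ Vb u = germ Vb' u'.
Proof.
move=> [k [c [r [r' [Nc [Vc [cb e]]]]]]] [l [d [q [q' [Nd [Vd [db f]]]]]]].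
have [|[p cd]|[p cd]] := @forest_common _ _ _ r' q' c d; first by rewrite cb db.
- case: _ / cb Vb Vb' db => Vb Vb' db; subst d.
  apply: (oe_stalk_inj (t_oe r')); rewrite (germ_irr Vb Vc) -e.
  rewrite (hom_eq_stalk (esym (t_comp p q r)) s Nc Nd).
  rewrite (@stalk_comp _ _ _ (t q) (t p) c) f.
  rewrite -(@stalk_comp _ _ _ (t q') (t p) c).
  exact: (hom_eq_stalk (t_comp p q' r') u').
- case: _ / db Vb Vb' cb => Vb Vb' cb; subst c.
  apply: (oe_stalk_inj (t_oe q')); rewrite (germ_irr Vb' Vd) -f.
  rewrite (hom_eq_stalk (esym (t_comp p r q)) s Nd Nc).
  rewrite (@stalk_comp _ _ _ (t r) (t p) d) e.
  rewrite -(@stalk_comp _ _ _ (t r') (t p) d).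
  exact: (hom_eq_stalk (esym (t_comp p r' q')) u).
Qed.

Let ext_at_near j b (V : opens (A j)) (u : lms_sh (A j) V) : ext_at b u ->
  exists W : opens (A j), oset W b /\ forall b', oset W b' -> ext_at b' u.
Proof.
move=> [k [c [r [r' [Nc [Vc [cb e]]]]]]]; move: e.
have Nc' : oset (opre (lh_fun (t r)) N) c := Nc.
have Vc' : oset (opre (lh_fun (t r')) V) c := Vc.
rewrite -(germ_pull s (@subpre _ _ _ _) Nc') -(germ_pull u (@subpre _ _ _ _) Vc').
move=> /germ_eq_near[M [Mc ME]].
exists (oe_img (t_oe r') (oI M (oI (opre (lh_fun (t r)) N) (opre (lh_fun (t r')) V)))).
split=> [|b' [d [Md [Nd Vd]] db']]; first by exists c.
exists k, d, r, r', Nd, Vd; split=> //.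
by rewrite -(germ_pull s (@subpre _ _ _ _) Nd) -(germ_pull u (@subpre _ _ _ _) Vd); exact: ME.
Qed.

Let ext_at_ex j b : oset (gl_img N) (gl_fun b) ->
  exists (V : opens (A j)) (Vb : oset V b) (u : lms_sh (A j) V), ext_at b u.
Proof.
move=> [a Na /gl_eq[k [c [r [r' /= [ca cb]]]]]].
have Nc : oset N (lh_fun (t r) c) by rewrite ca.
have [g] := oe_stalk_surj (t_oe r') (@stalk_map _ _ (t r) c (germ Nc s)).
have [V [Vc [u ->]]] := germ_surj g => e.
have Vb : oset V b by rewrite -cb.
by exists V, Vb, u, k, c, r, r', Nc, Vc.
Qed.

Lemma gl_extend : exists S : gl_sec (gl_img N), forall a (Na : oset N a)
  (Na' : oset (gl_img N) (gl_fun a)),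
  @germ _ _ a (opre (gl_map i) (gl_img N)) Na' (gsec S i) = germ Na s.
Proof.
have sec j : exists v : lms_sh (A j) (opre (gl_map j) (gl_img N)),
    forall b (Nb : oset (gl_img N) (gl_fun b)), exists (V : opens (A j))
      (Vb : oset V b) (u : lms_sh (A j) V), ext_at b u /\
      @germ _ _ b (opre (gl_map j) (gl_img N)) Nb v = germ Vb u.
  have gx b (Nb : oset (opre (gl_map j) (gl_img N)) b) :
      exists g : stalk (lms_sh (A j)) b, exists (V : opens (A j))
      (Vb : oset V b) (u : lms_sh (A j) V), ext_at b u /\ g = germ Vb u.
    by have [V [Vb [u ub]]] := ext_at_ex Nb; exists (germ Vb u), V, Vb, u.
  have [|v vE] := @germ_glue (A j) (opre (gl_map j) (gl_img N))
    (fun b Nb => projT1 (cid (gx b Nb))).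
    move=> b Nb; have [V [Vb [u ub]]] := ext_at_ex Nb.
    have [W [Wb WE]] := ext_at_near ub.
    pose V' := oI (opre (gl_map j) (gl_img N)) (oI V W).
    have V'V : V' `<=` V by move=> y [_ []].
    exists V', (res V'V u); split=> //; first by move=> y [].
    move=> y Ny Vy; case: cid => g /= [V2 [V2y [u2 [u2y ->]]]].
    rewrite (germ_res V'V (V'V _ Vy)); apply: ext_at_uniq => //.
    by apply: WE; case: Vy => _ [].
  exists v => b Nb; have := vE b Nb; case: cid => g /= [V [Vb [u [ub gu]]]] e.
  by exists V, Vb, u; split=> //; rewrite -gu -e; exact: germ_irr.
pose v j := projT1 (cid (sec j)).
have vP j b (Nb : oset (gl_img N) (gl_fun b)) : exists (V : opens (A j))
      (Vb : oset V b) (u : lms_sh (A j) V), ext_at b u /\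
      @germ _ _ b (opre (gl_map j) (gl_img N)) Nb (v j) = germ Vb u.
  by rewrite /v; case: cid.
have vC j l (r : R j l) b (Wb : oset (gl_img N) (gl_fun b))
      (Wb' : oset (gl_img N) (gl_fun (lh_fun (t r) b))) :
    @germ _ _ b (opre (gl_map j) (gl_img N)) Wb (v j) =
    @stalk_map _ _ (t r) b (@germ _ _ _ (opre (gl_map l) (gl_img N)) Wb' (v l)).
  have [V [Vb [u [ub ->]]]] := vP j b Wb.
  have [V' [Vb' [u' [ub' ->]]]] := vP l _ Wb'.
  rewrite -(germ_pull u' (@subpre _ _ (lh_fun (t r)) V') Vb').
  apply: ext_at_uniq => //.
  (* A roof to [A l] has to be turned into a roof to [A j]: its vertex is
     comparable with [j], and if it lies above [j] then [j] itself serves. *)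
  have [k [c [q [q' [Nc [Vc [cb e]]]]]]] := ub'.
  have [|[p cb']|[p cb']] := @forest_common _ _ _ q' r c b; first by rewrite cb.
    subst b.
    exists k, c, q, p, Nc, Vb'; split=> //; rewrite e.
    rewrite (germ_pull u' _ _ Vb') -(@stalk_comp _ _ _ (t r) (t p) c).
    exact: (hom_eq_stalk (esym (t_comp p r q'))).
  subst c.
  have Nb : oset N (lh_fun (t (Rtr p q)) b) by rewrite -(t_compE p q).
  have jj := Rxx j.
  have Vjb : oset (opre (lh_fun (t r)) V') (lh_fun (t jj) b) by rewrite /= t_idE.
  exists j, b, (Rtr p q), jj, Nb, Vjb; split; first by rewrite t_idE.
  rewrite (hom_eq_stalk (esym (t_comp p q (Rtr p q))) s Nb Nc).
  rewrite (@stalk_comp _ _ _ (t q) (t p) b) e.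
  rewrite -(@stalk_comp _ _ _ (t q') (t p) b).
  rewrite (hom_eq_stalk (t_comp p q' r) u' Vc Vb').
  rewrite (hom_eq_stalk (t_id jj) _ Vjb (Vb' : oset (opre (lh_fun (t r)) V') b)).
  by rewrite stalk_id (germ_pull u' _ _ Vb').
exists (GlSec vC) => a Na Na' /=.
have [V [Va [u [ua ->]]]] := vP i a Na'; apply: ext_at_uniq => //.
have ii := Rxx i; have Na2 : oset N (lh_fun (t ii) a) by rewrite t_idE.
by exists i, a, ii, ii, Na2, Na2; split; first exact: t_idE.
Qed.

End Extend.

Lemma gl_stalk_surj i a g : exists G, @stalk_map _ _ (pre_gl_hom i) a G = g.
Proof.
have [N [Na [s ->]]] := germ_surj g; have [S SE] := gl_extend s.
have Na' : oset (gl_img N) (gl_fun a) by exists a.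
exists (@germ _ gl_presheaf _ (gl_img N) Na' S).
by rewrite (pre_gl_stalk Na' Na'); exact: SE.
Qed.

Lemma gl_hom_local i a : local (@stalk_map _ _ (pre_gl_hom i) a).
Proof.
move=> g; apply: contra_not => -[h]; have [G <-] := gl_stalk_surj h => e.
exists G; apply: (@gl_stalk_inj i a).
by rewrite (stalk_map_add (pre_gl_hom i) a).2 e (stalk_map_add (pre_gl_hom i) a).1.
Qed.

Definition gl_hom i : lms_hom (A i) gl_lms := LmsHom (@gl_hom_local i).

Lemma gl_oe i : open_immersion (gl_hom i).
Proof.
split; [exact: gl_inj|exact: gl_open_map|exact: gl_stalk_inj|].
exact: gl_stalk_surj.
Qed.

Lemma gl_hom_t i j (r : R i j) : lms_comp (gl_hom j) (t r) = gl_hom i.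
Proof.
apply: lms_hom_ext => [a|a V s Vf Vg]; first exact: gl_t.
rewrite (@stalk_comp _ _ _ (gl_hom j) (t r) a).
rewrite (@pre_gl_stalk j _ V Vf Vf s) (@pre_gl_stalk i _ V Vg Vg s).
by rewrite (@gsecP _ s _ _ r a Vg Vf).
Qed.

Lemma gl_univ (B : lms) (g : forall i, lms_hom (A i) B) :
  (forall i j (r : R i j), lms_comp (g j) (t r) = g i) ->
  exists! h : lms_hom gl_lms B, forall i, lms_comp h (gl_hom i) = g i.
Proof.
move=> gE; have cov (x : gl_lms) : exists i a, lh_fun (gl_hom i) a = x.
  by have [i [a ->]] := gl_surj x; exists i, a.
have [|h hE] := lms_glue (g := g) gl_oe cov.
  move=> i k a b /gl_eq[l [c [r [r' /= [ca cb]]]]].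
  by exists (A l), c, (t r), (t r'); rewrite !gl_hom_t !gE.
exists h; split=> // h' h'E; apply: (lms_joint_epi gl_oe cov) => i.
by rewrite hE h'E.
Qed.

End Forest.

(** * Colimits of commutative monoids *)

(** The diagram is given by relations between the elements rather than by maps,
    since the stalks to be amalgamated below sit over points that are equal only
    propositionally. *)
Section MonoidColimit.
Variables (K : Type) (P : K -> nmodType) (R : forall i j, P i -> P j -> Prop).

Definition colim_compat (Q : nmodType) (g : forall k, P k -> Q) :=
  (forall k, GRing.nmod_morphism (g k)) /\
  forall i j (a : P i) (b : P j), R a b -> g i a = g j b.

Definition colim_eval (Q : nmodType) (g : forall k, P k -> Q)
    (s : seq {k & P k}) : Q :=
  \sum_(z <- s) g (projT1 z) (projT2 z).

(** The congruence is defined impredicatively, by testing against all compatible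
    families. Thus the universal property holds by construction, and no explicit
    generation of a congruence is needed. *)
Definition colim_eqv (s t : seq {k & P k}) :=
  forall (Q : nmodType) (g : forall k, P k -> Q), colim_compat g ->
    colim_eval g s = colim_eval g t.

Lemma colim_eval_cat (Q : nmodType) (g : forall k, P k -> Q) s t :
  colim_eval g (s ++ t) = colim_eval g s + colim_eval g t.
Proof. exact: big_cat. Qed.

Definition colim_premonoid : premonoid.
Proof.
refine (@Premonoid (seq {k & P k}) colim_eqv cat [::] _ _ _ _ _ _ _).
- by move=> s Q g _.
- by move=> s t st Q g gc; rewrite st.
- by move=> s t u st tu Q g gc; rewrite st // tu.
- by move=> s t u st Q g gc; rewrite !colim_eval_cat st.
- by move=> s t u Q g gc; rewrite catA.
- by move=> s t Q g gc; rewrite !colim_eval_cat addrC.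
- by move=> s Q g gc.
Defined.

Definition colim : nmodType := quot_monoid colim_premonoid.

Definition colim_in k (a : P k) : colim :=
  @cls colim_premonoid [:: existT _ k a].

Lemma colim_inE k (a : P k) (Q : nmodType) (g : forall k, P k -> Q) :
  colim_eval g [:: existT _ k a] = g k a.
Proof. by rewrite /colim_eval big_seq1. Qed.

Lemma colim_in_add k : GRing.nmod_morphism (@colim_in k).
Proof.
split=> [|a b].
  rewrite -(cls0 colim_premonoid); apply/clsP => Q g [gM _].
  by rewrite colim_inE (gM k).1 /colim_eval big_nil.
rewrite -(@clsD colim_premonoid); apply/clsP => Q g [gM _].
by rewrite [RHS]colim_eval_cat !colim_inE (gM k).2.
Qed.

Lemma colim_in_rel i j (a : P i) (b : P j) : R a b -> colim_in a = colim_in b.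
Proof. by move=> ab; apply/clsP => Q g [_ gR]; rewrite !colim_inE (gR _ _ _ _ ab). Qed.

(** The colimit is generated by the images of the [P k]. *)
Lemma colim_ind (C : colim -> Prop) : C 0 ->
  (forall k (a : P k), C (colim_in a)) -> (forall u v, C u -> C v -> C (u + v)) ->
  forall u, C u.
Proof.
move=> C0 Cin CD u; have [s ->] := @cls_surj colim_premonoid u.
elim: s => [|[k a] s IHs]; first exact: C0.
rewrite -[_ :: s]/([:: existT _ k a] ++ s) (@clsD colim_premonoid [:: _] s).
by apply: CD; first exact: Cin.
Qed.

Section Universal.
Variables (Q : nmodType) (g : forall k, P k -> Q).
Hypothesis gc : colim_compat g.

Definition colim_map (u : colim) : Q := colim_eval g (repr u).

Lemma colim_map_cls s : colim_map (@cls colim_premonoid s) = colim_eval g s.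
Proof.
have : colim_eqv (repr (@cls colim_premonoid s)) s.
  by apply/(@clsP colim_premonoid); rewrite /cls reprK.
by move=> /(_ Q g gc).
Qed.

Lemma colim_map_in k (a : P k) : colim_map (colim_in a) = g a.
Proof. by rewrite colim_map_cls colim_inE. Qed.

Lemma colim_mapM : GRing.nmod_morphism colim_map.
Proof.
split=> [|u v].
  by rewrite -(cls0 colim_premonoid) colim_map_cls /colim_eval big_nil.
have [s ->] := @cls_surj colim_premonoid u.
have [t ->] := @cls_surj colim_premonoid v.
by rewrite -(@clsD colim_premonoid) !colim_map_cls colim_eval_cat.
Qed.

End Universal.

Lemma colim_hom_ext (Q : nmodType) (f h : colim -> Q) :
  GRing.nmod_morphism f -> GRing.nmod_morphism h ->
  (forall k (a : P k), f (colim_in a) = h (colim_in a)) -> forall u, f u = h u.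
Proof.
move=> [f0 fD] [h0 hD] fh; apply: colim_ind => [|//|u v uE vE].
  by rewrite f0 h0.
by rewrite fD hD uE vE.
Qed.

End MonoidColimit.

(** Induction over a finite list of generators is handier than explicit linear
    combinations, both to use and to establish. *)
Lemma finitely_generatedP (P : nmodType) :
  finitely_generated P <-> exists s : seq P,
    forall C : P -> Prop, C 0 -> (forall a, a \in s -> C a) ->
      (forall a b, C a -> C b -> C (a + b)) -> forall a, C a.
Proof.
split=> [[n [g gP]]|[s sP]].
  exists (codom g) => C C0 Cg CD a; have [c ->] := gP a.
  elim/big_ind: _ => // i _; elim: (c i) => [|m IHm]; first by rewrite mulr0n.
  by rewrite mulrS; apply: CD => //; apply: Cg; exact: codom_f.
exists (size s), (fun i => s`_i); apply: sP => [|a /(nthP 0)[i i_s <-]|a b [c ->] [d ->]].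
- by exists (fun _ => 0%N); rewrite big1.
- exists (fun j => (j == Ordinal i_s) : nat).
  rewrite (bigD1 (Ordinal i_s)) //= eqxx mulr1n big1 ?addr0 // => j /negbTE ->.
  by rewrite mulr0n.
- exists (fun i => (c i + d i)%N); rewrite -big_split /=.
  by apply: eq_bigr => i _; rewrite mulrnDr.
Qed.

Lemma colim_fg n (P : 'I_n -> nmodType) (R : forall i j, P i -> P j -> Prop) :
  (forall k, finitely_generated (P k)) -> finitely_generated (colim R).
Proof.
move=> fg; apply/finitely_generatedP.
pose s k := projT1 (cid ((finitely_generatedP (P k)).1 (fg k))).
have sP k : forall C : P k -> Prop, C 0 -> (forall a, a \in s k -> C a) ->
      (forall a b, C a -> C b -> C (a + b)) -> forall a, C a.
  by rewrite /s; case: cid.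
exists (flatten [seq [seq colim_in R a | a <- s k] | k <- enum 'I_n]).
move=> C C0 Cg CD; apply: colim_ind => // k a.
have [in0 inD] := colim_in_add R k.
apply: (sP k (fun a => C (colim_in R a))) => [|b bs|b c Cb Cc].
- by rewrite in0.
- apply: Cg; apply/flatten_mapP; exists k; first by rewrite mem_enum.
  exact: map_f.
- by rewrite inD; exact: CD.
Qed.

Section PreservesUnits.
(** The two-element monoid in which the element besides zero is absorbing. Since
    a sum is a unit exactly if all of its terms are, sending the units to zero and
    all other elements to the absorbing one is a homomorphism. *)
Inductive mark := Mark of bool.
Definition unmark m := let: Mark b := m in b.
HB.instance Definition _ := gen_eqMixin mark.
HB.instance Definition _ := gen_choiceMixin mark.
Let mark_add x y := Mark (unmark x || unmark y).
Let mark_addA : associative mark_add.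
Proof. by move=> [a] [b] [c]; rewrite /mark_add /= orbA. Qed.
Let mark_addC : commutative mark_add.
Proof. by move=> [a] [b]; rewrite /mark_add /= orbC. Qed.
Let mark_add0 : left_id (Mark false) mark_add.
Proof. by move=> [a]. Qed.
HB.instance Definition _ := GRing.isNmodule.Build mark mark_addA mark_addC mark_add0.

Definition nonunit (P : nmodType) (a : P) : mark := Mark `[< ~ unit a >].

Lemma nonunitM (P : nmodType) : GRing.nmod_morphism (@nonunit P).
Proof.
split=> [|a b].
  congr Mark; apply/asboolP => nu; exact: nu (unit0 P).
congr Mark; rewrite -asbool_or; apply: asbool_equiv_eq.
rewrite -not_andP; split; apply: contra_not => /unitD //.
Qed.

(** If the relations preserve and reflect units, then the maps that classify the
    non-units are compatible. They factor through the colimit, which therefore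
    has no new units. *)
Lemma colim_in_unit (K : Type) (P : K -> nmodType) (R : forall i j, P i -> P j -> Prop)
    k (a : P k) : (forall i j (b : P i) (c : P j), R i j b c -> unit b <-> unit c) ->
  unit (colim_in R a) -> unit a.
Proof.
move=> Ru u.
have cc : colim_compat R (fun k => @nonunit (P k)).
  split=> [i|i j b c /Ru bc]; first exact: nonunitM.
  by congr Mark; apply: asbool_equiv_eq; rewrite bc.
have := unit_hom (colim_mapM cc) u; rewrite colim_map_in // => -[[y] [/norP[/asboolP/contrapT]]].
by [].
Qed.

End PreservesUnits.

(** * Finite limits of locally monoidal spaces *)

(** A finite diagram is given by a family of objects indexed by ['I_n] and by
    the set [H] of its morphisms. The space of the limit is the limit of the
    spaces, and its stalks are the colimits of the stalks. *)
Section LmsLimit.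
Variables (n : nat) (A : 'I_n -> lms).
Variable H : forall i j, lms_hom (A i) (A j) -> Prop.

Record lim_pt := LimPt {
  lp :> forall k, A k;
  lpP : forall i j h, @H i j h -> lh_fun h (lp i) = lp j }.

Lemma lim_pt_eq (x y : lim_pt) : (forall k, x k = y k) -> x = y.
Proof.
case: x y => x xP [y yP] /= e.
have {}e : x = y by apply: functional_extensionality_dep.
by case: _ / e yP => yP; congr LimPt; exact: Prop_irrelevance.
Qed.

HB.instance Definition _ := gen_eqMixin lim_pt.
HB.instance Definition _ := gen_choiceMixin lim_pt.

Definition lim_open : set_system lim_pt :=
  [set O | forall x : lim_pt, O x -> exists U : forall k, opens (A k),
     (forall k, oset (U k) (x k)) /\
     forall y : lim_pt, (forall k, oset (U k) (y k)) -> O y].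

Let lim_openT : lim_open setT.
Proof. by move=> x _; exists (fun k => oT (A k)). Qed.

Let lim_openI : setI_closed lim_open.
Proof.
move=> O O' oO oO' x [/oO[U [Ux UO]] /oO'[U' [Ux' UO']]].
exists (fun k => oI (U k) (U' k)); split=> // y Uy.
by split; [apply: UO|apply: UO'] => k; case: (Uy k).
Qed.

Let lim_open_bigU (K : Type) (f : K -> set lim_pt) :
  (forall k, lim_open (f k)) -> lim_open (\bigcup_k f k).
Proof.
move=> of_ x [k _ /of_[U [Ux Uf]]]; exists U; split=> // y /Uf.
by exists k.
Qed.

HB.instance Definition _ := isOpenTopological.Build lim_pt
  lim_openT lim_openI lim_open_bigU.

Lemma lim_openE (O : set lim_pt) : open O = lim_open O.
Proof. by []. Qed.

Let stalk_at (x : lim_pt) k : nmodType := stalk (lms_sh (A k)) (x k).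

(** The stalk map of [h] is defined at [h (x i)], which is equal to [x j] only
    propositionally: both stalks are reached from one section [s]. *)
Let stalk_rel (x : lim_pt) i j (a : stalk_at x i) (b : stalk_at x j) :=
  exists h, @H i j h /\ exists (V : opens (A j)) (s : lms_sh (A j) V)
    (Vj : oset V (x j)) (Vi : oset V (lh_fun h (x i))),
    a = @stalk_map _ _ h (x i) (germ Vi s) /\ b = germ Vj s.

(** This is where locality of the morphisms in the diagram enters: it makes the
    projections from the limit local, by [colim_in_unit]. *)
Let stalk_rel_unit (x : lim_pt) i j (a : stalk_at x i) (b : stalk_at x j) :
  stalk_rel a b -> unit a <-> unit b.
Proof.
move=> [h [Hh [V [s [Vj [Vi [-> ->]]]]]]]; split.
  move=> /stalk_unit; rewrite -(cast_germ (esym (lpP x Hh)) Vj Vi).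
  exact: cast_stalk_unit.
move=> u; apply: unit_hom (stalk_map_add h (x i)) _.
by move: u; rewrite -(cast_germ (lpP x Hh) Vi Vj) => /cast_stalk_unit.
Qed.

Definition lim_stalk (x : lim_pt) : nmodType := colim (@stalk_rel x).

Let stalk_in (x : lim_pt) k (a : stalk_at x k) : lim_stalk x :=
  colim_in (@stalk_rel x) a.

(** Sections of the presheaf colimit of the inverse images of the sheaves. They
    are encoded by their germs; sections of the limit are the families of germs
    that are locally of this form, i.e. those of the associated sheaf. *)
Inductive lim_gen (W : opens lim_pt) : (forall x, oset W x -> lim_stalk x) -> Prop :=
| LimGen0 : lim_gen (fun x _ => 0)
| LimGenIn k (V : opens (A k)) (s : lms_sh (A k) V)
    (WV : forall x : lim_pt, oset W x -> oset V (x k)) :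
    lim_gen (fun x Wx => stalk_in (germ (WV x Wx) s))
| LimGenD g g' : lim_gen g -> lim_gen g' ->
    lim_gen (fun x Wx => g x Wx + g' x Wx).

Lemma lim_gen_res (W W' : opens lim_pt) (W'W : W' `<=` W)
    (g : forall x, oset W x -> lim_stalk x) :
  lim_gen g -> lim_gen (fun x (Wx : oset W' x) => g x (W'W x Wx)).
Proof.
elim=> [|k V s WV|g1 g2 _ IH1 _ IH2]; first exact: LimGen0.
  exact: (LimGenIn s (fun x Wx => WV x (W'W x Wx))).
exact: LimGenD.
Qed.

Lemma lim_gen_eq (W : opens lim_pt) (g g' : forall x, oset W x -> lim_stalk x) :
  lim_gen g -> (forall x Wx, g x Wx = g' x Wx) -> lim_gen g'.
Proof.
move=> gg e; suff <- : g = g' by [].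
by do 2!apply: functional_extensionality_dep => ?.
Qed.

Record lim_sec (U : opens lim_pt) := LimSec {
  lsec : forall x, oset U x -> lim_stalk x;
  lsecP : forall x, oset U x -> exists (W : opens lim_pt) (WU : W `<=` U),
    oset W x /\ lim_gen (fun y (Wy : oset W y) => lsec (WU y Wy)) }.

Lemma lim_sec_eq U (s s' : lim_sec U) :
  (forall x (Ux : oset U x), lsec s Ux = lsec s' Ux) -> s = s'.
Proof.
case: s s' => s sP [s' s'P] /= e.
have {}e : s = s' by do 2!apply: functional_extensionality_dep => ?; exact: e.
by case: _ / e s'P => s'P; congr LimSec; exact: Prop_irrelevance.
Qed.

Definition gen_sec U (g : forall x, oset U x -> lim_stalk x) (gg : lim_gen g) :
  lim_sec U.
Proof. by exists g => x Ux; exists U, (fun _ Uy => Uy); split. Defined.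

Definition lsec_zero U : lim_sec U := gen_sec (LimGen0 U).

Definition lsec_add U (s s' : lim_sec U) : lim_sec U.
Proof.
exists (fun x Ux => lsec s Ux + lsec s' Ux) => x Ux.
have [W [WU [Wx gW]]] := lsecP s Ux; have [W' [WU' [Wx' gW']]] := lsecP s' Ux.
exists (oI W W'), (subset_trans (@oIl _ _ _) WU); split=> //.
apply: lim_gen_eq (LimGenD (lim_gen_res (@oIl _ W W') gW) (lim_gen_res (@oIr _ W W') gW')) _.
by move=> y Wy /=; congr (_ + _); congr lsec; exact: Prop_irrelevance.
Defined.

Section LimSecMonoid.
Variable U : opens lim_pt.
HB.instance Definition _ := gen_eqMixin (lim_sec U).
HB.instance Definition _ := gen_choiceMixin (lim_sec U).

Let lsec_addA : associative (@lsec_add U).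
Proof. by move=> s t u; apply: lim_sec_eq => x Ux /=; rewrite addrA. Qed.
Let lsec_addC : commutative (@lsec_add U).
Proof. by move=> s t; apply: lim_sec_eq => x Ux /=; rewrite addrC. Qed.
Let lsec_add0 : left_id (lsec_zero U) (@lsec_add U).
Proof. by move=> s; apply: lim_sec_eq => x Ux /=; rewrite add0r. Qed.

HB.instance Definition _ :=
  GRing.isNmodule.Build (lim_sec U) lsec_addA lsec_addC lsec_add0.
End LimSecMonoid.

Definition lsec_res (U V : opens lim_pt) (VU : V `<=` U) (s : lim_sec U) : lim_sec V.
Proof.
exists (fun x Vx => lsec s (VU x Vx)) => x Vx.
have [W [WU [Wx gW]]] := lsecP s (VU x Vx).
exists (oI W V), (@oIr _ W V); split=> //.
apply: lim_gen_eq (lim_gen_res (@oIl _ W V) gW) _ => y Wy.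
by congr lsec; exact: Prop_irrelevance.
Defined.

Definition lim_presheaf : presheaf lim_pt.
Proof.
refine (@Presheaf lim_pt (fun U => lim_sec U) lsec_res _ _ _).
- by move=> U V VU; split=> [|s t]; exact: lim_sec_eq.
- move=> U UU s; apply: lim_sec_eq => x Ux /=.
  by congr lsec; exact: Prop_irrelevance.
- move=> U V W VU WV WU s; apply: lim_sec_eq => x Ux /=.
  by congr lsec; exact: Prop_irrelevance.
Defined.

Lemma lim_sheafP : is_sheaf lim_presheaf.
Proof.
move=> U I V VU cov s sV.
have pt x (Ux : oset U x) : {i | oset (V i) x}.
  by apply: cid; have [i _ Vix] := cov x Ux; exists i.
have sE i j x (Vix : oset (V i) x) (Vjx : oset (V j) x) :
    lsec (s i) Vix = lsec (s j) Vjx.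
  have /(congr1 (fun u => @lsec (oI (V i) (V j)) u x (conj Vix Vjx))) /= :=
    sV i j (oI (V i) (V j)) (@oIl _ _ _) (@oIr _ _ _).
  by rewrite (Prop_irrelevance (oIl _) Vix) (Prop_irrelevance (oIr _) Vjx).
pose t x (Ux : oset U x) := lsec (s (projT1 (pt x Ux))) (projT2 (pt x Ux)).
have tP x : oset U x -> exists (W : opens lim_pt) (WU : W `<=` U),
    oset W x /\ lim_gen (fun y (Wy : oset W y) => t y (WU y Wy)).
  move=> Ux; have [i Vix] := pt x Ux.
  have [W [WV [Wx gW]]] := lsecP (s i) Vix.
  exists W, (subset_trans WV (VU i)); split=> //.
  by apply: lim_gen_eq gW _ => y Wy; exact: sE.
exists (LimSec tP); split=> [i|t' t'E].
  by apply: lim_sec_eq => x Vix /=; exact: sE.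
apply: lim_sec_eq => x Ux /=; rewrite /t.
case: (pt x Ux) => i Vix /=; rewrite -(t'E i) /=.
by congr lsec; exact: Prop_irrelevance.
Qed.

Definition lim_lms : lms := Lms lim_sheafP.

Lemma lim_leg_continuous k : continuous (fun x : lim_pt => x k).
Proof.
apply/continuousP => O oO; rewrite lim_openE => x Ox.
exists (fun j => match pselect (k = j) with
  | left e => eq_rect k (fun j => opens (A j)) (Opens oO) j e
  | right _ => oT (A j) end); split=> [j|y /(_ k)] /=; case: pselect => //.
  by move=> e; case: _ / e.
by move=> e; rewrite (Prop_irrelevance e erefl).
Qed.

Definition lim_leg_map k : continuousType lim_pt (A k) :=
  mkcts (@lim_leg_continuous k).

Definition pre_lim_leg k : pre_lms_hom lim_lms (A k).
Proof.
refine (@PreLmsHom lim_lms (A k) (lim_leg_map k)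
  (fun V U UV s => @gen_sec U _ (@LimGenIn U k V s UV)) _ _).
  move=> V U UV.
  split=> [|s t]; apply: lim_sec_eq => x Ux /=.
    by rewrite germ0 /stalk_in (colim_in_add _ _).1.
  by rewrite germD /stalk_in (colim_in_add _ _).2.
move=> V V' U U' UV UV' V'V U'U s; apply: lim_sec_eq => x Ux /=; congr stalk_in.
by rewrite (germ_res V'V (UV x (U'U x Ux))).
Defined.

Lemma lim_leg_local k x : local (@stalk_map _ _ (pre_lim_leg k) x).
Proof.
move=> g; have [V [Vx [s ->]]] := germ_surj g.
apply: contra_not; have Vx' : oset (opre (lim_leg_map k) V) x := Vx.
rewrite (@stalk_mapE _ _ (pre_lim_leg k) x V _ Vx Vx' (@subpre _ _ _ _)).
move=> /(@unit_germ lim_lms)[W [WU [t [Wx e]]]].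
have {}e := congr1 (fun u : lim_sec W => lsec u Wx) e; rewrite /= in e.
apply: (colim_in_unit (@stalk_rel_unit x)).
by exists (lsec t Wx); rewrite -[RHS]e (germ_irr _ Vx).
Qed.

Definition lim_leg k : lms_hom lim_lms (A k) := LmsHom (@lim_leg_local k).

Lemma lim_leg_compat i j h : @H i j h -> lms_comp h (lim_leg i) = lim_leg j.
Proof.
move=> Hh; apply: lms_hom_ext => [x|x V s Vf Vg]; first exact: (lpP x Hh).
rewrite (@stalk_comp _ _ _ h (lim_leg i) x).
have Vf1 : oset (opre (lh_fun h) V) (lh_fun (lim_leg i) x) := Vf.
rewrite -(germ_pull s (@subpre _ _ _ _) Vf1).
have Vf2 : oset (opre (lh_fun (lim_leg i)) (opre (lh_fun h) V)) x := Vf.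
have Vg1 : oset (opre (lh_fun (lim_leg j)) V) x := Vg.
rewrite -(germ_pull _ (@subpre _ _ _ _) Vf2) -(germ_pull s (@subpre _ _ _ _) Vg1).
apply/germP; exists (oI (opre (lh_fun (lim_leg i)) (opre (lh_fun h) V)) (opre (lh_fun (lim_leg j)) V)).
exists (@oIl _ _ _), (@oIr _ _ _); split=> //.
apply: lim_sec_eq => y [Vy1 Vy2] /=; apply: colim_in_rel.
exists h; split=> //; exists V, s, Vy2, Vy1; split=> //; last exact: germ_irr.
by rewrite (germ_pull s _ _ Vy1).
Qed.

(** Statements on sections that are local and additive need to be checked only
    for sections pulled back from one of the [A k]. *)
Lemma lim_sec_ind (W : opens lim_lms) (C : lms_sh lim_lms W -> Prop) : C 0 ->
  (forall k (V : opens (A k)) (s : lms_sh (A k) V)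
     (WV : W `<=` lh_fun (lim_leg k) @^-1` V), C (lh_sh WV s)) ->
  (forall s t, C s -> C t -> C (s + t)) ->
  forall s : lim_sec W, lim_gen (@lsec W s) -> C s.
Proof.
move=> C0 Cin CD [s sP] /= gs; elim: gs sP => [|k V r WV|g g' gg IHg gg' IHg'] sP.
- by rewrite (_ : LimSec _ = 0) //; exact: lim_sec_eq.
- by rewrite (_ : LimSec _ = @lh_sh _ _ (lim_leg k) V W WV r) //; exact: lim_sec_eq.
- rewrite (_ : LimSec _ = gen_sec gg + gen_sec gg'); last exact: lim_sec_eq.
  by apply: CD; [exact: IHg|exact: IHg'].
Qed.

Lemma lim_sec_local (U : opens lim_lms) (s : lms_sh lim_lms U) x : oset U x ->
  exists (W : opens lim_lms) (WU : W `<=` U), oset W x /\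
    lim_gen (@lsec W (res WU s)).
Proof. by move=> Ux; have [W [WU [Wx gW]]] := lsecP s Ux; exists W, WU. Qed.

Lemma lim_hom_ext (Y : lms) (h h' : lms_hom Y lim_lms) :
  (forall k, lms_comp (lim_leg k) h = lms_comp (lim_leg k) h') -> h = h'.
Proof.
move=> e; apply: lms_hom_ext => [y|y U s Uf Ug].
  apply: lim_pt_eq => k.
  by rewrite -[LHS]/(lh_fun (lms_comp (lim_leg k) h) y) e.
have pt : lh_fun h y = lh_fun h' y.
  apply: lim_pt_eq => k.
  by rewrite -[LHS]/(lh_fun (lms_comp (lim_leg k) h) y) e.
have [W [WU [Wf gW]]] := lim_sec_local s Uf; have Wg := Wf; rewrite pt in Wg.
rewrite -(germ_res WU Uf Wf) -(germ_res WU Ug Wg).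
move: (res WU s) gW; apply: lim_sec_ind => [|k V r WV|u v IHu IHv].
- by rewrite !germ0 !(stalk_map_add _ _).1.
- rewrite (germ_pull r WV Wf (WV _ Wf)) (germ_pull r WV Wg (WV _ Wg)).
  rewrite -(@stalk_comp _ _ _ (lim_leg k) h y) -(@stalk_comp _ _ _ (lim_leg k) h' y).
  exact: hom_eq_stalk.
- by rewrite !germD !(stalk_map_add _ _).2 IHu IHv.
Qed.

Section Universal.
Variables (Y : lms) (f : forall k, lms_hom Y (A k)).
Hypothesis fH : forall i j h, @H i j h -> lms_comp h (f i) = f j.

Let ptP y i j h : @H i j h -> lh_fun h (lh_fun (f i) y) = lh_fun (f j) y.
Proof. by move=> Hh; rewrite -(fH Hh). Qed.

Let pt (y : Y) : lim_pt := @LimPt (fun k => lh_fun (f k) y) (@ptP y).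

Let pt_continuous : continuous pt.
Proof.
apply/continuousP => O; rewrite lim_openE => oO; rewrite openE => y /= Oy.
have [U [Uy UO]] := oO _ Oy.
have : \forall z \near y, forall k, oset (U k) (lh_fun (f k) z).
  apply: filter_forall => k; apply: (open_nbhs_nbhs (A := lh_fun (f k) @^-1` U k)).
  split; last exact: Uy.
  apply: (continuousP (lh_fun (f k))).1; [exact: cts_fun|exact: oset_open].
by apply: filterS => z Uz; exact: (UO (pt z) Uz).
Qed.

Let stalk_compat y :
  colim_compat (@stalk_rel (pt y)) (fun k => @stalk_map _ _ (f k) y).
Proof.
split=> [k|i j a b [h [Hh [V [s [Vj [Vi [-> ->]]]]]]]]; first exact: stalk_map_add.
rewrite -(@stalk_comp _ _ _ h (f i) y).
exact: (@hom_eq_stalk _ _ _ _ (fH Hh) y V s Vi Vj).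
Qed.

(** The stalk map of the pairing exists by the universal property of the
    colimit of stalks, once a germ of the limit is read off as an element of
    this colimit by [ev]. *)
Let eta y : lim_stalk (pt y) -> stalk (lms_sh Y) y :=
  colim_map (fun k => @stalk_map _ _ (f k) y).

Let ev (x : lim_pt) (g : stalk (lms_sh lim_lms) x) : lim_stalk x :=
  @lsec _ (ls_sec (repr g)) x (ls_in (repr g)).

Let ev_germ (x : lim_pt) (U : opens lim_lms) (Ux : oset U x) (s : lms_sh lim_lms U) :
  ev (germ Ux s) = @lsec U s x Ux.
Proof.
rewrite /ev; set r := repr _.
have /germP[W [WU [Wr [Wx sr]]]] : germ Ux s = germ (ls_in r) (ls_sec r).
  have -> : germ (ls_in r) (ls_sec r) = @cls (stalk_premonoid _ _) r by case: (r).
  by rewrite /cls /r reprK.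
have /= := congr1 (fun u => @lsec W u x Wx) sr.
by rewrite (Prop_irrelevance (WU x Wx) Ux) (Prop_irrelevance (Wr x Wx) (ls_in r)).
Qed.

Let phi y (g : stalk (lms_sh lim_lms) (mkcts pt_continuous y)) := eta (ev g).

Let phi_leg y k (a : stalk (lms_sh (A k)) (lh_fun (f k) y)) :
  phi (@stalk_map _ _ (lim_leg k) (pt y) a) = @stalk_map _ _ (f k) y a.
Proof.
have [V [Vy [s ->]]] := germ_surj a.
have Vy' : oset (opre (lh_fun (lim_leg k)) V) (pt y) := Vy.
rewrite -(germ_pull (f := lim_leg k) s (@subpre _ _ _ _) Vy') /phi ev_germ /=.
rewrite /stalk_in /eta colim_map_in; last exact: stalk_compat.
by congr stalk_map; exact: germ_irr.
Qed.

Let phiM y : GRing.nmod_morphism (@phi y).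
Proof.
have [e0 eD] := colim_mapM (stalk_compat y).
split=> [|u v].
  by rewrite -(germ0 _ (Logic.I : oset (oT lim_lms) _)) /phi ev_germ /=; exact: e0.
have [U [Uy [s ->]]] := germ_surj u; have [V [Vy [t ->]]] := germ_surj v.
have UVy : oset (oI U V) (pt y) by split.
rewrite -(germ_res (@oIl _ U V) Uy UVy) -(germ_res (@oIr _ U V) Vy UVy) -germD.
by rewrite /phi !ev_germ; exact: eD.
Qed.

(** The stalks of the limit are generated by the stalks of the [A k]. In
    particular the pairing is local, because a sum is a unit only if its terms
    are. *)
Lemma lim_stalk_ind (x : lim_lms) (C : stalk (lms_sh lim_lms) x -> Prop) : C 0 ->
  (forall k a, C (@stalk_map _ _ (lim_leg k) x a)) ->
  (forall u v, C u -> C v -> C (u + v)) -> forall u, C u.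
Proof.
move=> C0 Cin CD u; have [U [Ux [s ->]]] := germ_surj u.
have [W [WU [Wx gW]]] := lim_sec_local s Ux.
rewrite -(germ_res WU Ux Wx); move: (res WU s) gW.
apply: lim_sec_ind => [|k V r WV|v w Cv Cw]; first by rewrite germ0.
  by rewrite (germ_pull r WV Wx (WV _ Wx)); exact: Cin.
by rewrite germD; exact: CD.
Qed.

Let phi_local y : local (@phi y).
Proof.
move=> g; apply: contra_not; move: g; apply: lim_stalk_ind => [_|k a|u v IHu IHv].
- exact: unit0.
- rewrite phi_leg => /stalk_unit u.
  exact: unit_hom (stalk_map_add (lim_leg k) (pt y)) u.
- by rewrite (phiM y).2 => /unitD[/IHu uu /IHv uv]; apply/unitD.
Qed.

Let phi_coh (V : opens lim_lms) (S : lms_sh lim_lms V) y :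
  oset V (mkcts pt_continuous y) -> exists (W : opens Y) (t : lms_sh Y W), oset W y /\
    forall z (Wz : oset W z) (Vz : oset V (mkcts pt_continuous z)),
      phi (germ Vz S) = germ Wz t.
Proof.
move=> Vy; have [O [OV [Oy gO]]] := lim_sec_local S Vy.
suff [W [t [Wy WE]]] : exists (W : opens Y) (t : lms_sh Y W), oset W y /\
    forall z (Wz : oset W z) (Oz : oset O (pt z)),
      @phi z (@germ _ (lms_sh lim_lms) _ _ Oz (res OV S)) = germ Wz t.
  exists (oI W (opre (mkcts pt_continuous) O)), (res (@oIl _ _ _) t).
  split=> // z Wz Vz; have [Wz' Oz] := Wz.
  by rewrite (germ_res _ Wz') -(WE z Wz' Oz); congr phi; rewrite (germ_res OV Vz).
move: (res OV S) gO; apply: lim_sec_ind => [|k U r OU|u v].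
- exists (oT Y), 0; split=> // z Wz Oz; rewrite !germ0.
  exact: (phiM z).1.
- exists (opre (lh_fun (f k)) U), (lh_sh (@subpre _ _ (lh_fun (f k)) U) r).
  split=> [|z Wz Oz]; first exact: (OU _ Oy).
  rewrite (germ_pull (f := lim_leg k) r OU Oz (OU _ Oz)) phi_leg.
  exact: (esym (germ_pull r (@subpre _ _ (lh_fun (f k)) U) Wz (OU _ Oz))).
- move=> [W [t [Wy WE]]] [W' [t' [Wy' WE']]].
  exists (oI W W'), (res (@oIl _ _ _) t + res (@oIr _ _ _) t'); split=> // z Wz Oz.
  have [Wz1 Wz2] := Wz.
  rewrite !germD (phiM z).2 (WE z Wz1) (WE' z Wz2).
  by rewrite (germ_res _ Wz1) (germ_res _ Wz2).
Qed.

Definition lim_pair : lms_hom Y lim_lms := mk_hom phiM phi_local phi_coh.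

Lemma lim_pairE k : lms_comp (lim_leg k) lim_pair = f k.
Proof.
apply: lms_hom_ext => [//|y V s Vf Vg].
rewrite (@stalk_comp _ _ _ (lim_leg k) lim_pair y) mk_hom_stalk phi_leg.
by congr stalk_map; exact: germ_irr.
Qed.

End Universal.
End LmsLimit.

(** * Affine charts of fans *)
Lemma spec_eq (P : nmodType) (p q : spec P) :
  (forall a, prime_set p a <-> prime_set q a) -> p = q.
Proof.
case: p q => A Ai A0 AD [B Bi B0 BD] /= AB.
have e : A = B by apply/seteqP; split=> a /AB.
by case: _ / e Bi B0 BD {AB} => *; congr Spec; exact: Prop_irrelevance.
Qed.

(** Inverses are unique, so that those of the germs glue. *)
Lemma unit_section (X : lms) (U : opens X) (s : lms_sh X U) :
  (forall x (Ux : oset U x), unit (germ Ux s)) -> unit s.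
Proof.
move=> su.
have [|v vE] := @germ_glue X U (fun x Ux => projT1 (cid (su x Ux))).
  move=> x Ux; have [W [WU [t [Wx e]]]] := unit_germ (su x Ux).
  exists W, t; split=> // y Uy Wy; case: cid => g /= ge.
  apply: (unit_cancel (su y Uy)); rewrite addrC ge addrC.
  by rewrite -(germ_res WU Uy Wy) -germD e germ0.
exists v; apply: germ_ext => x Ux; rewrite germD vE germ0.
by case: cid.
Qed.

Section SpecMap.
Variables (P Q : nmodType) (phi : P -> Q).
Hypothesis phiM : GRing.nmod_morphism phi.

Lemma spec_map_subproof :
  GRing.nmod_morphism (fun a => ssec_const (oT (spec Q)) (phi a) : lms_sh (spec_lms Q) (oT _)).
Proof.
split=> [|a b]; first by rewrite phiM.1; exact: spec_section_eq.
by rewrite phiM.2 ssec_constD.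
Qed.

Definition spec_map : lms_hom (spec_lms Q) (spec_lms P) := spec_hom spec_map_subproof.

Lemma global_section_map (X : lms) (f : lms_hom X (spec_lms Q)) a :
  global_section (lms_comp spec_map f) a = global_section f (phi a).
Proof.
by rewrite global_section_comp (global_section_spec_hom spec_map_subproof).
Qed.

Lemma spec_mapP (q : spec Q) a :
  prime_set (lh_fun spec_map q) a <-> prime_set q (phi a).
Proof.
have u := @unit_germ_const Q q (phi a).
rewrite (@prime_global_section _ _ spec_map q).
rewrite (global_section_spec_hom spec_map_subproof).
split=> [nu|pa /u //].
by apply: contrapT => npa; apply: nu; apply/u.
Qed.

End SpecMap.

Section ClosedPoint.
Variable P : nmodType.

(** The ideal of non-units is the largest prime ideal. *)
Definition closed_pt : spec P.
Proof.
exists [set a | ~ unit a].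
- by move=> a b /= na /unitD[].
- by move=> /=; apply; exact: unit0.
- by move=> a b /contrapT ua /contrapT ub; apply; apply/unitD.
Defined.

(** A basic open set containing the closed point is defined by a unit. *)
Lemma closed_pt_open (O : set (spec P)) : open O -> O closed_pt -> O = setT.
Proof.
rewrite spec_openE => oO /oO[p [pc pO]]; apply/seteqP; split=> // q _; apply: pO.
have [r pr] := contrapT pc.
by move=> qp; apply: (@prime0 _ q); rewrite -pr; exact: prime_ideal.
Qed.

Lemma ssec_const_surj (s : lms_sh (spec_lms P) (oT _)) :
  exists a, s = ssec_const (oT _) a.
Proof.
have BT : basic_open 0 `<=` oT (spec P) by [].
have [a [n sE]] := basic_section_surj (ssec_res BT s).
exists a; apply: spec_section_eq => q Tq.
have q0 : oset (basic_open 0) q by exact: prime0.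
have := congr1 (fun u => ssec u q0) sE; rewrite /= (Prop_irrelevance (BT q q0) Tq).
move=> ->; apply/fracP; exists 0; split; first exact: (sm0 (prime_compl q)).
by rewrite mul0rn !addr0.
Qed.

End ClosedPoint.

Section Localize.
Variables (P : nmodType) (S : submonoid P).

Definition loc_in (a : P) : localization S := frac a (sm0 S).

Lemma loc_inM : GRing.nmod_morphism loc_in.
Proof.
split=> // a b; rewrite fracD; apply/fracP; exists 0.
by split; [exact: sm0|rewrite addr0].
Qed.

Lemma loc_inE a t (St : sm_set S t) : frac a St + loc_in t = loc_in a.
Proof.
rewrite fracD; apply/fracP; exists 0.
by split; [exact: sm0|rewrite !(addr0, add0r)].
Qed.

Lemma loc_in_unit t : sm_set S t -> unit (loc_in t).
Proof. by move=> St; exists (frac 0 St); rewrite addrC loc_inE loc_inM.1. Qed.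

Lemma loc_hom_ext (Q : nmodType) (f g : localization S -> Q) :
  GRing.nmod_morphism f -> GRing.nmod_morphism g ->
  (forall a, f (loc_in a) = g (loc_in a)) -> forall u, f u = g u.
Proof.
move=> fM gM fg u; have [a [t [St ->]]] := frac_surj u.
apply: (unit_cancel (unit_hom gM (loc_in_unit St))).
by rewrite -gM.2 -fg -fM.2 loc_inE.
Qed.

(** The value [v] at a fraction [a - t] is characterized by [v + phi t = phi a]
    for all its presentations at once; it is unique since [phi t] is a unit. *)
Lemma loc_lift (Q : nmodType) (phi : P -> Q) : GRing.nmod_morphism phi ->
  (forall t, sm_set S t -> unit (phi t)) ->
  exists psi : localization S -> Q, GRing.nmod_morphism psi /\
    forall a, psi (loc_in a) = phi a.
Proof.
move=> phiM phiu.
have ex (u : localization S) : exists v, forall a t (St : sm_set S t),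
    u = frac a St -> v + phi t = phi a.
  have [a [t [St ->]]] := frac_surj u; have [w tw] := phiu t St.
  exists (phi a + w) => b r Sr /fracP[c [Sc e]].
  apply: (unit_cancel (phiu c Sc)); apply: (unit_cancel (phiu t St)).
  have {e} := congr1 phi e; rewrite !phiM.2 => e.
  transitivity (phi c + (phi a + phi r) + (phi t + w)).
    by rewrite !addrA [LHS](ACl (4*1*3*5*2)%AC).
  by rewrite e tw addr0 addrA [phi c + _]addrC.
pose psi u := projT1 (cid (ex u)).
have psiE a t (St : sm_set S t) : psi (frac a St) + phi t = phi a.
  by rewrite /psi; case: cid => v /= /(_ a t St erefl).
exists psi; split; last first.
  by move=> a; have := psiE a 0 (sm0 S); rewrite phiM.1 addr0.
split=> [|u v].
  by have := psiE 0 0 (sm0 S); rewrite phiM.1 addr0.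
have [a [t [St ->]]] := frac_surj u; have [b [r [Sr ->]]] := frac_surj v.
apply: (unit_cancel (phiu _ (smD St Sr))).
by rewrite fracD psiE !phiM.2 addrACA !psiE.
Qed.

End Localize.

Lemma oe_cancel (A B C : lms) (g : lms_hom B C) (f : lms_hom A B) :
  open_immersion g -> open_immersion (lms_comp g f) -> open_immersion f.
Proof.
move=> G GF; split.
- by move=> x y xy; apply: (oe_inj GF); rewrite /= xy.
- move=> O /(oe_open GF) oO.
  rewrite (_ : _ @` O = lh_fun g @^-1` (lh_fun (lms_comp g f) @` O)).
    by apply: (continuousP (lh_fun g)).1 => //; exact: cts_fun.
  apply/seteqP; split=> [_ [x Ox <-]|y [x Ox /(oe_inj G) <-]]; by exists x.
- move=> a u v.
  have [u' <-] := oe_stalk_surj G u; have [v' <-] := oe_stalk_surj G v.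
  rewrite -!(@stalk_comp _ _ _ g f a).
  by move=> /(oe_stalk_inj GF) ->.
- move=> a u; have [v <-] := oe_stalk_surj GF u.
  by exists (@stalk_map _ _ g (lh_fun f a) v); rewrite (@stalk_comp _ _ _ g f a).
Qed.

Lemma lcompA (X Y Z T : lms) (h : lms_hom Z T) (g : lms_hom Y Z) (f : lms_hom X Y) :
  lms_comp h (lms_comp g f) = lms_comp (lms_comp h g) f.
Proof. exact: (@compmA LMS). Qed.

Lemma lcomp1 (X Y : lms) (f : lms_hom X Y) : lms_comp f (lms_id X) = f.
Proof. exact: (@compm1 LMS). Qed.

Lemma l1comp (X Y : lms) (f : lms_hom X Y) : lms_comp (lms_id Y) f = f.
Proof. exact: (@comp1m LMS). Qed.

(** An open immersion is isomorphic to the inclusion of the open subspace that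
    is its image, as both factor through each other by [oe_factor]. *)
Lemma oe_restr_iso (A X : lms) (j : lms_hom A X) (J : open_immersion j) :
  exists f : @hom LMS (restr_lms (oe_img J (oT A))) A, is_iso f.
Proof.
have [f fE] : exists f, lms_comp j f = restr_incl (oe_img J (oT A)).
  by apply: (oe_factor J) => y; have [a _ ay] := restr_incl_in y; exists a.
have [g gE] : exists g, lms_comp (restr_incl (oe_img J (oT A))) g = j.
  by apply: restr_factor => a; exists a.
have gf : lms_comp g f = lms_id _.
  by apply: (oe_mono (restr_oe (oe_img J (oT A)))); rewrite lcompA gE fE lcomp1.
have fg : lms_comp f g = lms_id _.
  by apply: (oe_mono J); rewrite lcompA fE gE lcomp1.
by exists f, g.
Qed.

(** In an affine scheme a point rarely has a smallest neighbourhood, but if [P]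
    is finitely generated then each point [q] of [Spec P] has one: the spectrum
    of the localization at [q], whose closed point is [q]. *)
Section LocalChart.
Variables (P : nmodType) (q : spec P).
Hypothesis fgP : finitely_generated P.
Local Notation S := (prime_compl q).
Local Notation L := (localization S).

(** The sum [p] of those generators that are not in [q]: every element outside
    [q] is a summand of a multiple of [p], so that inverting [p] inverts all of
    them. *)
Let dense_elt : exists p : P, ~ prime_set q p /\
  forall a, ~ prime_set q a -> exists r m, a + r = p *+ m.
Proof.
have [s sP] := (finitely_generatedP P).1 fgP.
pose p := \sum_(a <- s | ~~ `[< prime_set q a >]) a.
exists p; split.
  rewrite /p; elim/big_ind: _ => [|a b|a]; first exact: prime0.
    exact: primeD.
  by move=> /asboolPn.
apply: (sP (fun a => ~ prime_set q a -> _)) => [_|a a_s qa|a b IHa IHb qab].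
- by exists 0, 0%N; rewrite addr0.
- exists (\sum_(b <- rem a s | ~~ `[< prime_set q b >]) b), 1%N.
  by rewrite mulr1n /p [RHS](big_rem a) //= asboolF.
- have [r [m e]] := IHa (fun qa => qab (prime_ideal b qa)).
  have [|r' [m' e']] := IHb; first by move=> qb; apply: qab; rewrite addrC; exact: prime_ideal.
  by exists (r + r'), (m + m')%N; rewrite addrACA e e' mulrnDr.
Qed.

(** The generators of [P] and the inverse of [p] generate the localization. *)
Lemma loc_fg : finitely_generated L.
Proof.
have [p [qp pP]] := dense_elt; have [s sP] := (finitely_generatedP P).1 fgP.
apply/finitely_generatedP; exists (@frac P S 0 p qp :: [seq loc_in S a | a <- s]).
move=> C C0 Cg CD.
have Cin a : C (loc_in S a).
  apply: (sP (fun a => C (loc_in S a))) => [//|b bs|b c Cb Cc].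
    by apply: Cg; rewrite in_cons; apply/orP; right; exact: map_f.
  by rewrite (loc_inM S).2; exact: CD.
have Cn (u : L) m : C u -> C (u *+ m).
  by move=> Cu; elim: m => [|m IHm]; rewrite ?mulr0n // mulrS; exact: CD.
move=> u; have [a [t [St ->]]] := frac_surj u; have [r [m e]] := pP t St.
suff -> : frac a St = loc_in S a + (loc_in S r + @frac P S 0 p qp *+ m).
  apply: (CD) => //; apply: CD => //; apply: Cn; apply: Cg.
  by rewrite in_cons eqxx.
apply: (unit_cancel (loc_in_unit St)); rewrite loc_inE -!addrA.
have -> : loc_in S r + (@frac P S 0 p qp *+ m + loc_in S t) = 0.
  rewrite addrCA -(loc_inM S).2 addrC [r + t]addrC e.
  elim: m {e} => [|m IHm]; first by rewrite !mulr0n (loc_inM S).1 addr0.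
  rewrite !mulrS (loc_inM S).2 addrACA IHm addr0 addrC.
  by rewrite (loc_inE 0 (t := p)) (loc_inM S).1.
by rewrite addr0.
Qed.

(** The localization at [q] is also the localization at [p]; its spectrum is the
    basic open set [U] of [p]. Both spectra are compared by their universal
    properties: [sig] and [mu] are mutually inverse over [Spec P]. *)
Lemma loc_chart : exists j : lms_hom (spec_lms L) (spec_lms P),
  open_immersion j /\ lh_fun j (closed_pt L) = q.
Proof.
have [p [qp pP]] := dense_elt.
pose lam := spec_map (loc_inM S).
have lam_mono (X : lms) (f g : lms_hom X (spec_lms L)) :
    lms_comp lam f = lms_comp lam g -> f = g.
  move=> e; apply: global_section_inj.
  apply: loc_hom_ext; [exact: global_section_add|exact: global_section_add|] => a.
  by rewrite -!(global_section_map (loc_inM S)) e.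
pose U := basic_open p; pose i := restr_incl (X := spec_lms P) U.
have [psi [psiM psiE]] : exists psi : L -> lms_sh (restr_lms (X := spec_lms P) U) (oT _),
    GRing.nmod_morphism psi /\ forall a, psi (loc_in S a) = global_section i a.
  apply: loc_lift; first exact: global_section_add.
  have iM := global_section_add i.
  have up : unit (global_section i p).
    apply: unit_section => x []; apply: contrapT.
    by move/prime_global_section; exact: (restr_incl_in x).
  move=> t /pP[r [m e]].
  suff /unitD[] : unit (global_section i t + global_section i r) by [].
  rewrite -iM.2 e; elim: m {e} => [|m IHm]; first by rewrite mulr0n iM.1; exact: unit0.
  by rewrite mulrS iM.2; apply/unitD.
(* [sig] exists since all elements outside [q] are invertible on [U], and [mu]
   since the image of [lam] avoids the primes containing [p]. *)
pose sig := spec_hom psiM.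
have lamsig : lms_comp lam sig = i.
  apply: global_section_inj => a.
  by rewrite (global_section_map (loc_inM S)) (global_section_spec_hom psiM).
have [mu muE] : exists mu, lms_comp i mu = lam.
  apply: restr_factor => r; rewrite /= => /(spec_mapP (loc_inM S)).
  apply: contraPnot (loc_in_unit (S := S) qp) => pr.
  by move=> [v e]; apply: (@prime0 _ r); rewrite -e; exact: prime_ideal.
exists lam; split.
  rewrite -muE; apply: oe_comp; first exact: restr_oe.
  apply: (@oe_iso _ _ mu sig).
    by apply: lam_mono; rewrite lcompA lamsig muE lcomp1.
  by apply: (oe_mono (restr_oe (X := spec_lms P) U)); rewrite lcompA muE lamsig lcomp1.
apply: spec_eq => a; rewrite (spec_mapP (loc_inM S)) /=; split=> [nu|qa [v]].
  by apply: contrapT => qa; apply: nu; exact: loc_in_unit.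
have [b [t [St ->]]] := frac_surj v; rewrite fracD => /fracP[u [Su]].
rewrite addr0 !add0r => e; apply: (primeD Su St).
by rewrite -e addrCA; exact: prime_ideal.
Qed.

End LocalChart.

Lemma fan_chart (X : lms) (x : X) : locally_finite_type_fan X ->
  exists (P : nmodType) (j : lms_hom (spec_lms P) X),
    [/\ finitely_generated P, open_immersion j & lh_fun j (closed_pt P) = x].
Proof.
move=> /(_ x)[U [Ux [P [fgP [f [g [gf fg]]]]]]].
pose x' : restr_lms U := SigSub (mem_set Ux).
have [j [J jc]] := @loc_chart P (lh_fun f x') fgP.
exists (localization (prime_compl (lh_fun f x'))), (lms_comp (restr_incl U) (lms_comp g j)).
split; first exact: loc_fg.
  by apply: (oe_comp (restr_oe U)); apply: oe_comp J; exact: oe_iso fg gf.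
rewrite /= jc -[lh_fun g _]/(lh_fun (lms_comp g f) x').
by rewrite -[lms_comp g f]/(@compm LMS _ _ _ g f) gf.
Qed.

(** A chart is the smallest open neighbourhood of the image of its closed point.
    This rigidity makes finite limits of fans much simpler than those of
    schemes. *)
Lemma chart_min (X : lms) (P : nmodType) (j : lms_hom (spec_lms P) X) (O : opens X) :
  oset O (lh_fun j (closed_pt P)) -> forall q, oset O (lh_fun j q).
Proof.
move=> Oc q; have := @closed_pt_open P _ (oset_open (opre (lh_fun j) O)) Oc.
by move=> /seteqP[_ /(_ q Logic.I)].
Qed.

Lemma fan_of_cover (X : lms) :
  (forall x : X, exists (P : nmodType) (j : lms_hom (spec_lms P) X) q,
    [/\ finitely_generated P, open_immersion j & lh_fun j q = x]) ->
  locally_finite_type_fan X.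
Proof.
move=> cov x; have [P [j [q [fgP J qx]]]] := cov x.
exists (oe_img J (oT _)); split; first by exists q.
by exists P; split=> //; exact: oe_restr_iso.
Qed.

Lemma restr_fan (X : lms) (U : opens X) :
  locally_finite_type_fan X -> locally_finite_type_fan (restr_lms U).
Proof.
move=> fX; apply: fan_of_cover => x.
have [P [j [fgP J jx]]] := fan_chart (set_val x) fX.
have [k kE] : exists k, lms_comp (restr_incl U) k = j.
  by apply: restr_factor; apply: chart_min; rewrite jx; exact: set_valP.
exists P, k, (closed_pt P); split=> //.
  by apply: (oe_cancel (restr_oe U)); rewrite kE.
apply: (oe_inj (restr_oe U)).
by rewrite -[LHS]/(lh_fun (lms_comp (restr_incl U) k) _) kE; exact: jx.
Qed.

Lemma fan_of_fans (I : Type) (A : I -> lms) (X : lms) (q : forall i, lms_hom (A i) X) :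
  (forall i, locally_finite_type_fan (A i)) -> (forall i, open_immersion (q i)) ->
  (forall x, exists i a, lh_fun (q i) a = x) -> locally_finite_type_fan X.
Proof.
move=> fA Q cov; apply: fan_of_cover => x; have [i [a <-]] := cov x.
have [P [j [fgP J <-]]] := fan_chart a (fA i).
exists P, (lms_comp (q i) j), (closed_pt P); split=> //.
exact: oe_comp.
Qed.

Section LimitOfFans.
Variables (n : nat) (A : 'I_n -> lms).
Variable H : forall i j, lms_hom (A i) (A j) -> Prop.
Hypothesis fA : forall k, locally_finite_type_fan (A k).
Local Notation X := (lim_lms H).

(** Around a point [x] of the limit, take the charts [j k] centred at the
    coordinates of [x]. As they are the smallest neighbourhoods, every morphism
    of the diagram maps chart into chart. So the limit is, near [x], a limit of
    affine fans [Spec (P k)], that is, the spectrum of the colimit [C] of the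
    monoids [P k]. *)
Lemma lim_fan : locally_finite_type_fan X.
Proof.
apply: fan_of_cover => x.
pose P k := projT1 (cid (fan_chart (lh_fun (lim_leg H k) x) (@fA k))).
have jex k : exists j : lms_hom (spec_lms (P k)) (A k),
    [/\ finitely_generated (P k), open_immersion j & lh_fun j (closed_pt (P k)) = lh_fun (lim_leg H k) x].
  by rewrite /P; case: cid.
pose j k := projT1 (cid (jex k)).
have fgP k : finitely_generated (P k) by rewrite /j; case: (jex k) => ? [].
have J k : open_immersion (j k) by rewrite /j; case: cid => ? [].
have jx k : lh_fun (j k) (closed_pt (P k)) = lh_fun (lim_leg H k) x.
  by rewrite /j; case: cid => ? [].
have tau i k (h : lms_hom (A i) (A k)) : H h ->
    exists t : lms_hom (spec_lms (P i)) (spec_lms (P k)), lms_comp (j k) t = lms_comp h (j i).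
  move=> Hh; apply: (oe_factor (J k)) => y.
  pose O : opens (A i) := opre (lh_fun h) (oe_img (J k) (oT _)).
  suff /(chart_min (O := O))/(_ y)[b _ e] : oset O (lh_fun (j i) (closed_pt (P i))).
    by exists b.
  rewrite jx; exists (closed_pt (P k)) => //; rewrite jx.
  by rewrite -[RHS]/(lh_fun (lms_comp h (lim_leg H i)) x) (lim_leg_compat Hh).
pose R k i (a : P k) (b : P i) := exists h : lms_hom (A i) (A k), H h /\
  exists t : lms_hom (spec_lms (P i)) (spec_lms (P k)),
    lms_comp (j k) t = lms_comp h (j i) /\
    global_section t a = ssec_const (oT _) b.
pose C := colim R.
pose Z k := spec_map (colim_in_add R k).
have Z_ext (Y : lms) (f g : lms_hom Y (spec_lms C)) :
    (forall k, lms_comp (Z k) f = lms_comp (Z k) g) -> f = g.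
  move=> fg; apply: global_section_inj.
  apply: colim_hom_ext; [exact: global_section_add|exact: global_section_add|].
  by move=> k a; rewrite -!(global_section_map (colim_in_add R k)) fg.
have ZH i k h : @H i k h -> lms_comp h (lms_comp (j i) (Z i)) = lms_comp (j k) (Z k).
  move=> Hh; have [t tE] := tau _ _ _ Hh.
  rewrite lcompA -tE -lcompA; congr lms_comp; apply: global_section_inj => a.
  have [b ab] := ssec_const_surj (global_section t a).
  rewrite global_section_comp ab (global_section_spec_hom (spec_map_subproof (colim_in_add R k))).
  rewrite -[lh_sh _ _]/(global_section (Z i) b).
  rewrite (global_section_spec_hom (spec_map_subproof (colim_in_add R i))).
  congr ssec_const; apply/esym/colim_in_rel; exists h; split=> //; exists t; split=> //.
(* [theta] is the candidate chart; it is an isomorphism onto the open subset [W]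
   of points whose coordinates all lie in the charts, with inverse [sig]. *)
pose theta := lim_pair ZH.
have thE k : lms_comp (lim_leg H k) theta = lms_comp (j k) (Z k) by exact: lim_pairE.
have Wo : open [set y : lim_pt H | forall k, oset (oe_img (J k) (oT _)) (y k)].
  by rewrite lim_openE => y Wy; exists (fun k => oe_img (J k) (oT _)).
pose W : opens X := Opens Wo; pose i := restr_incl W.
have wex k : exists w, lms_comp (j k) w = lms_comp (lim_leg H k) i.
  apply: (oe_factor (J k)) => y.
  by have /(_ k)[b _ e] := restr_incl_in y; exists b.
pose w k := projT1 (cid (wex k)).
have wE k : lms_comp (j k) (w k) = lms_comp (lim_leg H k) i by rewrite /w; case: cid.
have wc : colim_compat R (fun k => global_section (w k)).
  split=> [k|k l a b [h [Hh [t [tE tab]]]]]; first exact: global_section_add.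
  have -> : w k = lms_comp t (w l).
    apply: (oe_mono (J k)); rewrite lcompA tE -lcompA !wE lcompA.
    by rewrite (lim_leg_compat Hh).
  by rewrite global_section_comp tab.
pose sig := spec_hom (colim_mapM wc).
have Zsig k : lms_comp (Z k) sig = w k.
  apply: global_section_inj => a.
  rewrite (global_section_map (colim_in_add R k)).
  by rewrite (global_section_spec_hom (colim_mapM wc)) (colim_map_in wc).
have [mu muE] : exists mu, lms_comp i mu = theta.
  by apply: restr_factor => q k; exists (lh_fun (Z k) q).
have musig : lms_comp mu sig = lms_id _.
  apply: (oe_mono (restr_oe W)); rewrite lcompA muE lcomp1.
  apply: lim_hom_ext => k.
  by rewrite lcompA thE -lcompA Zsig wE.
have sigmu : lms_comp sig mu = lms_id _.
  apply: Z_ext => k; rewrite lcompA Zsig lcomp1.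
  by apply: (oe_mono (J k)); rewrite lcompA wE -lcompA muE thE.
have Wx : oset W x by move=> k; exists (closed_pt (P k)).
exists C, theta, (lh_fun sig (SigSub (mem_set Wx))); split.
- exact: colim_fg.
- by rewrite -muE; apply: (oe_comp (restr_oe W)); exact: oe_iso sigmu musig.
- rewrite -muE -[LHS]/(lh_fun i (lh_fun (lms_comp mu sig) (SigSub (mem_set Wx)))).
  by rewrite musig.
Qed.
End LimitOfFans.

(** * Fans form a category of spaces: limits and gluing *)
Section TopGlue.
Variables (I : Type) (A : I -> topologicalType) (X B : topologicalType).
Variables (q : forall i, continuousType (A i) X) (g : forall i, continuousType (A i) B).
Hypothesis q_open : forall i (O : set (A i)), open O -> open (q i @` O).
Hypothesis cov : forall x, exists i a, q i a = x.
Hypothesis compat : forall i k a b, q i a = q k b -> g i a = g k b.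

Lemma top_glue : exists! h : @hom Top X B,
  forall i, @compm Top _ _ _ h (q i : @hom Top (A i) X) = g i.
Proof.
have /choice[p pP] (x : X) : exists y : B, forall i a, q i a = x -> g i a = y.
  have [i [a ax]] := cov x; exists (g i a) => k b bx.
  by apply: compat; rewrite ax.
have pc : continuous p.
  apply/continuousP => O oO.
  rewrite (_ : _ @^-1` _ = \bigcup_(i in [set: I]) (q i @` (g i @^-1` O))).
    apply: bigcup_open => i _; apply: q_open.
    by apply: (continuousP (g i)).1 => //; exact: cts_fun.
  apply/seteqP; split=> [x Ox|_ [i _ [a Oa <-]]] /=; last by rewrite -(pP _ i a).
  by have [i [a ax]] := cov x; exists i => //; exists a; rewrite //= (pP x).
exists (mkcts pc : continuousType X B); split=> [i|h hE]; apply/continuousEP => x /=.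
  by apply/esym/pP.
have [i [a <-]] := cov x; transitivity (g i a); first by apply/esym/pP.
by rewrite -hE.
Qed.

End TopGlue.

Lemma fan_atlas (X : fan) : exists (P : X -> nmodType)
    (j : forall x, lms_hom (spec_lms (P x)) X), forall x,
  [/\ finitely_generated (P x), open_immersion (j x) & lh_fun (j x) (closed_pt (P x)) = x].
Proof.
pose ch (x : X) := cid (fan_chart x (@fanP X)).
exists (fun x => projT1 (ch x)), (fun x => projT1 (cid (projT2 (ch x)))) => x.
exact: (projT2 (cid (projT2 (ch x)))).
Qed.

Section FanOpenEmbeddings.
Local Notation E := FansSpecN.

Definition fan_restr (X : fan) (O : opens X) : fan :=
  Fan (restr_fan (U := O) (@fanP X)).

Definition fan_incl (X : fan) (O : opens X) : @hom E (fan_restr O) X := restr_incl O.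

Lemma oe_embedding (X U : E) (j : hom U X) (J : open_immersion j) :
  @open_embedding_onto E X (oe_img J (oT _)) U j.
Proof.
split; first exact: oset_open.
split=> [Y g _ [y _ <-]|Y f fO]; first by exists (lh_fun (g : lms_hom _ _) y).
have [h hE] : exists h : lms_hom Y U, lms_comp j h = f.
  apply: (oe_factor J) => y.
  have /fO[a _ ay] : range (lh_fun (f : lms_hom _ _)) (lh_fun (f : lms_hom _ _) y).
    by exists y.
  by exists a.
exists h; split=> // h' h'E; apply: (oe_mono J).
by rewrite hE -h'E.
Qed.

(** The open subspace [R] has the same universal property as [j] among fans, and
    therefore [j] is isomorphic to its inclusion. *)
Lemma embedding_oe (X U : E) (j : hom U X) (O : set X) :
  @open_embedding_onto E X O U j ->
  open_immersion j /\ range (lh_fun (j : lms_hom _ _)) = O.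
Proof.
move=> [oO [jO jU]]; pose R : E := fan_restr (Opens oO : opens X).
have [g [gE _]] : exists! g : hom R U, j ∘ g = fan_incl _.
  by apply: jU => _ [y _ <-]; exact: (restr_incl_in y).
have jr : range (lh_fun (j : lms_hom _ _)) `<=` O.
  by have := jO U (idm U); rewrite compm1.
have [h hE] : exists h : lms_hom U R, lms_comp (restr_incl (Opens oO : opens X)) h = j.
  by apply: restr_factor => y; apply: jr; exists y.
have hg : lms_comp h g = lms_id _.
  by apply: (oe_mono (restr_oe (Opens oO : opens X))); rewrite lcompA hE lcomp1.
have gh : lms_comp g h = lms_id _.
  have [k [_ kU]] := jU U j jr.
  rewrite -(kU (lms_comp g h)); first by apply: kU; exact: lcomp1.
  by rewrite /= lcompA; move: gE => /= ->.
split; first by rewrite -hE; apply: (oe_comp (restr_oe _)); exact: oe_iso gh hg.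
apply/seteqP; split=> // x Ox.
exists (lh_fun (g : lms_hom _ _) (SigSub (mem_set Ox))) => //.
exact: (congr1 (fun f : lms_hom R X => lh_fun f (SigSub (mem_set Ox))) gE).
Qed.

Lemma open_embeddingP (X U : E) (j : hom U X) :
  @open_embedding E U X j <-> open_immersion j.
Proof.
split=> [[O /embedding_oe[]]//|J].
by exists (oe_img J (oT _)); exact: oe_embedding.
Qed.

End FanOpenEmbeddings.

Section FansLimits.
Variables (J : category) (D : functor J FansSpecN).
Hypothesis finJ : finite_category J.

(** The universal property with respect to all locally monoidal spaces as test
    objects. It is needed in this strength because the locally monoidal space
    underlying an object of another category of spaces is seldom a fan. *)
Definition lms_limit (c : cone D) := forall (Y : lms) (f : forall j, lms_hom Y (D j)),
  (forall i j (u : hom i j), lms_comp (fmap D u : lms_hom _ _) (f i) = f j) ->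
  exists! h : lms_hom Y (apex c), forall j, lms_comp (leg c j : lms_hom _ _) h = f j.

Lemma fans_lms_limit : exists c : cone D, lms_limit c.
Proof.
have [[n [e e_surj]] _] := finJ.
pose A (k : 'I_n) : lms := D (e k).
pose H (i k : 'I_n) (h : lms_hom (A i) (A k)) := exists u : hom (e i) (e k), h = fmap D u.
have fA k : locally_finite_type_fan (A k) := @fanP (D (e k)).
pose X : FansSpecN := Fan (@lim_fan n A H fA).
have leg_ex (j : J) : exists l : hom X (D j), forall k (u : hom (e k) j),
    fmap D u ∘ (lim_leg H k : hom X (D (e k))) = l.
  have [k <-] := e_surj j; exists (lim_leg H k) => i u.
  by apply: (@lim_leg_compat _ _ H i k); exists u.
pose l j := projT1 (cid (leg_ex j)).
have lE j k (u : hom (e k) j) : fmap D u ∘ (lim_leg H k : hom X (D (e k))) = l j.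
  by rewrite /l; case: cid.
have lk k : l (e k) = lim_leg H k by rewrite -(lE _ k (idm _)) fmap1 comp1m.
have l_nat i j (u : hom i j) : fmap D u ∘ l i = l j.
  have [k ki] := e_surj i; case: _ / ki u => u.
  by rewrite lk lE.
exists (Cone l_nat) => Y f fnat.
have fH i k h : @H i k h -> lms_comp h (f (e i)) = f (e k).
  by move=> [u ->]; exact: fnat.
exists (lim_pair fH); split=> [j|h' h'E] /=.
  have [k <-] := e_surj j; rewrite lk; exact: lim_pairE.
apply: lim_hom_ext => k; rewrite lim_pairE -h'E /= lk.
by [].
Qed.

Lemma lms_limit_is_limit (c : cone D) : lms_limit c -> is_limit c.
Proof. by move=> lim c'; apply: (lim (apex c') (leg c')) => i j u; exact: (@leg_nat _ _ _ c' i j u). Qed.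

(** One limit with the stronger property exists, and limits are unique up to
    isomorphism. *)
Lemma is_limit_lms_limit (c : cone D) : is_limit c -> lms_limit c.
Proof.
move=> lim; have [d dlim] := fans_lms_limit.
have [a [aE _]] := lms_limit_is_limit dlim c.
have [b [bE _]] := lim d.
have ba : lms_comp b a = lms_id _.
  have [k [_ kU]] := lim c.
  rewrite -(kU (lms_comp b a)) => [|j]; first by apply: kU => j; exact: lcomp1.
  by apply: etrans (@lcompA _ _ _ _ (leg c j) b a) _; rewrite [X in lms_comp X a]bE; exact: aE.
move=> Y f fnat; have [h [hE hU]] := dlim Y f fnat.
exists (lms_comp b h); split=> [j|h' h'E].
  by rewrite lcompA [X in lms_comp X h]bE; exact: hE.
rewrite (hU (lms_comp a h')) ?lcompA ?ba ?l1comp // => j.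
by rewrite lcompA [X in lms_comp X h']aE; exact: h'E.
Qed.

End FansLimits.

Lemma fans_finite_limits : finite_limits_axiom FansSpecN.
Proof.
move=> J D finJ; have [c clim] := fans_lms_limit D finJ.
by exists c; exact: lms_limit_is_limit.
Qed.

Section ForestFan.
Variables (I : smallType) (R : I -> I -> Prop).
Hypothesis Rxx : forall i, R i i.
Hypothesis Rtr : forall i j k, R i j -> R j k -> R i k.
Hypothesis Rforest : forall i j k, R i k -> R j k -> R i j \/ R j i.
Variables (A : I -> fan) (t : forall i j, R i j -> lms_hom (A i) (A j)).
Hypothesis t_id : forall i (r : R i i), t r = lms_id (A i).
Hypothesis t_comp : forall i j k (r : R i j) (r' : R j k) (r'' : R i k),
  lms_comp (t r') (t r) = t r''.
Hypothesis t_oe : forall i j (r : R i j), open_immersion (t r).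

(** All gluings of fans needed below, with what is needed about them: the
    universal property in locally monoidal spaces and in topological spaces, and
    the description of the overlaps. *)
Lemma forest_colimit : exists (Q : fan) (q : forall i, lms_hom (A i) Q),
  [/\ forall i j (r : R i j), lms_comp (q j) (t r) = q i,
      forall i, open_immersion (q i),
      forall x, exists i a, lh_fun (q i) a = x,
      forall i j a b, lh_fun (q i) a = lh_fun (q j) b ->
        forest_rel t (existT _ i a) (existT _ j b)
    & (forall (B : lms) (g : forall i, lms_hom (A i) B),
        (forall i j (r : R i j), lms_comp (g j) (t r) = g i) ->
        exists! h : lms_hom Q B, forall i, lms_comp h (q i) = g i) /\
      (forall (B : topologicalType) (g : forall i, continuousType (A i) B),
        (forall i j (r : R i j) a, g j (lh_fun (t r) a) = g i a) ->
        exists! h : @hom Top Q B, forall i, @compm Top _ _ _ h (lh_fun (q i)) = g i)].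
Proof.
pose q := gl_hom Rxx Rtr Rforest t_id t_comp t_oe.
have qoe i : open_immersion (q i) by exact: gl_oe.
have cov (x : gl_lms Rxx Rtr Rforest t_id t_comp t_oe) : exists i a, lh_fun (q i) a = x.
  by have [i [a ->]] := gl_surj x; exists i, a.
have qrel i j a b : lh_fun (q i) a = lh_fun (q j) b ->
    forest_rel t (existT _ i a) (existT _ j b).
  by move/gl_eq; apply.
have Qf : locally_finite_type_fan (gl_lms Rxx Rtr Rforest t_id t_comp t_oe).
  by apply: (fan_of_fans (fun i => @fanP (A i)) qoe).
exists (Fan Qf), q; split=> //; first by move=> i j r; exact: gl_hom_t.
split=> [B g|B g gE]; first exact: gl_univ.
apply: (@top_glue _ _ _ _ (fun i => lh_fun (q i)) g) => //.
- by move=> i O; exact: (oe_open (qoe i)).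
- move=> i k a b /qrel[l [c [r [r' /= [<- <-]]]]].
  by rewrite !gE.
Qed.

End ForestFan.

(** * Fans form a category of spaces: the axioms *)
Section FansAxioms.
Local Notation E := FansSpecN.

Lemma discrete_colimit (I : smallType) (A : I -> fan) :
  exists (Q : fan) (q : forall i, lms_hom (A i) Q),
  [/\ forall i, open_immersion (q i),
      forall x, exists i a, lh_fun (q i) a = x,
      forall i j a b, lh_fun (q i) a = lh_fun (q j) b ->
        existT (fun i => A i : Type) i a = existT _ j b
    & forall (B : lms) (g : forall i, lms_hom (A i) B),
        exists! h : lms_hom Q B, forall i, lms_comp h (q i) = g i].
Proof.
pose t i j (e : i = j) : lms_hom (A i) (A j) :=
  match e in _ = j return lms_hom (A i) (A j) with erefl => lms_id (A i) end.
have t_id i (r : i = i) : t i i r = lms_id (A i) by rewrite (Prop_irrelevance r erefl).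
have t_comp i j k (r : i = j) (r' : j = k) (r'' : i = k) :
    lms_comp (t j k r') (t i j r) = t i k r''.
  by subst j k; rewrite (Prop_irrelevance r'' erefl) /= lcomp1.
have t_oe i j (r : i = j) : open_immersion (t i j r).
  by subst j; apply: (@oe_iso _ _ _ (lms_id _)) => /=; rewrite lcomp1.
have [|Q [q [_ qoe cov qrel [univ _]]]] := forest_colimit (@erefl _) (@etrans _) _ t_id t_comp t_oe.
  by move=> i j k -> ->; left.
exists Q, q; split=> // [i j a b /qrel|B g].
  move=> [k [c [r [r' /= []]]]]; rewrite /= in r r' *.
  by subst i j => /= <- <-.
by apply: univ => i j r; subst j; rewrite /= lcomp1.
Qed.

Lemma fans_coproducts : coproducts_axiom E.
Proof.
move=> I A; have [Q [q [_ _ _ univ]]] := discrete_colimit A.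
by exists Q, q => Y g; exact: univ.
Qed.

(** It is isomorphic to the disjoint union constructed above. *)
Lemma fans_coproductP (I : smallType) (A : I -> E) (Q : E)
    (inj : forall i, hom (A i) Q) : is_coproduct inj ->
  [/\ forall i, open_immersion (inj i),
      forall x : Q, exists i (a : A i), lh_fun (inj i : lms_hom _ _) a = x
    & forall i j (a : A i) (b : A j),
        lh_fun (inj i : lms_hom _ _) a = lh_fun (inj j : lms_hom _ _) b ->
        existT (fun i => A i : Type) i a = existT _ j b].
Proof.
move=> inj_univ; have [G [q [qoe cov qrel univ]]] := discrete_colimit A.
have [f [fE _]] := inj_univ G q.
have [g [gE _]] := univ Q inj.
have fg : lms_comp f g = lms_id G.
  have [k [_ kU]] := univ G q.
  rewrite -(kU (lms_comp f g)); first by apply: kU => i; exact: l1comp.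
  by move=> i; rewrite -lcompA gE; exact: fE.
have gf : lms_comp g f = lms_id Q.
  have [k [_ kU]] := inj_univ Q inj.
  rewrite -(kU (lms_comp g f)); first by apply: kU => i; exact: l1comp.
  move=> i; apply: etrans (esym (@lcompA _ _ _ _ g f (inj i))) _.
  by rewrite [X in lms_comp g X]fE; exact: gE.
split=> [i|x|i j a b].
- by rewrite -gE; apply: oe_comp (qoe i); exact: oe_iso fg gf.
- have [i [a e]] := cov (lh_fun (f : lms_hom _ _) x); exists i, a.
  by rewrite -gE /= e; exact: (congr1 (fun h : lms_hom Q Q => lh_fun h x) gf).
- have fgK z : lh_fun (f : lms_hom _ _) (lh_fun (g : lms_hom _ _) z) = z.
    exact: (congr1 (fun h : lms_hom G G => lh_fun h z) fg).
  rewrite -!gE => e; apply: qrel; move: (congr1 (lh_fun (f : lms_hom _ _)) e).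
  by rewrite /= !fgK.
Qed.

Lemma fans_top_coproducts : top_coproducts_axiom E.
Proof.
move=> I A Q inj /fans_coproductP[oe cov rel] B g.
apply: (@top_glue _ _ _ _ (fun i => lh_fun (inj i : lms_hom _ _)) g).
- by move=> i O; exact: (oe_open (oe i)).
- by move=> x; have [i [a ax]] := cov x; exists i, a.
- move=> i k a b /rel e.
  by rewrite -[LHS]/((fun z : {i : I & A i : Type} => g (projT1 z) (projT2 z)) (existT _ i a)) e.
Qed.

Lemma fans_open_subspaces : open_subspaces_axiom E.
Proof.
split=> [X O oO|X X0 Y].
  exists (fan_restr (Opens oO : opens (X : fan))), (fan_incl _); split.
    have := @oe_embedding X _ (fan_incl (Opens oO : opens (X : fan))) (restr_oe _).
    rewrite (_ : oe_img _ _ = Opens oO); first by [].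
    apply: opens_eq; apply/seteqP; split=> [_ [y _ <-]|x Ox].
      exact: (restr_incl_in y).
    by exists (SigSub (mem_set Ox)).
  exists (@idm Top (set_type O : topologicalType)); split.
    by exists (@idm Top (set_type O : topologicalType)); split; exact: (@comp1m Top).
  exact: (@compm1 Top).
have no (x : (X : fan)) : False.
  have : [set: (X : fan)] x by [].
  by move: X0 => /seteqP[X0 _] /X0.
have [h _] := @lms_glue False (fun i => X) X Y (fun i => lms_id _)
  (fun i => match i with end) (fun i => match i with end)
  (fun x => match no x with end) (fun i => match i with end).
exists h; split=> // k _; apply: (lms_joint_epi (I := False) (A := fun=> X) (q := fun i => lms_id X)) => //.
Qed.

Lemma fans_coproduct_inclusions : coproduct_inclusions_axiom E.
Proof. by move=> I A Q inj /fans_coproductP[oe _ _] i; exact/open_embeddingP. Qed.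

(** A section is invertible iff all of its germs are, that is, iff the
    corresponding morphism avoids the prime ideal generated by [1]. *)
Lemma spec_unitP (Y : lms) (f : lms_hom Y (spec_lms nat)) :
  (exists g, spec_add f g = spec_zero Y nat) <->
  forall y, oset (basic_open 1%N) (lh_fun f y).
Proof.
split=> [[g fg] y|fU].
  have u : unit (global_section f 1%N).
    exists (global_section g 1%N).
    by rewrite -global_section_spec_add fg global_section_spec_zero.
  move/prime_global_section; apply; move: u => [v e].
  by exists (germ (U := oT _) Logic.I v); rewrite -germD e germ0.
have [v e] : unit (global_section f 1%N).
  apply: unit_section => y []; apply: contrapT => /prime_global_section.
  exact: fU.
have [inv _ invK] := global_section1_bij Y.
exists (inv v); apply: (bij_inj (global_section1_bij Y)).
by rewrite global_section_spec_add invK e global_section_spec_zero.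
Qed.

Lemma fans_units : units_axiom E.
Proof.
pose U : opens SpecN := basic_open 1%N.
exists (fan_restr U), (fan_incl U); split; last by apply/open_embeddingP; exact: restr_oe.
split=> [Y g|Y f /spec_unitP fU].
  by apply/(spec_unitP (lms_comp (restr_incl U) g)) => y; exact: (@restr_incl_in SpecN U).
have [h hE] := @restr_factor _ _ U _ fU.
exists h; split=> // h' h'E; apply: (oe_mono (restr_oe U)).
by rewrite hE -h'E.
Qed.

(** The Zariski topology: sieves that contain open immersions covering the
    target. *)
Definition zariski_sieve (X : E) (S : sieve X) := forall x : (X : fan),
  exists (U : E) (j : hom U X), [/\ open_immersion j, range (lh_fun (j : lms_hom _ _)) x & S U j].

Lemma zariski_topology : grothendieck_topology zariski_sieve.
Proof.
split=> [X x|X Y h S JS y|X S T JS ST x].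
- exists X, (idm X); split; [|by exists x|by []].
  by apply: (@oe_iso _ _ _ (lms_id _)); rewrite lcomp1.
- have [U [j [J [u _ ux] Sj]]] := JS (lh_fun (h : lms_hom _ _) y).
  pose O : opens Y := opre (lh_fun (h : lms_hom _ _)) (oe_img J (oT _)).
  have [k kE] : exists k : lms_hom (fan_restr O) U,
      lms_comp j k = lms_comp h (restr_incl O).
    apply: (oe_factor J) => z; have [a _ az] := restr_incl_in z.
    by exists a.
  exists (fan_restr O), (fan_incl O); split; first exact: restr_oe.
    have Oy : oset O y by exists u.
    by exists (SigSub (mem_set Oy)).
  rewrite /= -[lms_comp h _]kE; exact: (@sieve_closed E X S U (fan_restr O) j k Sj).
- have [U [j [J [u _ <-] Sj]]] := JS x.
  have [V [k [K [v _ <-] Tk]]] := ST U j Sj u.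
  by exists V, (j ∘ k); split=> //; exact: oe_comp.
Qed.

(** An open immersion has a fibre product with any morphism, namely a preimage;
    it supplies the overlaps on which [lms_glue] asks for agreement. *)
Lemma fan_overlap (X : lms) (A B : fan) (q : lms_hom A X) (f : lms_hom B X)
    (Q : open_immersion q) (b : B) : (exists a, lh_fun q a = lh_fun f b) ->
  exists (C : fan) (c : C) (u : lms_hom C B) (v : lms_hom C A),
    [/\ lh_fun u c = b, open_immersion u & lms_comp q v = lms_comp f u].
Proof.
move=> [a ab]; pose O : opens B := opre (lh_fun f) (oe_img Q (oT _)).
have Ob : oset O b by exists a.
have [k kE] : exists k, lms_comp q k = lms_comp f (restr_incl O).
  apply: (oe_factor Q) => z; have [d _ dz] := restr_incl_in z.
  by exists d.
exists (fan_restr O), (SigSub (mem_set Ob)), (restr_incl O), k; split=> //.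
exact: restr_oe.
Qed.

(** The open immersions in the sieve cover [X], and the given morphisms agree on
    their overlaps; they glue by [lms_glue]. The result agrees with the given
    morphism on every member [f : Y -> X] of the sieve because [Y] is covered by
    open subspaces that factor through the cover of [X]. *)
Lemma zariski_subcanonical : subcanonical zariski_sieve.
Proof.
move=> Z X S JS s sE.
have s_eq Y (f f' : hom Y X) (Sf : S Y f) (Sf' : S Y f') :
    f = f' -> s Y f Sf = s Y f' Sf'.
  by move=> ff'; subst f'; congr s; exact: Prop_irrelevance.
pose U (x : (X : fan)) : E := projT1 (cid (JS x)).
have Uj x : exists j : hom (U x) X,
    [/\ open_immersion j, range (lh_fun (j : lms_hom _ _)) x & S (U x) j].
  by rewrite /U; case: cid.
pose j x : hom (U x) X := projT1 (cid (Uj x)).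
have J x : open_immersion (j x) by rewrite /j; case: cid => ? [].
have jx x : range (lh_fun (j x : lms_hom _ _)) x by rewrite /j; case: cid => ? [].
have Sj x : S (U x) (j x) by rewrite /j; case: cid => ? [].
have cov (x : X) : exists (y : X) (a : U y), lh_fun (j y : lms_hom _ _) a = x.
  by have [a _ ax] := jx x; exists x, a.
have [x y a b ab|h hE] := lms_glue (q := j : forall x, lms_hom (U x) X)
  (g := fun x => s _ _ (Sj x)) J cov.
  have [C [c [u [v [uc uoe qv]]]]] := fan_overlap (J x) (ex_intro (fun a => _ = _) a ab).
  exists C, c, v, u; split=> //.
  - apply: (oe_inj (J x)); rewrite ab -uc.
    exact: (congr1 (fun f : lms_hom C X => lh_fun f c) qv).
  - by apply: (oe_cancel (J x)); rewrite qv; apply: oe_comp.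
  - split=> //.
    have Sv : S C (j x ∘ (v : @hom E C (U x))) by exact: sieve_closed.
    have Su : S C (j y ∘ (u : @hom E C (U y))) by exact: sieve_closed.
    rewrite -[LHS](sE _ _ _ _ (Sj x) Sv) -[RHS](sE _ _ _ _ (Sj y) Su).
    exact: s_eq.
exists h; split=> [Y f Sf|h' h'E]; last first.
  apply: (lms_joint_epi J cov) => x.
  by rewrite [LHS]hE -(h'E _ _ (Sj x)).
pose T (y : (Y : fan)) := {C : fan & {u : lms_hom C Y & {v : lms_hom C (U (lh_fun (f : lms_hom _ _) y)) |
   [/\ open_immersion u, range (lh_fun u) y & lms_comp (j _ : lms_hom _ _) v = lms_comp f u]}}}.
have tex (y : (Y : fan)) : exists w : T y, True.
  have [a _ ax] := jx (lh_fun (f : lms_hom _ _) y).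
  have [C [c [u [v [uc uoe qv]]]]] := @fan_overlap _ _ _ _ f (J (lh_fun (f : lms_hom _ _) y)) y (ex_intro _ a ax).
  have P : [/\ open_immersion u, range (lh_fun u) y & lms_comp (j _ : lms_hom _ _) v = lms_comp f u].
    by split=> //; exists c.
  by exists (existT _ C (existT _ u (exist _ v P))).
pose w y : T y := projT1 (cid (tex y)).
apply: (@lms_joint_epi (Y : fan) (fun y => projT1 (w y) : lms) Y Z (fun y => projT1 (projT2 (w y)))).
- by move=> y; case: (w y) => C [u [v P]] /=; case: P.
- by move=> y; exists y; case: (w y) => C [u [v P]] /=; case: P => _ [c _ cy] _; exists c.
move=> y; case: (w y) => C [u [v P]] /=; case: P => _ _ e.
have Su : S C ((f : @hom E Y X) ∘ (u : @hom E C Y)) by exact: sieve_closed.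
have Sv : S C (j _ ∘ (v : @hom E C _)) by exact: (sieve_closed _ (Sj _)).
apply: etrans (etrans (etrans _ (esym (sE _ _ _ _ (Sj _) Sv))) (s_eq _ _ _ Sv Su e))
  (sE _ _ _ _ Sf Su).
apply: etrans (congr1 (fun z => lms_comp z v) (hE (lh_fun (f : lms_hom _ _) y))).
by rewrite /= -!lcompA e.
Qed.

Lemma fans_zariski_covers : zariski_covers_axiom E.
Proof.
exists zariski_sieve; split; [exact: zariski_topology|exact: zariski_subcanonical|].
move=> X Y f [fr fz] y.
have [x _ <-] : range (lh_fun (f : lms_hom _ _)) y by rewrite [range _]fr.
have [U [j [_ [u _ <-] /open_embeddingP oe]]] := fz x.
by exists U, (f ∘ j); split=> //; exists j.
Qed.

(** A pushout of open immersions is a colimit over a tree with the root [None]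
    below two leaves. *)
Section Span.
Variables (X0 X1 X2 : fan) (f1 : lms_hom X0 X1) (f2 : lms_hom X0 X2).
Hypotheses (F1 : open_immersion f1) (F2 : open_immersion f2).

Definition span_rel (i k : option bool) :=
  match i, k with None, _ => True | Some b, Some c => b = c | _, _ => False end.

Definition span_obj (i : option bool) : fan :=
  match i with None => X0 | Some true => X1 | Some false => X2 end.

Definition span_hom (i k : option bool) : span_rel i k ->
    lms_hom (span_obj i) (span_obj k) :=
  match i, k with
  | None, None => fun _ => lms_id _
  | None, Some true => fun _ => f1
  | None, Some false => fun _ => f2
  | Some true, Some true | Some false, Some false => fun _ => lms_id _
  | Some true, Some false => fun e => match notF (esym e) with end
  | Some false, Some true => fun e => match notF e with end
  | _, None => fun e => match e with end
  end.

Let span_id i (r : span_rel i i) : span_hom r = lms_id (span_obj i).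
Proof. by move: i r => [[]|]. Qed.

Let span_comp i j k (r : span_rel i j) (r' : span_rel j k) (r'' : span_rel i k) :
  lms_comp (span_hom r') (span_hom r) = span_hom r''.
Proof.
by move: i j k r r' r'' => [[]|] [[]|] [[]|] //= *; rewrite ?lcomp1 ?l1comp.
Qed.

Let oe_id (X : lms) : open_immersion (lms_id X).
Proof. by apply: (@oe_iso _ _ _ (lms_id _)); rewrite lcomp1. Qed.

Let span_oe i j (r : span_rel i j) : open_immersion (span_hom r).
Proof. by move: i j r => [[]|] [[]|] //= *; exact: oe_id. Qed.

Let span_refl i : span_rel i i. Proof. by case: i. Qed.

Let span_trans i j k : span_rel i j -> span_rel j k -> span_rel i k.
Proof. by move: i j k => [[]|] [[]|] [[]|]. Qed.

Let span_forest i j k : span_rel i k -> span_rel j k -> span_rel i j \/ span_rel j i.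
Proof. by move: i j k => [[]|] [[]|] [[]|] //=; auto. Qed.

Lemma span_pushout : exists (Q : fan) (q1 : lms_hom X1 Q) (q2 : lms_hom X2 Q),
  [/\ @is_pushout E X0 X1 X2 Q f1 f2 q1 q2, open_immersion q1, open_immersion q2
    & @is_pushout Top _ _ _ _ (lh_fun f1) (lh_fun f2) (lh_fun q1) (lh_fun q2)].
Proof.
have [Q [q [qt qoe cov qrel [univ tuniv]]]] :=
  forest_colimit span_refl span_trans span_forest span_id span_comp span_oe.
exists Q, (q (Some true)), (q (Some false)).
have q1 : lms_comp (q (Some true)) f1 = q None by exact: (qt None (Some true) Logic.I).
have q2 : lms_comp (q (Some false)) f2 = q None by exact: (qt None (Some false) Logic.I).
split; [split| exact: (qoe (Some true))|exact: (qoe (Some false))|split].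
- by rewrite [LHS]q1 [RHS]q2.
- move=> Y g1 g2 g12.
  pose g (i : option bool) : lms_hom (span_obj i) (Y : fan) :=
    match i with None => lms_comp g1 f1 | Some true => g1 | Some false => g2 end.
  have [|h [hE hU]] := univ Y g.
    by move=> [[]|] [[]|] //= *; rewrite ?lcomp1 //; apply/esym.
  exists h; split; first by split; [exact: (hE (Some true))|exact: (hE (Some false))].
  move=> h' [h1 h2]; apply: hU => -[[]|] //.
  by rewrite -q1 lcompA; congr lms_comp.
- by apply/continuousEP => x; rewrite -[LHS]/(lh_fun (lms_comp (q (Some true)) f1) x) q1 -q2.
- move=> Y g1 g2 g12.
  pose g (i : option bool) : continuousType (span_obj i) (Y : topologicalType) :=
    match i with None => top_comp g1 (lh_fun f1) | Some true => g1 | Some false => g2 end.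
  have [|h [hE hU]] := tuniv Y g.
    move=> [[]|] [[]|] //= r a.
    by rewrite -[LHS]/((top_comp g2 (lh_fun f2)) a) -[top_comp g2 _]g12.
  exists h; split; first by split; [exact: (hE (Some true))|exact: (hE (Some false))].
  move=> h' [h1 h2]; apply: hU => -[[]|] //.
  rewrite -q1; apply/continuousEP => x.
  exact: (congr1 (fun k : continuousType _ _ => k (lh_fun f1 x)) h1).
Qed.
End Span.

Lemma well_order_total (I : Type) (R : rel I) : well_order R -> total R.
Proof.
move=> wo x y; have [|z [[zxy zmin] _]] := wo (fun z => `[< z = x \/ z = y >]).
  by exists x; apply/asboolP; left.
have zx : R z x by apply: zmin; apply/asboolP; left.
have zy : R z y by apply: zmin; apply/asboolP; right.
by move/asboolP: zxy => [<-|<-]; rewrite ?zx ?zy ?orbT.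
Qed.

(** Spans and well-ordered sets are forests. *)
Lemma fans_zariski_gluing : zariski_gluing_axiom E.
Proof.
split=> [X0 X1 X2 f1 f2 /open_embeddingP F1 /open_embeddingP F2|].
  have [Q [q1 [q2 [po oe1 oe2 tpo]]]] := span_pushout F1 F2.
  exists Q, q1, q2; split=> //; split; apply/open_embeddingP => //.
  exact: oe_comp.
move=> I R Rxx Rtr D wo Doe.
pose A (i : I) : fan := D i.
pose t i j (r : R i j) : lms_hom (A i) (A j) := fmap D (r : @hom (order_category Rxx Rtr) i j).
have t_id i (r : R i i) : t i i r = lms_id (A i).
  by rewrite /t (Prop_irrelevance r (Rxx i)); exact: (fmap1 D).
have t_comp i j k (r : R i j) (r' : R j k) (r'' : R i k) :
    lms_comp (t j k r') (t i j r) = t i k r''.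
  rewrite /t (Prop_irrelevance r'' (@compm (order_category Rxx Rtr) _ _ _ r' r)).
  by rewrite fmapM.
have t_oe i j (r : R i j) : open_immersion (t i j r) by apply/open_embeddingP; exact: Doe.
have [//|i j k|i j k|Q [q [qt qoe cov qrel [univ tuniv]]]] :=
    @forest_colimit I (fun i j => R i j) _ _ _ A t t_id t_comp t_oe.
- exact: Rtr.
- by move=> _ _; have /orP[] := well_order_total wo i j; auto.
have qn i j (u : @hom (order_category Rxx Rtr) i j) : @compm E _ _ _ (q j) (fmap D u) = q i.
  exact: qt.
exists (Cocone qn); split.
- by move=> c'; apply: univ => i j r; exact: (@coleg_nat _ _ _ c' i j r).
- by move=> i; exact/open_embeddingP.
- move=> c'; apply: tuniv => i j r a.
  by rewrite -(@coleg_nat _ _ _ c' i j r).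
Qed.

Theorem fans_category_of_spaces : category_of_spaces FansSpecN.
Proof.
split; last exact: fans_units.
- split; [exact: fans_finite_limits|exact: fans_coproducts| |].
    exact: fans_top_coproducts.
  exact: fans_open_subspaces.
- exact: fans_zariski_covers.
- exact: fans_coproduct_inclusions.
- exact: fans_zariski_gluing.
Qed.
End FansAxioms.

(** * Finitely generated commutative monoids are finitely presented *)

(** Dickson's lemma on the minimal elements of a set of vectors, where [T] stands
    for the set of vectors and [f] for the coordinates. For the induction step,
    let [s] be such a list for the first [n] coordinates and [K] its largest
    last coordinate. An element whose last coordinate is at least [K] lies above
    an element of [s]; the finitely many smaller values [k] are dealt with
    separately, on the elements with last coordinate [k]. *)
Lemma dickson (T : eqType) (f : nat -> T -> nat) (n : nat) (D : T -> Prop) :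
  exists s : seq T, (forall a, a \in s -> D a) /\
    forall d, D d -> exists2 a, a \in s & forall i, (i < n)%N -> (f i a <= f i d)%N.
Proof.
elim: n D => [|n IHn] D.
  have [[d Dd]|nD] := pselect (exists d, D d).
    by exists [:: d]; split=> [a|e _]; [rewrite mem_seq1 => /eqP->|exists d; rewrite ?mem_head].
  by exists [::]; split=> // d Dd; case: nD; exists d.
have [s [sD sP]] := IHn D; pose K := (\max_(a <- s) f n a)%N.
pose t k := projT1 (cid (IHn (fun d => D d /\ f n d = k))).
have tD k a : a \in t k -> D a /\ f n a = k.
  by rewrite /t; case: cid => u /= [uD _] /uD.
have tP k d : D d -> f n d = k ->
    exists2 a, a \in t k & forall i, (i < n)%N -> (f i a <= f i d)%N.
  by move=> Dd e; rewrite /t; case: cid => u /= [_ uP]; exact: uP.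
exists (s ++ flatten [seq t k | k <- iota 0 K]); split=> [a|d Dd].
  by rewrite mem_cat => /orP[/sD//|/flatten_mapP[k _ /tD[]]].
have [dK|Kd] := ltnP (f n d) K.
  have [a at_ aP] := tP _ d Dd erefl; exists a.
    rewrite mem_cat; apply/orP; right; apply/flatten_mapP; exists (f n d) => //.
    by rewrite mem_iota.
  by move=> i; rewrite ltnS leq_eqVlt => /orP[/eqP->|/aP//]; have [_ ->] := tD _ _ at_.
have [a as_ aP] := sP d Dd; exists a; first by rewrite mem_cat as_.
move=> i; rewrite ltnS leq_eqVlt => /orP[/eqP->|/aP//].
by apply: leq_trans Kd; rewrite /K (big_rem a) //= leq_maxl.
Qed.

Section Redei.
Variable n : nat.
Local Notation vec := {ffun 'I_n -> nat}.

(** The lexicographic order, restricted to the first [m] coordinates in order to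
    prove by induction that it is well-founded. *)
Definition lexlt (m : nat) (a b : vec) := exists2 k : 'I_n, (k < m)%N &
  (a k < b k)%N /\ forall i : 'I_n, (i < k)%N -> a i = b i.

Lemma lex_min (C : vec -> Prop) : (exists a, C a) ->
  exists2 a, C a & forall b, C b -> a = b \/ lexlt n a b.
Proof.
move=> C0; suff /(_ n)[a Ca aP] m : exists2 a, C a & forall b, C b ->
    (forall i : 'I_n, (i < m)%N -> a i = b i) \/ lexlt m a b.
  exists a => // b /aP[ab|]; [left|by right].
  by apply/ffunP => i; exact: ab.
elim: m => [|m [a Ca aP]]; first by have [a Ca] := C0; exists a => // b _; left.
have [mn|nm] := ltnP m n; last first.
  exists a => // b /aP[ab|[k km kP]]; [left=> i _|right].
    by apply: ab; exact: leq_trans (ltn_ord i) nm.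
  by exists k => //; exact: ltnW.
pose p k := `[< exists2 b, C b & (forall i : 'I_n, (i < m)%N -> a i = b i) /\ b (Ordinal mn) = k >].
have [|k /asboolP[b Cb [ab bk]] kmin] := @ex_minnP p.
  by exists (a (Ordinal mn)); apply/asboolP; exists a.
exists b => // d Cd; have [ad|[l lm [al ai]]] := aP d Cd.
  have : (k <= d (Ordinal mn))%N by apply: kmin; apply/asboolP; exists d.
  rewrite leq_eqVlt => /orP[/eqP e|kd]; [left=> i|right].
    rewrite ltnS leq_eqVlt => /orP[/eqP im|im]; last by rewrite -ab // ad.
    by rewrite (_ : i = Ordinal mn) ?bk //; exact: val_inj.
  exists (Ordinal mn) => //; split=> [|i im]; first by rewrite bk.
  by rewrite -ab // ad.
right; exists l; first exact: ltnW.
by split=> [|i il]; rewrite -ab //; [exact: ai|exact: ltn_trans lm].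
Qed.

Lemma lexltD a b c : lexlt n a b -> lexlt n [ffun i => (a i + c i)%N] [ffun i => (b i + c i)%N].
Proof.
move=> [k kn [ab ai]]; exists k => //; split=> [|i ik]; rewrite !ffunE ?ltn_add2r //.
by rewrite ai.
Qed.

Lemma lexlt_asym a b : lexlt n a b -> ~ lexlt n b a.
Proof.
move=> [k _ [ak ai]] [l _ [bl bi]].
have [kl|lk|/val_inj e] := ltngtP k l.
- by move: ak; rewrite bi // ltnn.
- by move: bl; rewrite ai // ltnn.
- by move: ak; rewrite e ltnNge ltnW.
Qed.

Definition lin (M : nmodType) (m : 'I_n -> M) (c : 'I_n -> nat) : M :=
  \sum_i m i *+ c i.

Lemma linD (M : nmodType) (m : 'I_n -> M) (c d : 'I_n -> nat) :
  lin m (fun i => (c i + d i)%N) = lin m c + lin m d.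
Proof. by rewrite -big_split; apply: eq_bigr => i _; rewrite mulrnDr. Qed.

Lemma lin_ext (M : nmodType) (m : 'I_n -> M) (c d : 'I_n -> nat) :
  c =1 d -> lin m c = lin m d.
Proof. by move=> cd; apply: eq_bigr => i _; rewrite cd. Qed.

(** The argument of Groebner bases. Fix the lexicographic order on [N ^ n]; call
    a vector reducible if it is not the smallest one with its value in [P].
    Reducible vectors are closed under adding vectors, since the order is, and
    so all lie above finitely many of them, by [dickson]. The relations that
    identify these with a smaller vector suffice: the smallest vector that they
    identify with [a] is the smallest one with the same value as [a]. *)
Theorem redei (P : nmodType) (g : 'I_n -> P) :
  exists s : seq (vec * vec),
    (forall r, r \in s -> lin g r.1 = lin g r.2) /\
    forall (M : nmodType) (m : 'I_n -> M),
      (forall r, r \in s -> lin m r.1 = lin m r.2) ->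
      forall c d : 'I_n -> nat, lin g c = lin g d -> lin m c = lin m d.
Proof.
pose below (a b : vec) := lexlt n b a /\ lin g b = lin g a.
pose coord i (a : vec) := if insub i is Some j then a j else 0%N.
have [s [sD sP]] := @dickson vec coord n (fun a => exists b, below a b).
pose low a := if pselect (exists b, below a b) is left e then projT1 (cid e) else a.
have lowP a : (exists b, below a b) -> below a (low a).
  by move=> ex; rewrite /low; case: pselect => // e; case: cid.
exists [seq (a, low a) | a <- s]; split=> [_ /mapP[a /sD/lowP[_ e] ->]//|M m mP].
(* [b] is a normal form of [a]: it has the same value in [P] and in [M], and it
   depends only on the value in [P]. *)
suff key (a : vec) : exists2 b : vec, lin g b = lin g a /\ lin m b = lin m a &
    forall d : vec, lin g d = lin g a -> b = d \/ lexlt n b d.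
  move=> c d cd.
  have [a [ga ma] amin] := key (finfun c); have [b [gb mb] bmin] := key (finfun d).
  have fc (N : nmodType) (h : 'I_n -> N) e : lin h (finfun e) = lin h e.
    by apply: lin_ext => i; rewrite ffunE.
  have ab : a = b.
    have [|//|ab] := amin b; first by rewrite gb !fc.
    have [|->//|/(lexlt_asym ab)//] := bmin a.
    by rewrite ga !fc.
  by rewrite -(fc M m c) -ma ab mb fc.
have [|b [gb mb] bmin] := lex_min (C := fun b => lin g b = lin g a /\ lin m b = lin m a).
  by exists a.
exists b => // d gd; apply: contrapT => /not_orP[bd nlt].
have [e ge emin] := lex_min (C := fun e => lin g e = lin g a) (ex_intro _ a erefl).
have be : below b e.
  have [eb|//] := emin b gb; last by split=> //; rewrite ge gb.
  by have [ed|ed] := emin d gd; [case: bd; rewrite -eb|case: nlt; rewrite -eb].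
have [x xs xb] := sP b (ex_intro _ e be).
have [lx gx] := lowP x (sD x xs).
have xb' i : (x i <= b i)%N.
  by have := xb i (ltn_ord i); rewrite /coord valK.
pose c : vec := [ffun i => (b i - x i)%N].
have bE : b = [ffun i => (x i + c i)%N].
  by apply/ffunP => i; rewrite !ffunE subnKC.
pose y : vec := [ffun i => (low x i + c i)%N].
have yl (N : nmodType) (h : 'I_n -> N) : lin h x = lin h (low x) -> lin h y = lin h b.
  move=> hx; rewrite bE /y !(@lin_ext N h [ffun i => _] _ (ffunE _)) !linD.
  by rewrite hx.
have ylt : lexlt n y b by rewrite bE; exact: lexltD.
have [|yb|by_] := bmin y.
- rewrite yl // yl //; exact: (mP (x, low x) (map_f _ xs)).
- by move: ylt; rewrite -yb => bb; exact: (lexlt_asym bb bb).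
- exact: lexlt_asym by_.
Qed.

End Redei.

(** * Open embeddings in a category of spaces *)

(** The indiscrete space with two points. All maps to it are continuous, so that
    subsets of a space amount to maps to it, and universal properties in
    topological spaces can be tested on points. *)
Definition indiscrete := bool.
HB.instance Definition _ := Choice.on indiscrete.

Definition indiscrete_open : set_system indiscrete :=
  [set O | forall x y, O x -> O y].

Lemma indiscrete_openT : indiscrete_open setT. Proof. by []. Qed.
Lemma indiscrete_openI : setI_closed indiscrete_open.
Proof. by move=> U V oU oV x y [/oU Uy /oV Vy]. Qed.
Lemma indiscrete_open_bigU (K : Type) (f : K -> set indiscrete) :
  (forall k, indiscrete_open (f k)) -> indiscrete_open (\bigcup_k f k).
Proof. by move=> of_ x y [k _ fx]; exists k => //; exact: of_ fx. Qed.

HB.instance Definition _ := isOpenTopological.Build indiscrete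
  indiscrete_openT indiscrete_openI indiscrete_open_bigU.

Lemma to_indiscrete_continuous (X : topologicalType) (f : X -> indiscrete) :
  continuous f.
Proof.
apply/continuousP => O oO; have [[x Ox]|nO] := pselect (exists x, O (f x)).
  rewrite (_ : _ @^-1` _ = setT); first exact: openT.
  by apply/seteqP; split=> // y _; exact: oO Ox.
rewrite (_ : _ @^-1` _ = set0); first exact: open0.
by apply/seteqP; split=> // y Oy; apply: nO; exists y.
Qed.

Definition indicator (X : topologicalType) (D : set X) : @hom Top X indiscrete :=
  mkcts (@to_indiscrete_continuous X (fun x => `[< D x >])).

Lemma indicator_eq (X : topologicalType) (D : set X) :
  indicator setT = indicator D -> forall x, D x.
Proof.
move=> e x; have /esym := congr1 (fun f : continuousType _ _ => f x) e.
by rewrite /= (asboolT (Logic.I : setT x)) => /asboolP.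
Qed.

(** The indicators of the whole space and of the union of the images agree on
    each [X i], and hence are equal. *)
Lemma top_coproduct_surj (I : smallType) (X : I -> Top) (Q : Top)
    (inj : forall i, hom (X i) Q) : is_coproduct inj ->
  forall z : (Q : topologicalType), exists i x, (inj i : continuousType _ _) x = z.
Proof.
move=> cop; apply: (indicator_eq (D := [set z | exists i x, (inj i : continuousType _ _) x = z])).
have [h [_ hU]] := cop indiscrete (fun i => indicator setT).
transitivity h; first by apply/esym/hU => i; exact/continuousEP.
apply: hU => i; apply/continuousEP => x.
by apply: asbool_equiv_eq; split=> // _; exists i, x.
Qed.

Definition sp (E : space_data) (X : E) : topologicalType := sp_top E X.

Definition tf (E : space_data) (X Y : E) (f : hom X Y) : continuousType (sp X) (sp Y) :=
  fmap (sp_top E) f.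

Lemma tf_comp (E : space_data) (X Y Z : E) (g : hom Y Z) (f : hom X Y) x :
  tf (g ∘ f) x = tf g (tf f x).
Proof. by rewrite /tf fmapM. Qed.

Lemma tf_id (E : space_data) (X : E) x : tf (idm X) x = x.
Proof. by rewrite /tf fmap1. Qed.

Lemma subspace_val_open (X : topologicalType) (O : opens X) (W : set (set_type O)) :
  open W -> open (set_val @` W).
Proof.
move=> [A oA <-]; suff -> : (set_val @` (set_val @^-1` A : set (set_type O)) : set X) = A `&` O.
  by apply: openI => //; exact: oset_open.
apply/seteqP; split=> [_ [y Ay <-]|x [Ax Ox]].
  by split=> //; exact: set_valP.
by exists (SigSub (mem_set Ox)).
Qed.

Section Spaces.
Variable E : space_data.
Hypothesis SE : category_of_spaces E.

(** The open subset is kept as a parameter: it is determined by [j], but only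
    together with the axiom that identifies the underlying map of [j]. *)
Definition emb (X : E) (O : opens (sp X)) (U : E) (j : hom U X) :=
  @open_embedding_onto E X O U j.

Lemma emb_in X O U (j : hom U X) : @emb X O U j -> forall u, oset O (tf j u).
Proof. by move=> [_ [/(_ U (idm U))]]; rewrite compm1 => jO _ u; apply: jO; exists u. Qed.

Lemma emb_factor X O U (j : hom U X) Y (f : hom Y X) : @emb X O U j ->
  (forall y, oset O (tf f y)) -> exists g, j ∘ g = f.
Proof.
move=> [_ [_ /(_ Y f)]] jU fO; case: jU => [_ [y _ <-]|g [ge _]]; first exact: fO.
by exists g.
Qed.

Lemma emb_mono X O U (j : hom U X) Y (f g : hom Y U) : @emb X O U j ->
  j ∘ f = j ∘ g -> f = g.
Proof.
move=> J e; have [_ [_ jU]] := J.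
have [_ [y _ <-]|h [_ hU]] := jU Y (j ∘ f).
  rewrite -[fmap _ _]/(tf (j ∘ f)) tf_comp; exact: emb_in J _.
by rewrite -(hU f) // -(hU g).
Qed.

Lemma embI X (O : opens (sp X)) U (j : hom U X) : (forall u, oset O (tf j u)) ->
  (forall Y (f : hom Y X), (forall y, oset O (tf f y)) -> exists g, j ∘ g = f) ->
  (forall Y (f g : hom Y U), j ∘ f = j ∘ g -> f = g) -> emb O j.
Proof.
move=> jO jf jm; split; first exact: oset_open.
split=> [Y g _ [y _ <-]|Y f fO].
  by rewrite -[fmap _ _]/(tf (j ∘ g)) tf_comp.
have [|g ge] := jf Y f; first by move=> y; apply: fO; exists y.
by exists g; split=> // g' ge'; apply: jm; rewrite ge.
Qed.

Lemma embE X (j_U : E) (j : hom j_U X) : open_embedding j -> exists O, @emb X O j_U j.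
Proof. by move=> [O [oO jO]]; exists (Opens oO); split. Qed.

Definition sub_spec X (O : opens (sp X)) : exists (U : E) (j : hom U X), emb O j /\
   exists phi : @hom Top (sp U) (set_type O : topologicalType),
        is_iso phi /\ @compm Top _ _ _ (incl_map O) phi = tf j.
Proof. by case: SE => -[_ _ _ [H _]] _ _ _ _; exact: H (oset_open O). Qed.

Definition sub X (O : opens (sp X)) : E := projT1 (cid (sub_spec O)).

Definition inc_spec X (O : opens (sp X)) := projT2 (cid (sub_spec O)).

Definition inc X (O : opens (sp X)) : hom (sub O) X := projT1 (cid (inc_spec O)).

Lemma inc_emb X (O : opens (sp X)) : emb O (inc O).
Proof. exact: (projT2 (cid (inc_spec O))).1. Qed.

Lemma inc_homeo X (O : opens (sp X)) :
   exists phi : @hom Top (sp (sub O)) (set_type O : topologicalType),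
        is_iso phi /\ @compm Top _ _ _ (incl_map O) phi = tf (inc O).
Proof. exact: (projT2 (cid (inc_spec O))).2. Qed.

Section Embeddings.
Variables (X : E) (O : opens (sp X)) (U : E) (j : hom U X).
Hypothesis J : emb O j.

Lemma emb_iso_sub : exists (f : hom U (sub O)) (g : hom (sub O) U),
  [/\ inc O ∘ f = j, j ∘ g = inc O, f ∘ g = idm _ & g ∘ f = idm _].
Proof.
have [f fE] := emb_factor (inc_emb O) (emb_in J).
have [g gE] := emb_factor J (emb_in (inc_emb O)).
exists f, g; split=> //.
  by apply: (emb_mono (inc_emb O)); rewrite compmA fE gE compm1.
by apply: (emb_mono J); rewrite compmA gE fE compm1.
Qed.

Lemma emb_homeo : exists (phi : continuousType (sp U) (set_type O))
    (psi : continuousType (set_type O) (sp U)),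
  [/\ forall u, psi (phi u) = u, forall x, phi (psi x) = x &
      forall u, set_val (phi u) = tf j u].
Proof.
have [f [g [fE gE fg gf]]] := emb_iso_sub.
have [phi [[psi [psiphi phipsi]] phiE]] := inc_homeo O.
exists (@compm Top _ _ _ phi (tf f)), (@compm Top _ _ _ (tf g : @hom Top _ _) psi); split.
- move=> u; rewrite /= -[psi _]/((@compm Top _ _ _ psi phi : continuousType _ _) (tf f u)).
  by rewrite psiphi /= -tf_comp gf tf_id.
- move=> x; rewrite /= -tf_comp fg tf_id.
  by rewrite -[phi _]/((@compm Top _ _ _ phi psi : continuousType _ _) x) phipsi.
- move=> u; rewrite /= -[LHS]/((@compm Top _ _ _ (incl_map O) phi : continuousType _ _) (tf f u)).
  by rewrite phiE -tf_comp fE.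
Qed.

Lemma emb_inj : injective (tf j).
Proof.
have [phi [psi [phiK psiK phiE]]] := emb_homeo.
by move=> u v; rewrite -!phiE => /val_inj e; rewrite -[u]phiK e phiK.
Qed.

Lemma emb_surj x : oset O x -> exists u, tf j u = x.
Proof.
move=> Ox; have [phi [psi [phiK psiK phiE]]] := emb_homeo.
by exists (psi (SigSub (mem_set Ox))); rewrite -phiE psiK.
Qed.

Lemma emb_open (V : set (sp U)) : open V -> open (tf j @` V).
Proof.
move=> oV; have [phi [psi [phiK psiK phiE]]] := emb_homeo.
have oW : open (psi @^-1` V) by apply: (continuousP psi).1 => //; exact: cts_fun.
rewrite (_ : _ @` _ = set_val @` (psi @^-1` V)).
  exact: subspace_val_open.
apply/seteqP; split=> [_ [u Vu <-]|_ [x Vx <-]] /=.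
  by exists (phi u); rewrite ?phiE //= phiK.
by exists (psi x); rewrite // -phiE psiK.
Qed.

End Embeddings.
End Spaces.

(** * Gluing morphisms in a category of spaces *)
Section SpaceGluing.
Variable E : space_data.
Hypothesis SE : category_of_spaces E.
Local Notation sub := (sub SE).
Local Notation inc := (inc SE).

Lemma emb_id (X : E) : emb (oT (sp X)) (idm X).
Proof.
apply: embI => // [Y f _|Y f g]; first by exists f; rewrite comp1m.
by rewrite !comp1m.
Qed.

Lemma emb_cancel (X U V : E) (O : opens (sp X)) (W : opens (sp X)) (j : hom U X)
    (k : hom V U) : emb O j -> emb W (j ∘ k) -> emb (opre (tf j) W) k.
Proof.
move=> J JK; apply: embI => [u|Y f fW|Y f g e].
- by have := emb_in JK u; rewrite tf_comp.
- have [|g ge] := emb_factor (f := j ∘ f) JK; first by move=> y; rewrite tf_comp; exact: fW.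
  by exists g; apply: (emb_mono J); rewrite compmA.
- by apply: (emb_mono JK); rewrite -!compmA e.
Qed.

Lemma sub_map (X Y : E) (h : hom X Y) (U : opens (sp X)) (V : opens (sp Y)) :
  U `<=` tf h @^-1` V -> exists k : hom (sub U) (sub V), inc V ∘ k = h ∘ inc U.
Proof.
move=> UV; apply: (emb_factor (inc_emb SE V)) => y; rewrite tf_comp.
by apply: UV; exact: emb_in (inc_emb SE U) y.
Qed.

Lemma sub_point (X : E) (U : opens (sp X)) x : oset U x ->
  exists u, tf (inc U) u = x.
Proof. exact: emb_surj (inc_emb SE U) x. Qed.

Lemma inc_mono (X : E) (U : opens (sp X)) Y (f g : hom Y (sub U)) :
  inc U ∘ f = inc U ∘ g -> f = g.
Proof. exact: emb_mono (inc_emb SE U). Qed.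

Section Cover.
Variables (X : E) (I : smallType) (U : I -> E) (O : I -> opens (sp X)).
Variable j : forall i, hom (U i) X.
Hypothesis J : forall i, emb (O i) (j i).
Hypothesis cov : forall x, exists i, oset (O i) x.

(** The coproduct of an open cover is a Zariski cover, and the topology is
    subcanonical. *)
Lemma cover_coproduct : exists (Q : E) (inj : forall i, hom (U i) Q) (f : hom Q X),
  [/\ is_coproduct inj, forall i, f ∘ inj i = j i,
      (forall z : sp Q, exists i u, tf (inj i) u = z),
      forall i, open_embedding (inj i)
    & forall Z : E, sheaf_for Z (gen_sieve f)].
Proof.
have [[_ S2 S3 _] S5 S6 _ _] := SE.
have [Q [inj cop]] := S2 I U; have [f [fE _]] := cop X j.
have surj (z : sp Q) : exists i u, tf (inj i) u = z.
  exact: (top_coproduct_surj (S3 _ _ _ _ cop) z).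
exists Q, inj, f; split=> // [i|Z]; first exact: S6.
have [T [_ Tsub Tzar]] := S5; apply: Tsub; apply: Tzar; split.
  apply/seteqP; split=> // x _; have [i Oi] := cov x.
  have [u ux] := emb_surj SE (J i) Oi; exists (tf (inj i) u) => //.
  by rewrite -[LHS]/(tf f (tf (inj i) u)) -tf_comp fE.
move=> z; have [i [u uz]] := surj z; exists (U i), (inj i); split; first exact: S6.
  by exists u.
by rewrite fE; exists (O i); exact: J.
Qed.

Lemma cover_epi (Z : E) (h h' : hom X Z) : (forall i, h ∘ j i = h' ∘ j i) -> h = h'.
Proof.
move=> hh'; have [Q [inj [f [cop fE _ _ sh]]]] := cover_coproduct.
have hf : h ∘ f = h' ∘ f.
  have [k [_ kU]] := cop Z (fun i => h ∘ j i).
  rewrite -(kU (h ∘ f)) => [|i]; last by rewrite -compmA fE.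
  by apply: kU => i; rewrite -compmA fE hh'.
have [|t [_ tU]] := sh Z (fun Y g _ => h ∘ g).
  by move=> Y Y' g g' _ _; rewrite compmA.
rewrite -(tU h) // ; apply: tU => Y _ [g ->].
by rewrite !compmA hf.
Qed.

End Cover.

(** The maps [g i] define a map [G] on the coproduct [Q] of the cover. It descends
    to [X] if [G] does not distinguish two maps [k] and [k'] to [Q] that agree
    over [X]. Locally on the source, [k] and [k'] factor through members of the
    cover, and there [compat] applies. *)
Lemma cover_glue (X : E) (I : smallType) (U : I -> E) (O : I -> opens (sp X))
    (j : forall i, hom (U i) X) (Z : E) (g : forall i, hom (U i) Z) :
  (forall i, emb (O i) (j i)) -> (forall x, exists i, oset (O i) x) ->
  (forall i k T (a : hom T (U i)) (b : hom T (U k)), j i ∘ a = j k ∘ b ->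
     g i ∘ a = g k ∘ b) ->
  exists h : hom X Z, forall i, h ∘ j i = g i.
Proof.
move=> J cov compat; have [Q [inj [f [cop fE surj oe sh]]]] := cover_coproduct J cov.
have [G [GE _]] := cop Z g.
(* This argument stands in for a description of the fibre product of [Q] with
   itself over [X] as a coproduct of intersections. *)
have sep T (k k' : hom T Q) : f ∘ k = f ∘ k' -> G ∘ k = G ∘ k'.
  move=> e; pose O' i := projT1 (cid (embE (oe i))).
  have J' i : emb (O' i) (inj i) by exact: (projT2 (cid (embE (oe i)))).
  have pick (t : sp T) : exists il : I * I,
      oset (O' il.1) (tf k t) /\ oset (O' il.2) (tf k' t).
    have [i [u ui]] := surj (tf k t); have [l [v vl]] := surj (tf k' t).
    by exists (i, l); rewrite -ui -vl; split; exact: emb_in (J' _) _.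
  have {pick} [p pP] := choice pick.
  pose W t := oI (opre (tf k) (O' (p t).1)) (opre (tf k') (O' (p t).2)).
  apply: (cover_epi (fun t => inc_emb SE (W t))) => [t|t].
    by exists t; exact: pP.
  have [|a ae] := emb_factor (f := k ∘ inc (W t)) (J' (p t).1).
    by move=> y; rewrite tf_comp; case: (emb_in (inc_emb SE (W t)) y).
  have [|b be] := emb_factor (f := k' ∘ inc (W t)) (J' (p t).2).
    by move=> y; rewrite tf_comp; case: (emb_in (inc_emb SE (W t)) y).
  rewrite -!compmA -ae -be !compmA !GE; apply: compat.
  by rewrite -!fE -!compmA ae be !compmA e.
pose pk Y (phi : hom Y X) (P : gen_sieve f Y phi) := projT1 (cid P).
have pkE Y phi P : phi = f ∘ @pk Y phi P by rewrite /pk; case: cid.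
have [|h [hE _]] := sh Z (fun Y phi P => G ∘ pk Y phi P).
  move=> Y Y' phi psi P P'; rewrite -compmA; apply: sep.
  by rewrite -pkE compmA -pkE.
exists h => i; have P : gen_sieve f (U i) (j i) by exists (inj i); rewrite fE.
rewrite (hE _ (j i) P) -GE; apply: sep.
by rewrite -pkE fE.
Qed.

(** The open subset is that of the open embedding representing the units. *)
Lemma unit_open_spec : exists G : opens (sp (A1 E)), forall (Y : E) (f : hom Y (A1 E)),
  (exists g, madd (A1_monoid E) f g = mzero (A1_monoid E) Y) <->
  forall y, oset G (tf f y).
Proof.
have [_ _ _ _ [G [j [[j1 j2] oe]]]] := SE; have [O J] := embE oe.
exists O => Y f; split=> [u y|fO].
  by have [h [<- _]] := j2 Y f u; rewrite tf_comp; exact: emb_in J _.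
by have [h <-] := emb_factor J fO; exact: j1.
Qed.

Definition Gm : opens (sp (A1 E)) := projT1 (cid unit_open_spec).

Lemma GmP (Y : E) (f : hom Y (A1 E)) :
  (exists g, madd (A1_monoid E) f g = mzero (A1_monoid E) Y) <->
  forall y, oset Gm (tf f y).
Proof. exact: (projT2 (cid unit_open_spec)). Qed.

End SpaceGluing.

(** * The locally monoidal space underlying a space *)

(** The monoid of functions on [X]; a name of its own lets it carry
    the instance. *)
Definition homA (E : space_data) (X : E) := hom X (A1 E).
Arguments homA : clear implicits.

HB.instance Definition _ (E : space_data) X := gen_eqMixin (homA E X).
HB.instance Definition _ (E : space_data) X := gen_choiceMixin (homA E X).
HB.instance Definition _ (E : space_data) X := GRing.isNmodule.Build (homA E X)
  (@maddA _ _ (A1_monoid E) X) (@maddC _ _ (A1_monoid E) X) (@madd0 _ _ (A1_monoid E) X).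

Lemma homAD (E : space_data) X (f g : homA E X) : f + g = madd (A1_monoid E) f g.
Proof. by []. Qed.

Lemma homA0 (E : space_data) X : (0 : homA E X) = mzero (A1_monoid E) X.
Proof. by []. Qed.

Definition pullA (E : space_data) (X Y : E) (h : hom Y X) (f : homA E X) : homA E Y :=
  f ∘ h.

Lemma pullAM (E : space_data) (X Y : E) (h : hom Y X) : GRing.nmod_morphism (pullA h).
Proof.
split=> [|f g]; first exact: (mzero_comp (A1_monoid E)).
exact: (madd_comp (A1_monoid E)).
Qed.

Section Structure.
Variable E : space_data.
Hypothesis SE : category_of_spaces E.
Local Notation sub := (sub SE).
Local Notation inc := (inc SE).

Section SubMap.
Variables (X Y : E) (h : hom X Y) (U : opens (sp X)) (V : opens (sp Y)).
Hypothesis UV : U `<=` tf h @^-1` V.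

Definition smap : hom (sub U) (sub V) := projT1 (cid (sub_map SE UV)).

Lemma smapE : inc V ∘ smap = h ∘ inc U.
Proof. by rewrite /smap; case: cid. Qed.

End SubMap.

Lemma sub_id_sub (X : E) (U V : opens (sp X)) : V `<=` U -> V `<=` tf (idm X) @^-1` U.
Proof. by move=> VU x Vx; rewrite /preimage /= tf_id; exact: VU. Qed.

Definition sub_res (X : E) (U V : opens (sp X)) (VU : V `<=` U) :
  hom (sub V) (sub U) := smap (sub_id_sub VU).

Lemma sub_resE (X : E) (U V : opens (sp X)) (VU : V `<=` U) :
  inc U ∘ sub_res VU = inc V.
Proof. by rewrite smapE comp1m. Qed.

Lemma sub_res_emb (X : E) (U V : opens (sp X)) (VU : V `<=` U) :
  emb (opre (tf (inc U)) V) (sub_res VU).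
Proof.
by apply: emb_cancel (inc_emb SE U) _; rewrite sub_resE; exact: inc_emb.
Qed.

Definition lms_of_presheaf (X : E) : presheaf (sp X).
Proof.
refine (@Presheaf (sp X) (fun U => homA E (sub U))
  (fun U V VU s => pullA (sub_res VU) s) _ _ _).
- by move=> U V VU; exact: pullAM.
- move=> U UU s; rewrite /pullA (_ : sub_res UU = idm _) ?compm1 //.
  by apply: (inc_mono (SE := SE)); rewrite sub_resE compm1.
- move=> U V W VU WV WU s; rewrite /pullA -compmA; congr (_ ∘ _).
  by apply: (inc_mono (SE := SE)); rewrite compmA !sub_resE.
Defined.

(** Sections are morphisms to [A1], which glue by [cover_glue]. *)
Lemma lms_of_sheafP (X : E) : is_sheaf (lms_of_presheaf X).
Proof.
move=> U I V VU cov s sV.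
have /choice[p pP] (z : sp (sub U)) : exists i, oset (V i) (tf (inc U) z).
  by have [i _ Vi] := cov _ (emb_in (inc_emb SE U) z); exists i.
have agree i k T (a : hom T (sub (V i))) (b : hom T (sub (V k))) :
    inc (V i) ∘ a = inc (V k) ∘ b -> (s i : hom _ _) ∘ a = (s k : hom _ _) ∘ b.
  move=> e; pose W := oI (V i) (V k).
  have [|c cE] := emb_factor (f := inc (V i) ∘ a) (inc_emb SE W).
    move=> y; split; first by rewrite tf_comp; exact: emb_in (inc_emb SE (V i)) _.
    by rewrite e tf_comp; exact: emb_in (inc_emb SE (V k)) _.
  have -> : a = sub_res (@oIl _ (V i) (V k)) ∘ c.
    by apply: (inc_mono (SE := SE)); rewrite compmA sub_resE cE.
  have -> : b = sub_res (@oIr _ (V i) (V k)) ∘ c.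
    by apply: (inc_mono (SE := SE)); rewrite compmA sub_resE cE e.
  have := sV i k W (@oIl _ _ _) (@oIr _ _ _); rewrite /= /pullA !compmA => ->.
  by [].
have covp z : exists i : sp (sub U), oset (opre (tf (inc U)) (V (p i))) z by exists z; exact: pP.
have [|h hE] := cover_glue (g := fun z => s (p z) : hom _ _) SE
    (fun z => sub_res_emb (VU (p z))) covp.
  move=> i k T a b e; apply: agree.
  by rewrite -(sub_resE (VU (p i))) -(sub_resE (VU (p k))) -!compmA e.
exists h; split=> [i|h' h'E]; last first.
  apply: (cover_epi SE (fun z => sub_res_emb (VU (p z))) covp) => z.
  by rewrite hE -h'E.
pose T (z : sp (sub U)) := oI (V i) (V (p z)).
have TV z : T z `<=` V i by exact: oIl.
have TVp z : T z `<=` V (p z) by exact: oIr.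
apply: (@cover_epi E SE (sub (V i)) _ _ _ (fun z => sub_res (TV z)) (fun z => sub_res_emb (TV z))).
  move=> y; exists (tf (sub_res (VU i)) y); split; first exact: emb_in (inc_emb SE (V i)) _.
  by have := pP (tf (sub_res (VU i)) y); rewrite -tf_comp sub_resE.
move=> z; rewrite (agree i (p z) _ _ (sub_res (TVp z))); last by rewrite !sub_resE.
rewrite -hE /= /pullA -!compmA; congr (_ ∘ _).
by apply: (inc_mono (SE := SE)); rewrite !compmA !sub_resE.
Qed.

Definition lms_of (X : E) : lms := Lms (@lms_of_sheafP X).

(** A function is invertible near [x] iff its value at [x] lies in the open
    subset of units: this condition is open and can be tested on points. *)
Lemma lms_of_germ_unit (X : E) (U : opens (lms_of X)) x (Ux : oset U x)
    (s : lms_sh (lms_of X) U) (u : sp (sub U)) : tf (inc U) u = x ->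
  unit (germ Ux s) <-> oset (Gm SE) (tf (s : hom _ _) u).
Proof.
move=> ux; split=> [/unit_germ[W [WU [t [Wx e]]]]|Gu].
  have [w wx] := sub_point SE Wx.
  have wu : tf (sub_res WU) w = u.
    by apply: (emb_inj SE (inc_emb SE U)); rewrite ux -wx -tf_comp sub_resE.
  rewrite -wu -tf_comp; apply: (GmP SE _).1; by exists t.
have oW : open (tf (inc U) @` (opre (tf (s : hom _ _)) (Gm SE))).
  by apply: (emb_open SE (inc_emb SE U)); exact: oset_open.
pose W : opens (lms_of X) := Opens oW.
have WU : W `<=` U by move=> _ [v _ <-]; exact: emb_in (inc_emb SE U) v.
have Wx : oset W x by exists u.
rewrite -(germ_res WU Ux Wx).
have [t e] : exists t, madd (A1_monoid E) ((s : hom _ _) ∘ sub_res WU) t = mzero (A1_monoid E) _.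
  apply/(GmP SE) => w; rewrite tf_comp.
  have [v Gv vw] := emb_in (inc_emb SE W) w.
  rewrite (_ : tf (sub_res WU) w = v) //.
  by apply: (emb_inj SE (inc_emb SE U)); rewrite vw -tf_comp sub_resE.
by exists (germ Wx (t : lms_sh (lms_of X) W)); rewrite -germD [X in germ _ X]e -(germ0 _ Wx).
Qed.

Section StrMap.
Variables (X Y : E) (h : hom X Y).

Definition pre_lms_of_map : pre_lms_hom (lms_of X) (lms_of Y).
Proof.
refine (@PreLmsHom (lms_of X) (lms_of Y) (tf h) (fun V U UV s => pullA (smap UV) s) _ _).
  by move=> V U UV; exact: pullAM.
move=> V V' U U' UV UV' V'V U'U s; rewrite /= /pullA -!compmA; congr (_ ∘ _).
by apply: (inc_mono (SE := SE)); rewrite !compmA smapE -compmA !sub_resE smapE.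
Defined.

Lemma lms_of_map_local x : local (@stalk_map _ _ pre_lms_of_map x).
Proof.
move=> g; have [V [Vx [s ->]]] := germ_surj g; apply: contra_not.
have Vx' : oset (opre (tf h) V) x := Vx.
rewrite (@stalk_mapE _ _ pre_lms_of_map x V _ Vx Vx' (@subpre _ _ (tf h) V)).
have [u ux] := sub_point SE Vx'.
move=> /(lms_of_germ_unit _ _ ux) Gu.
apply/(@lms_of_germ_unit _ _ _ _ _ (tf (smap (@subpre _ _ (tf h) V)) u)).
  by rewrite -tf_comp smapE tf_comp ux.
by move: Gu; rewrite /= /pullA tf_comp.
Qed.

Definition lms_of_map : lms_hom (lms_of X) (lms_of Y) := LmsHom lms_of_map_local.

End StrMap.

Lemma lms_of_map_id (X : E) : lms_of_map (idm X) = lms_id (lms_of X).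
Proof.
apply: lms_hom_eq => [x|V U UV UV' s] /=; first exact: tf_id.
by rewrite /pullA; congr (_ ∘ _); apply: (inc_mono (SE := SE)); rewrite !smapE.
Qed.

Lemma lms_of_map_comp (X Y Z : E) (g : hom Y Z) (f : hom X Y) :
  lms_of_map (g ∘ f) = lms_comp (lms_of_map g) (lms_of_map f).
Proof.
apply: lms_hom_eq => [x|V U UV UV' s] /=; first exact: tf_comp.
rewrite /pullA -compmA; congr (_ ∘ _); apply: (inc_mono (SE := SE)).
by rewrite smapE [RHS]compmA smapE -[RHS]compmA smapE compmA.
Qed.

End Structure.

(** * Spaces universal over a locally monoidal space *)
Section Represent.
Variable E : space_data.
Hypothesis SE : category_of_spaces E.
Local Notation sub := (sub SE).
Local Notation inc := (inc SE).
Local Notation lms_of := (lms_of SE).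
Local Notation lms_of_map := (lms_of_map SE).

Lemma emb_comp (X U V : E) (O : opens (sp X)) (W : opens (sp U)) (j : hom U X)
    (k : hom V U) (J : emb O j) : emb W k ->
  emb (Opens (emb_open SE J (oset_open W))) (j ∘ k).
Proof.
move=> K; apply: embI => [v|Y f fW|Y f g e].
- by rewrite tf_comp; exists (tf k v) => //; exact: emb_in K v.
- have [|g gE] := emb_factor (f := f) J.
    by move=> y; have [u _ <-] := fW y; exact: emb_in J u.
  have [|h hE] := emb_factor (f := g) K.
    move=> y; have [u Wu e] := fW y.
    by rewrite (_ : tf g y = u) //; apply: (emb_inj SE J); rewrite e -gE tf_comp.
  by exists h; rewrite -compmA hE.
- by apply: (emb_mono K); apply: (emb_mono J); rewrite !compmA.
Qed.

(** An open subspace of [U] is also an open subspace of [X] ([kex]), and so has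
    the same functions. *)
Lemma lms_of_map_oe (X U : E) (O : opens (sp X)) (j : hom U X) :
  emb O j -> open_immersion (lms_of_map j).
Proof.
move=> J; pose im (N : opens (sp U)) := Opens (emb_open SE J (oset_open N)) : opens (lms_of X).
have imV (N : opens (sp U)) (V : opens (sp X)) : N `<=` tf j @^-1` V -> im N `<=` V.
  by move=> NV _ [u Nu <-]; exact: NV.
have kex (N : opens (sp U)) : exists k : hom (sub (im N)) (sub N), j ∘ inc N ∘ k = inc (im N).
  exact: (emb_factor (emb_comp J (inc_emb SE N))) (emb_in (inc_emb SE (im N))).
split; [exact: (@emb_inj E SE X O U j J)|exact: (@emb_open E SE X O U j J)| |].
- move=> a g h; have [V [Vx [s ->]]] := germ_surj g; have [W [Wx [t ->]]] := germ_surj h.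
  rewrite (@stalk_mapE _ _ (lms_of_map j) a V (opre (tf j) V) Vx Vx (@subpre _ _ _ _)).
  rewrite (@stalk_mapE _ _ (lms_of_map j) a W (opre (tf j) W) Wx Wx (@subpre _ _ _ _)).
  move=> /germP[N [NV [NW [Na e]]]]; apply/germP.
  have [k kE] := kex N; exists (im N), (imV _ _ NV), (imV _ _ NW); split; first by exists a.
  have fac (V' : opens (sp X)) (NV' : N `<=` opre (tf j) V') : sub_res SE (imV _ _ NV') =
      smap SE (@subpre _ _ (tf j) V') ∘ sub_res SE NV' ∘ k.
    apply: (inc_mono (SE := SE)).
    by rewrite !compmA sub_resE smapE -[j ∘ _ ∘ _]compmA sub_resE kE.
  rewrite /= /pullA !fac !compmA; congr (_ ∘ _).
  exact: e.
- move=> a g; have [N [Na [s ->]]] := germ_surj g; have [k kE] := kex N.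
  have Na' : oset (im N) (tf j a) by exists a.
  exists (germ Na' (pullA k s : lms_sh (lms_of X) (im N))).
  have NM : N `<=` tf j @^-1` im N by move=> u Nu; exists u.
  rewrite (@stalk_mapE _ _ (lms_of_map j) a (im N) N Na' Na NM) /= /pullA -compmA.
  rewrite (_ : k ∘ _ = idm _) ?compm1 //.
  apply: (emb_mono (emb_comp J (inc_emb SE N))).
  by rewrite !compmA kE smapE compm1.
Qed.

Section GlobalSections.
Variable X : E.

Definition glob (f : homA E X) : lms_sh (lms_of X) (oT _) := pullA (inc (oT (sp X))) f.

Lemma globM : GRing.nmod_morphism glob.
Proof. exact: pullAM. Qed.

Lemma glob_bij : exists2 g : lms_sh (lms_of X) (oT _) -> homA E X,
  GRing.nmod_morphism g & cancel glob g /\ cancel g glob.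
Proof.
have [k kE] := emb_factor (f := idm X) (inc_emb SE (oT (sp X))) (fun _ => Logic.I).
have kI : k ∘ inc _ = idm _.
  by apply: (inc_mono (SE := SE)); rewrite compmA kE comp1m compm1.
exists (pullA k); first exact: pullAM.
by split=> f; rewrite /glob /pullA -compmA ?kE ?kI compm1.
Qed.

End GlobalSections.

Lemma glob_nat (X Y : E) (h : hom Y X) (f : homA E X) (H : oT (lms_of Y) `<=` tf h @^-1` oT (lms_of X)) :
  @lh_sh _ _ (lms_of_map h) (oT _) (oT _) H (glob f) = glob (pullA h f).
Proof. by rewrite /= /glob /pullA -!compmA smapE. Qed.

(** [Q] represents the functor sending [Y] to the homomorphisms from [P] to the
    functions on [Y]. *)
Definition affine_univ (P : nmodType) (Q : E) (z : P -> homA E Q) :=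
  GRing.nmod_morphism z /\
  forall (Y : E) (phi : P -> homA E Y), GRing.nmod_morphism phi ->
    exists! h : hom Y Q, forall p, pullA h (z p) = phi p.

(** [Q] represents the functor sending a space [Y] to the morphisms from [Y],
    seen as a locally monoidal space, to the open part [U] of [X]. Keeping [X]
    fixed and varying [U] avoids restricting and gluing the targets. *)
Definition universal_over (X : lms) (U : opens X) (Q : E) (e : lms_hom (lms_of Q) X) :=
  (forall q, oset U (lh_fun e q)) /\
  forall (Y : E) (g : lms_hom (lms_of Y) X), (forall y, oset U (lh_fun g y)) ->
    exists! h : hom Y Q, lms_comp e (lms_of_map h) = g.

Section AffineMap.
Variables (P : nmodType) (Q : E) (z : P -> homA E Q).
Hypothesis zM : GRing.nmod_morphism z.

Lemma aff_map_subproof : GRing.nmod_morphism (fun p => glob (z p)).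
Proof. by split=> [|a b]; rewrite ?zM.1 ?(globM Q).1 // zM.2 (globM Q).2. Qed.

Definition aff_map : lms_hom (lms_of Q) (spec_lms P) := spec_hom aff_map_subproof.

Lemma aff_mapE (Y : E) (h : hom Y Q) p :
  global_section (lms_comp aff_map (lms_of_map h)) p = glob (pullA h (z p)).
Proof.
by rewrite global_section_comp (global_section_spec_hom aff_map_subproof) glob_nat.
Qed.

Lemma aff_map1 p : global_section aff_map p = glob (z p).
Proof. exact: (global_section_spec_hom aff_map_subproof). Qed.

End AffineMap.

(** Morphisms to [Spec P] are homomorphisms from [P] to global sections. *)
Lemma affine_universal (P : nmodType) (Q : E) (z : P -> homA E Q) (zU : affine_univ z) :
  universal_over (oT (spec_lms P)) (aff_map zU.1).
Proof.
split=> // Y k _; have [un unM [globK unK]] := glob_bij Y.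
have [|h [hE hU]] := zU.2 Y (fun p => un (global_section k p)).
  by have kM := global_section_add k; split=> [|a b]; rewrite ?kM.1 ?unM.1 // kM.2 unM.2.
exists h; split=> [|h' h'E].
  by apply: global_section_inj => p; rewrite aff_mapE hE unK.
by apply: hU => p; rewrite -[LHS]globK -(aff_mapE zU.1) h'E.
Qed.

Lemma universal_oe (A X : lms) (j : lms_hom A X) (J : open_immersion j) (Q : E)
    (e : lms_hom (lms_of Q) A) : universal_over (oT A) e -> universal_over (oe_img J (oT A)) (lms_comp j e).
Proof.
move=> [_ R]; split=> [q|Y g gU]; first by exists (lh_fun e q).
have [k kE] : exists k, lms_comp j k = g.
  by apply: (oe_factor J) => y; have [q _ qy] := gU y; exists q.
have [//|h [hE hU]] := R Y k; exists h; split=> [|h' h'E]; first by rewrite -lcompA hE.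
by apply: hU; apply: (oe_mono J); rewrite lcompA h'E kE.
Qed.

Section Representations.
Variable X : lms.
Implicit Types (U V : opens X).

Lemma universal_mono U Q (e : lms_hom (lms_of Q) X) : universal_over U e ->
  forall Y (h h' : hom Y Q), lms_comp e (lms_of_map h) = lms_comp e (lms_of_map h') -> h = h'.
Proof.
move=> [eU eX] Y h h' hh'; have [|k [_ kU]] := eX Y (lms_comp e (lms_of_map h)).
  by move=> y; exact: eU.
by rewrite -(kU h) // -(kU h').
Qed.

Lemma universal_lift U Q (e : lms_hom (lms_of Q) X) : universal_over U e ->
  forall Y (g : lms_hom (lms_of Y) X), (forall y, oset U (lh_fun g y)) ->
    exists h : hom Y Q, lms_comp e (lms_of_map h) = g.
Proof. by move=> [_ eX] Y g /eX[h [hE _]]; exists h. Qed.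

(** Both [h] and the open embedding over the preimage of [V] represent the
    morphisms to [Q] that land in [V] over [X]. *)
Lemma universal_emb U V Q Q' (e : lms_hom (lms_of Q) X) (e' : lms_hom (lms_of Q') X) (h : hom Q' Q) :
  universal_over U e -> universal_over V e' -> lms_comp e (lms_of_map h) = e' ->
  emb (opre (lh_fun e) V) h.
Proof.
move=> R R' eh; apply: embI => [u|Y f fV|Y f g fg].
- by have := R'.1 u; rewrite -eh.
- have [|g gE] := universal_lift R' (g := lms_comp e (lms_of_map f)); first exact: fV.
  exists g; apply: (universal_mono R).
  by rewrite lms_of_map_comp lcompA eh.
- by apply: (universal_mono R'); rewrite -eh -!lcompA -!lms_of_map_comp fg.
Qed.

Lemma universal_sub U V Q Q' (e : lms_hom (lms_of Q) X) (j : hom Q' Q) :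
  universal_over U e -> V `<=` U -> emb (opre (lh_fun e) V) j ->
  universal_over V (lms_comp e (lms_of_map j)).
Proof.
move=> R VU J; split=> [q|Y g gV]; first exact: (emb_in J q).
have [|h hE] := universal_lift R (g := g); first by move=> y; exact: VU.
have [|k kE] := emb_factor (f := h) J.
  by move=> y; have := gV y; rewrite -hE.
exists k; split=> [|k' k'E]; first by rewrite -lcompA -lms_of_map_comp kE.
apply: (emb_mono J); apply: (universal_mono R).
by rewrite kE hE -k'E -lcompA -lms_of_map_comp.
Qed.

(** A morphism [g] to [X] is lifted locally, over the preimages of the [W i];
    the lifts are unique, so that they glue. Uniqueness is itself local: over the
    preimage of [W i], two lifts of [g] factor through [Q_ i]. *)
Lemma universal_local (I : smallType) (W : I -> opens X) U (Q : E) (e : lms_hom (lms_of Q) X)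
    (Q_ : I -> E) (j : forall i, hom (Q_ i) Q) :
  (forall q, oset U (lh_fun e q)) -> (forall i, W i `<=` U) ->
  (forall x, oset U x -> exists i, oset (W i) x) ->
  (forall i, emb (opre (lh_fun e) (W i)) (j i)) ->
  (forall i, universal_over (W i) (lms_comp e (lms_of_map (j i)))) -> universal_over U e.
Proof.
move=> eU WU cov J R.
have covY Y (g : lms_hom (lms_of Y) X) (gU : forall y, oset U (lh_fun g y)) :
    forall y, exists i, oset (opre (lh_fun g) (W i)) y by move=> y; exact: cov.
have mono Y (m m' : hom Y Q) :
    lms_comp e (lms_of_map m) = lms_comp e (lms_of_map m') -> m = m'.
  move=> mm'; have [g gm gm'] : exists2 g, lms_comp e (lms_of_map m) = g &
      lms_comp e (lms_of_map m') = g by exists (lms_comp e (lms_of_map m)).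
  have gU y : oset U (lh_fun g y) by rewrite -gm; exact: eU.
  have mW i z : oset (opre (lh_fun g) (W i)) z -> oset (opre (lh_fun e) (W i)) (tf m z).
    by rewrite -gm.
  have mW' i z : oset (opre (lh_fun g) (W i)) z -> oset (opre (lh_fun e) (W i)) (tf m' z).
    by rewrite -gm'.
  apply: (cover_epi SE (fun i => inc_emb SE (opre (lh_fun g) (W i))) (covY Y g gU)) => i.
  have inW := emb_in (inc_emb SE (opre (lh_fun g) (W i))).
  have [|a aE] := emb_factor (f := m ∘ inc (opre (lh_fun g) (W i))) (J i).
    by move=> y; rewrite tf_comp; exact: mW.
  have [|b bE] := emb_factor (f := m' ∘ inc (opre (lh_fun g) (W i))) (J i).
    by move=> y; rewrite tf_comp; exact: mW'.
  rewrite -aE -bE; congr (_ ∘ _); apply: (universal_mono (R i)).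
  by rewrite -!lcompA -!lms_of_map_comp aE bE !lms_of_map_comp !lcompA gm gm'.
split=> // Y g gU.
have lift i : exists h : hom (sub (opre (lh_fun g) (W i))) (Q_ i),
    lms_comp (lms_comp e (lms_of_map (j i))) (lms_of_map h) = lms_comp g (lms_of_map (inc _)).
  by apply: (universal_lift (R i)) => y; exact: emb_in (inc_emb SE (opre (lh_fun g) (W i))) y.
pose h i := projT1 (cid (lift i)).
have hE i : lms_comp e (lms_of_map (j i ∘ h i)) = lms_comp g (lms_of_map (inc _)).
  by rewrite lms_of_map_comp lcompA; exact: (projT2 (cid (lift i))).
have [|m mE] := cover_glue (g := fun i => j i ∘ h i) SE
    (fun i => inc_emb SE (opre (lh_fun g) (W i))) (covY Y g gU).
  move=> i k T a b ab; apply: mono.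
  by rewrite !(lms_of_map_comp _ (j _ ∘ _)) !lcompA !hE -!lcompA -!lms_of_map_comp ab.
exists m; split=> [|m' m'E]; last first.
  apply: (cover_epi SE (fun i => inc_emb SE (opre (lh_fun g) (W i))) (covY Y g gU)) => i.
  apply: mono; rewrite mE hE -m'E.
  by rewrite lms_of_map_comp lcompA.
apply: (@lms_joint_epi _ _ _ _ (fun i => lms_of_map (inc (opre (lh_fun g) (W i))))).
- by move=> i; exact: lms_of_map_oe (inc_emb SE _).
- move=> y; have [i Wi] := covY Y g gU y; exists i.
  by have [u uy] := sub_point SE Wi; exists u.
- by move=> i; rewrite -lcompA -lms_of_map_comp mE hE.
Qed.

Definition representable U := exists (Q : E) (e : lms_hom (lms_of Q) X), universal_over U e.

End Representations.
End Represent.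

(** * Transfinite gluing of universal spaces *)
Lemma top_colimit_surj (J : category) (D : functor J Top) (c : cocone D) :
  is_colimit c -> forall z : (coapex c : topologicalType),
    exists i x, (coleg c i : continuousType _ _) x = z.
Proof.
move=> col; apply: (indicator_eq (D := [set z | exists i x, (coleg c i : continuousType _ _) x = z])).
have nat i k (u : hom i k) : @compm Top _ _ _ (indicator (X := D k) setT) (fmap D u) = indicator setT.
  by apply/continuousEP.
have [h [_ hU]] := col (Cocone nat).
transitivity h; first by apply/esym/hU => i; exact/continuousEP.
apply: hU => i; apply/continuousEP => x.
by apply: asbool_equiv_eq; split=> // _; exists i, x.
Qed.

Section TopPushout.
Variables (X0 X1 X2 Q : Top) (f1 : hom X0 X1) (f2 : hom X0 X2).
Variables (q1 : hom X1 Q) (q2 : hom X2 Q).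
Hypothesis po : is_pushout f1 f2 q1 q2.

Lemma top_pushout_surj (z : (Q : topologicalType)) :
  (exists a, (q1 : continuousType _ _) a = z) \/ (exists b, (q2 : continuousType _ _) b = z).
Proof.
move: z; have [_ pou] := po; apply: (indicator_eq (D := [set z |
  (exists a, (q1 : continuousType _ _) a = z) \/ (exists b, (q2 : continuousType _ _) b = z)])).
have [|h [_ hU]] := pou indiscrete (indicator setT) (indicator setT); first exact/continuousEP.
transitivity h; first by apply/esym/hU; split; exact/continuousEP.
apply: hU; split; apply/continuousEP => x; apply: asbool_equiv_eq; split=> // _.
  by left; exists x.
by right; exists x.
Qed.

(** If [a] is not in the image of [f1], then the indicators of this image and
    of the whole of [X2] glue to a function separating [q1 a] from [q2 b]. *)
Lemma top_pushout_overlap a b :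
  (q1 : continuousType _ _) a = (q2 : continuousType _ _) b ->
  exists c, (f1 : continuousType _ _) c = a.
Proof.
move=> ab; apply: contrapT => na; case: po => _ pou.
have [|h [[h1 h2] _]] := pou indiscrete
    (indicator (range (f1 : continuousType _ _))) (indicator setT).
  by apply/continuousEP => x; apply: asbool_equiv_eq; split=> // _; exists x.
have e1 := congr1 (fun k : continuousType _ _ => k a) h1.
have e2 := congr1 (fun k : continuousType _ _ => k b) h2.
move: e1; rewrite /= ab => e1; move: e2; rewrite /= e1.
rewrite (asboolT (Logic.I : setT b)) => /asboolP[c _ ca]; apply: na.
by exists c.
Qed.

End TopPushout.

Definition oU (X : topologicalType) (U V : opens X) : opens X :=
  Opens (openU (oset_open U) (oset_open V)).

Definition obigU (X : topologicalType) (I : Type) (U : I -> opens X) : opens X :=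
  Opens (bigcup_open (fun i (_ : [set: I] i) => oset_open (U i))).

Section WellOrder.
Variables (T : Type) (R : rel T).
Hypothesis wo : well_order R.

Lemma wo_refl : reflexive R.
Proof. by move=> x; have := well_order_total wo x x; rewrite orbb. Qed.

Lemma wo_anti x y : R x y -> R y x -> x = y.
Proof.
move=> xy yx; have [|z [_ zU]] := @wo (fun z => `[< z = x \/ z = y >]).
  by exists x; apply/asboolP; left.
have <- : z = x.
  by apply: zU; split; [apply/asboolP; left|move=> w /asboolP[->|->] //; exact: wo_refl].
by apply: zU; split; [apply/asboolP; right|move=> w /asboolP[->|->] //; exact: wo_refl].
Qed.

Lemma wo_trans : transitive R.
Proof.
move=> y x z xy yz; have [|m [[/asboolP mxyz mmin] _]] := @wo (fun m => `[< [\/ m = x, m = y | m = z] >]).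
  by exists x; apply/asboolP; constructor 1.
have mx : R m x by apply: mmin; apply/asboolP; constructor 1.
have my : R m y by apply: mmin; apply/asboolP; constructor 2.
have mz : R m z by apply: mmin; apply/asboolP; constructor 3.
case: mxyz => e; subst m => //.
  by rewrite (wo_anti xy mx).
by rewrite -(wo_anti yz my).
Qed.

Lemma wo_ind (P : T -> Prop) :
  (forall x, (forall y, R y x -> y <> x -> P y) -> P x) -> forall x, P x.
Proof.
move=> step x; apply: contrapT => nx.
have [|m [[/asboolP nm mmin] _]] := @wo (fun y => `[< ~ P y >]); first by exists x; apply/asboolP.
apply: nm; apply: step => y ym e; apply: contrapT => ny; apply: e.
by apply: wo_anti => //; apply: mmin; apply/asboolP.
Qed.

Lemma wo_sub (D : T -> Prop) : well_order (fun u v : {x | D x} => R (sval u) (sval v)).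
Proof.
move=> A [u Au]; have [|m [[/asboolP[v [Av vm]] mmin] _]] :=
  @wo (fun x => `[< exists v, v \in A /\ sval v = x >]).
  by exists (sval u); apply/asboolP; exists u.
subst m; exists v; split; first split=> // w Aw.
  by apply: mmin; apply/asboolP; exists w.
move=> w [Aw wmin]; have vw : sval v = sval w.
  by apply: wo_anti; [apply: mmin; apply/asboolP; exists w|exact: wmin].
case: v w vw {Av mmin Aw wmin} => x xD [y yD] /= e.
by subst y; congr exist; exact: Prop_irrelevance.
Qed.

End WellOrder.

Section RepresentGlue.
Variable E : space_data.
Hypothesis SE : category_of_spaces E.
Local Notation sub := (sub SE).
Local Notation inc := (inc SE).
Local Notation lms_of := (lms_of SE).
Local Notation lms_of_map := (lms_of_map SE).
Variable X : lms.
Implicit Types (U V : opens X).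

Lemma emb_eq (Y U : E) (O O' : opens (sp Y)) (j : hom U Y) :
  (forall y, oset O y <-> oset O' y) -> emb O j -> emb O' j.
Proof.
move=> OO'; rewrite (_ : O = O') //; apply: opens_eq.
by apply/seteqP; split=> y /OO'.
Qed.

(** The [Q_ i] are the charts of [Q]. Their morphisms to [X] glue, since they
    agree on the overlaps. The last hypothesis says that the preimage of [W i]
    in [Q] is not larger than [Q_ i]; universality can then be checked over each
    [W i]. *)
Lemma universal_colim (I : smallType) (W : I -> opens X) (Q_ : I -> E)
    (e_ : forall i, lms_hom (lms_of (Q_ i)) X) (Q : E) (q : forall i, hom (Q_ i) Q) :
  (forall i, universal_over (W i) (e_ i)) -> (forall i, open_embedding (q i)) ->
  (forall z, exists i u, tf (q i) u = z) ->
  (forall i k a b, tf (q i) a = tf (q k) b ->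
     exists (C : E) (c : sp C) (u : hom C (Q_ i)) (v : hom C (Q_ k)),
     [/\ tf u c = a, tf v c = b, open_embedding u, open_embedding v &
         q i ∘ u = q k ∘ v /\ lms_comp (e_ i) (lms_of_map u) = lms_comp (e_ k) (lms_of_map v)]) ->
  (forall i k b, oset (W i) (lh_fun (e_ k) b) -> exists a, tf (q i) a = tf (q k) b) ->
  representable SE (obigU W).
Proof.
move=> R qoe surj overlap sat.
have qo i : open_immersion (lms_of_map (q i)) by have [O J] := embE (qoe i); exact: lms_of_map_oe J.
have cov (z : lms_of Q) : exists i u, lh_fun (lms_of_map (q i)) u = z by exact: surj.
have [|e eE] := lms_glue (g := e_) qo cov.
  move=> i k a b /overlap[C [c [u [v [ua vb uo vo [qe ee]]]]]].
  exists (lms_of C), c, (lms_of_map u), (lms_of_map v); split=> //.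
  - by have [O J] := embE uo; exact: lms_of_map_oe J.
  - by have [O J] := embE vo; exact: lms_of_map_oe J.
  - by rewrite -!lms_of_map_comp qe.
exists Q, e; apply: (@universal_local _ _ _ _ W _ _ _ Q_ q).
- move=> z; have [i [u <-]] := cov z; exists i => //.
  by rewrite -[lh_fun e _]/(lh_fun (lms_comp e (lms_of_map (q i))) u) eE; exact: (R i).1.
- by move=> i x Wx; exists i.
- by move=> x [i _ Wx]; exists i.
- move=> i; have [O J] := embE (qoe i); apply: (emb_eq _ J) => z; split.
    move=> /(emb_surj SE J)[u <-].
    by rewrite /= -[lh_fun e _]/(lh_fun (lms_comp e (lms_of_map (q i))) u) eE; exact: (R i).1.
  move=> /= Wz; have [k [b bz]] := cov z.
  have [|a ab] := sat i k b.
    by rewrite -eE; move: Wz; rewrite -bz.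
  by rewrite -bz -[lh_fun _ b]/(tf (q k) b) -ab; exact: emb_in J a.
- by move=> i; rewrite eE; exact: R.
Qed.

Lemma open_embedding_id (Y : E) : open_embedding (idm Y).
Proof. by exists (oT (sp Y)); exact: emb_id. Qed.

(** The spaces over [U] and [V] both contain the one over the intersection as an
    open subspace, and can be glued along it. *)
Lemma representable_union U V : representable SE U -> representable SE V ->
  representable SE (oU U V).
Proof.
move=> [Q1 [e1 R1]] [Q2 [e2 R2]]; pose W := oI U V.
pose f1 := inc (opre (lh_fun e1) W).
have R0 := universal_sub R1 (@oIl _ U V) (inc_emb SE (opre (lh_fun e1) W)).
have [|f2 f2E] := universal_lift R2 (g := lms_comp e1 (lms_of_map f1)).
  by move=> y; have [] := R0.1 y.
have J2 := universal_emb R2 R0 f2E.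
have F1 : open_embedding f1 by exists (opre (lh_fun e1) W); exact: inc_emb.
have F2 : open_embedding f2 by exists (opre (lh_fun e2) W).
have [_ _ _ [S7 _] _] := SE.
have [Q [q1 [q2 [[q12 _] [oe1 oe2 _] tpo]]]] := S7 _ _ _ _ _ F1 F2.
have sat1 a b : tf q1 a = tf q2 b -> exists c, tf f1 c = a /\ tf f2 c = b.
  move=> ab; have [c ca] := top_pushout_overlap tpo ab; exists c; split=> //.
  have [O2 K2] := embE oe2; apply: (emb_inj SE K2).
  by rewrite -ab -ca -[fmap _ _]/(tf f1) -!tf_comp q12.
pose W_ (b : bool) := if b then U else V.
pose Q_ (b : bool) : E := if b then Q1 else Q2.
pose e_ b := if b return lms_hom (lms_of (Q_ b)) X then e1 else e2.
pose q b := if b return hom (Q_ b) Q then q1 else q2.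
suff [Q' [e' R']] : representable SE (obigU W_).
  exists Q', e'; rewrite (_ : oU U V = obigU W_) //; apply: opens_eq.
  by apply/seteqP; split=> [x []|x [[] _]]; [exists true|exists false|left|right].
apply: (@universal_colim _ W_ Q_ e_ Q q).
- by case.
- by case.
- move=> z; have [[a az]|[b bz]] := top_pushout_surj tpo z; first by exists true, a.
  by exists false, b.
- have refl i a b : tf (q i) a = tf (q i) b ->
     exists (C : E) (c : sp C) (u : hom C (Q_ i)) (v : hom C (Q_ i)),
     [/\ tf u c = a, tf v c = b, open_embedding u, open_embedding v &
         q i ∘ u = q i ∘ v /\ lms_comp (e_ i) (lms_of_map u) = lms_comp (e_ i) (lms_of_map v)].
    have qo : open_embedding (q i) by case: (i).
    have [O K] := embE qo => /(emb_inj SE K) ab; subst b.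
    exists (Q_ i), a, (idm _), (idm _); split=> //; rewrite ?tf_id //; exact: open_embedding_id.
  move=> [] [] a b; [exact: (refl true)| | |exact: (refl false)].
    by move=> /sat1[c [ca cb]]; exists (sub (opre (lh_fun e1) W)), c, f1, f2.
  move=> /esym/sat1[c [ca cb]]; exists (sub (opre (lh_fun e1) W)), c, f2, f1.
  by split=> //; rewrite q12.
- move=> [] [] b /= Wb; try (by exists b).
    have [c <-] := emb_surj SE J2 (conj Wb (R2.1 b) : oset (opre (lh_fun e2) W) b).
    by exists (tf f1 c); rewrite -!tf_comp q12.
  have [c <-] := emb_surj SE (inc_emb SE (opre (lh_fun e1) W))
    (conj (R1.1 b) Wb : oset (opre (lh_fun e1) W) b).
  by exists (tf f2 c); rewrite -!tf_comp -q12.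
Qed.

(** The spaces over the [W i] form a functor by their universal properties, and
    its transition maps are open embeddings. *)
Lemma representable_chain (I : smallType) (R : rel I) (W : I -> opens X) :
  well_order R -> (forall i k, R i k -> W i `<=` W k) ->
  (forall i, representable SE (W i)) -> representable SE (obigU W).
Proof.
move=> wo mono rep.
pose Q_ i := projT1 (cid (rep i)).
have ex i : exists e : lms_hom (lms_of (Q_ i)) X, universal_over (W i) e by exact: (projT2 (cid (rep i))).
pose e_ i := projT1 (cid (ex i)).
have R_ i : universal_over (W i) (e_ i) by exact: (projT2 (cid (ex i))).
have dex i k (r : R i k) : exists h : hom (Q_ i) (Q_ k), lms_comp (e_ k) (lms_of_map h) = e_ i.
  by apply: (universal_lift (R_ k)) => y; apply: mono r _ _; exact: (R_ i).1.
pose d i k r := projT1 (cid (dex i k r)).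
have dE i k r : lms_comp (e_ k) (lms_of_map (d i k r)) = e_ i by exact: (projT2 (cid (dex i k r))).
pose J := order_category (wo_refl wo) (wo_trans wo).
have d1 i : d i i (idm (i : J)) = idm _.
  by apply: (universal_mono (R_ i)); rewrite dE lms_of_map_id lcomp1.
have dM i k l (v : hom (k : J) (l : J)) (u : hom (i : J) k) : d i l (v ∘ u) = d k l v ∘ d i k u.
  by apply: (universal_mono (R_ l)); rewrite dE lms_of_map_comp lcompA !dE.
pose D : functor J E := @Functor J E Q_ d d1 dM.
have K i k r : emb (opre (lh_fun (e_ k)) (W i)) (d i k r).
  exact: universal_emb (R_ k) (R_ i) (dE i k r).
have doe i k r : open_embedding (d i k r) by exists (opre (lh_fun (e_ k)) (W i)); exact: K.
have [_ _ _ [_ S7] _] := SE.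
have [c [_ coe tcol]] := S7 I R (wo_refl wo) (wo_trans wo) D wo doe.
have cd i k (r : R i k) : coleg c k ∘ d i k r = coleg c i by exact: (@coleg_nat _ _ _ c i k r).
apply: (@universal_colim _ W Q_ e_ (coapex c) (coleg c)) => //.
- by move=> z; have [i [x xz]] := top_colimit_surj tcol z; exists i, x.
- move=> i k a b ab; have [r|r] := orP (well_order_total wo i k).
    have {}ab : tf (d i k r) a = b.
      have [O C] := embE (coe k); apply: (emb_inj SE C).
      by rewrite -ab -tf_comp cd.
    exists (Q_ i), a, (idm _), (d i k r); split=> //; rewrite ?tf_id //.
      exact: open_embedding_id.
    by rewrite compm1 cd lms_of_map_id lcomp1 dE.
  have {}ab : tf (d k i r) b = a.
    have [O C] := embE (coe i); apply: (emb_inj SE C).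
    by rewrite ab -tf_comp cd.
  exists (Q_ k), b, (d k i r), (idm _); split=> //; rewrite ?tf_id //.
    exact: open_embedding_id.
  by rewrite compm1 cd lms_of_map_id lcomp1 dE.
- move=> i k b Wb; have [r|r] := orP (well_order_total wo i k).
    have [a <-] := emb_surj SE (K i k r) Wb.
    by exists a; rewrite -tf_comp cd.
  by exists (tf (d k i r) b); rewrite -tf_comp cd.
Qed.

(** A category of spaces provides only pushouts and unions of well-ordered
    chains. Hence the points of [X], which index the cover, are well-ordered,
    and the union [V x] of the [U y] for [y <= x] is treated by transfinite
    induction: it is the union of a chain and of the one set [U x]. *)
Lemma representable_cover (U : forall x : X, opens X) :
  (forall x, oset (U x) x) -> (forall x, representable SE (U x)) ->
  representable SE (oT X).
Proof.
move=> Ux rep; have [R wo] := well_ordering_principle X.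
pose V x := obigU (fun y : {y | R y x} => U (sval y)).
have Vmono x y : R x y -> V x `<=` V y.
  move=> xy z [[w wx] _ Uw]; exists (exist _ w (wo_trans wo wx xy)) => //.
have Vrep : forall x, representable SE (V x).
  apply: (wo_ind wo) => x IHx.
  pose V' := obigU (fun y : {y | R y x /\ y <> x} => V (sval y)).
  rewrite (_ : V x = oU V' (U x)).
    apply: representable_union => //.
    apply: (representable_chain (wo_sub wo (D := fun y => R y x /\ y <> x))).
      by move=> i k; exact: Vmono.
    by move=> [y [yx ne]]; exact: IHx.
  apply: opens_eq; apply/seteqP; split=> z /=.
    move=> [[y yx] _ /= Uz]; have [yx'|ne] := pselect (y = x); first by right; rewrite -yx'.
    by left; exists (exist _ y (conj yx ne)) => //; exists (exist _ y (wo_refl wo y)).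
  move=> [[[y [yx ne]] _ /= Vz]|Uz]; first exact: Vmono yx _ Vz.
  by exists (exist _ x (wo_refl wo x)).
rewrite (_ : oT X = obigU V); first exact: (representable_chain wo).
apply: opens_eq; apply/seteqP; split=> // x _; exists x => //.
by exists (exist _ x (wo_refl wo x)) => //=; exact: Ux.
Qed.

End RepresentGlue.

(** * Affine fans as finite limits *)

(** A space representing the homomorphisms from [P] is built in two steps: a
    product of copies of [A1] for the generators, and in it a joint equalizer
    for the relations. *)
Section Shapes.

Definition discrete_category (n : nat) : category.
Proof.
refine (@Category 'I_n (fun i j => i = j) (@erefl _) (fun i j k v u => etrans u v) _ _ _);
  by move=> *; exact: Prop_irrelevance.
Defined.

Definition star_hom (m : nat) (i j : option 'I_m) : Type :=
  match i, j with
  | None, None => Datatypes.unit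
  | None, Some _ => bool
  | Some k, Some l => k = l
  | Some _, None => void
  end.

Definition star_id m (i : option 'I_m) : star_hom i i :=
  match i with None => tt | Some k => erefl k end.

Definition star_comp m (i j k : option 'I_m) :
    star_hom j k -> star_hom i j -> star_hom i k :=
  match i, j, k with
  | None, None, None => fun _ _ => tt
  | None, None, Some _ => fun g _ => g
  | None, Some _, Some _ => fun _ g => g
  | Some _, Some _, Some _ => fun e f => etrans f e
  | _, Some _, None => fun e _ => match e with end
  | Some _, None, _ => fun _ e => match e with end
  end.

(** The shape of a joint equalizer: one vertex with a pair of arrows to each of
    [m] others. *)
Definition star_category (m : nat) : category.
Proof.
refine (@Category (option 'I_m) (@star_hom m) (@star_id m) (@star_comp m) _ _ _).
- by move=> [k|] [l|] //= e; case: e.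
- by move=> [k|] [l|] //= e; case: e.
- by move=> [a|] [b|] [c|] [d|] //= *; try exact: Prop_irrelevance; case: (_ : void).
Defined.

Lemma finite_finType (T : finType) : finite_type T.
Proof.
exists #|T|, (fun i => enum_val i) => x; exists (enum_rank x).
exact: enum_rankK.
Qed.

Lemma finite_eq (T : eqType) (x y : T) : finite_type (x = y).
Proof.
have [e|ne] := eqVneq x y.
  by exists 1%N, (fun=> e) => e'; exists ord0; exact: Prop_irrelevance.
have no : 'I_0 -> x = y by case.
by exists 0%N, no => e'; rewrite e' eqxx in ne.
Qed.

Lemma discrete_finite n : finite_category (discrete_category n).
Proof. by split; [exact: finite_finType|move=> i j; exact: finite_eq]. Qed.

Lemma star_finite m : finite_category (star_category m).
Proof.
split; first exact: finite_finType.
by move=> [k|] [l|] /=; [exact: finite_eq| | |]; exact: finite_finType.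
Qed.

Lemma discrete_limit n (C : category) (D : functor (discrete_category n) C) (c : cone D) :
  is_limit c -> forall (Y : C) (f : forall i, hom Y (D i)),
    exists! h : hom Y (apex c), forall i, leg c i ∘ h = f i.
Proof.
move=> lim Y f; have nat i j (u : @hom (discrete_category n) i j) : fmap D u ∘ f i = f j.
  by case: _ / u; rewrite (fmap1 D i) comp1m.
exact: (lim (Cone nat)).
Qed.

Section StarLimit.
Variables (m : nat) (C : category) (D : functor (star_category m) C) (c : cone D).
Hypothesis lim : is_limit c.
Let arr (k : 'I_m) (b : bool) : hom (D None) (D (Some k)) :=
  @fmap _ _ D None (Some k) b.

Lemma star_limit_eq k : arr k true ∘ leg c None = arr k false ∘ leg c None.
Proof.
by rewrite (@leg_nat _ _ _ c None (Some k) true) (@leg_nat _ _ _ c None (Some k) false).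
Qed.

Lemma star_limit (Y : C) (f : hom Y (D None)) :
  (forall k, arr k true ∘ f = arr k false ∘ f) ->
  exists! h : hom Y (apex c), leg c None ∘ h = f.
Proof.
move=> fE; pose g i : hom Y (D i) :=
  match i return hom Y (D i) with None => f | Some k => arr k true ∘ f end.
have nat i j (u : @hom (star_category m) i j) : fmap D u ∘ g i = g j.
  move: i j u => [k|] [l|] //= u.
  - by case: _ / u; rewrite (fmap1 D (Some k)) comp1m.
  - by case: u => //; rewrite fE.
  - by case: u; rewrite (fmap1 D None) comp1m.
have [h [hE hU]] := lim (Cone nat); exists h; split=> [|h' h'E]; first exact: (hE None).
apply: hU => -[k|] //=.
by rewrite -(@leg_nat _ _ _ c None (Some k) true) -compmA h'E.
Qed.

End StarLimit.
End Shapes.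

Lemma lin_morph n (M N : nmodType) (phi : M -> N) (m : 'I_n -> M) c :
  GRing.nmod_morphism phi -> phi (lin m c) = lin (phi \o m) c.
Proof.
move=> [phi0 phiD]; rewrite /lin (big_morph phi phiD phi0).
apply: eq_bigr => i _ /=.
by elim: (c i) => [|k IHk]; rewrite ?mulr0n // !mulrS phiD IHk.
Qed.

(** What is used of the two limits is isolated because it is verified twice, for
    limits in [E] and for their images under a 1-morphism. *)
Section AffineData.
Variables (P : nmodType) (n : nat) (g : 'I_n -> P) (s : seq ({ffun 'I_n -> nat} * {ffun 'I_n -> nat})).
Variable coef : P -> 'I_n -> nat.
Hypothesis coefE : forall p, lin g (coef p) = p.
Hypothesis s_rel : forall r, r \in s -> lin g r.1 = lin g r.2.
Hypothesis s_pres : forall (M : nmodType) (m : 'I_n -> M),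
  (forall r, r \in s -> lin m r.1 = lin m r.2) ->
  forall c d : 'I_n -> nat, lin g c = lin g d -> lin m c = lin m d.
Variables (E : space_data) (V Z : E) (pr : 'I_n -> homA E V) (l : hom Z V).
Hypothesis Vprod : forall Y (f : 'I_n -> homA E Y),
  exists! h : hom Y V, forall i, pullA h (pr i) = f i.
Hypothesis leq_ : forall r, r \in s -> pullA l (lin pr r.1) = pullA l (lin pr r.2).
Hypothesis Zeq : forall Y (f : hom Y V),
  (forall r, r \in s -> pullA f (lin pr r.1) = pullA f (lin pr r.2)) ->
  exists! h : hom Y Z, l ∘ h = f.
Variable z : P -> homA E Z.
Hypothesis zE : forall p, z p = lin (fun i => pullA l (pr i)) (coef p).

Lemma affine_data_univ : affine_univ z.
Proof.
have pl c : pullA l (lin pr c) = lin (fun i => pullA l (pr i)) c.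
  by rewrite (lin_morph _ _ (pullAM l)).
have wd c d : lin g c = lin g d ->
    lin (fun i => pullA l (pr i)) c = lin (fun i => pullA l (pr i)) d.
  by apply: s_pres => r rs; rewrite -!pl leq_.
have zl p c : lin g c = p -> z p = lin (fun i => pullA l (pr i)) c.
  by move=> e; rewrite zE; apply: wd; rewrite coefE e.
have zg i : z (g i) = pullA l (pr i).
  have delta (M : nmodType) (m : 'I_n -> M) : lin m (fun j => (j == i) : nat) = m i.
    rewrite /lin (bigD1 i) //= eqxx mulr1n big1 ?addr0 // => j /negbTE ->.
    by rewrite mulr0n.
  by rewrite (zl _ (fun j => (j == i) : nat)) delta.
split.
  split=> [|p q].
    have lin0 (M : nmodType) (m : 'I_n -> M) : lin m (fun=> 0%N) = 0.
      by rewrite /lin big1 // => i _; rewrite mulr0n.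
    by rewrite (zl _ (fun=> 0%N)) lin0.
  by rewrite (zl (p + q) (fun i => (coef p i + coef q i)%N)) linD ?coefE // -!zE.
move=> Y phi phiM; have [h0 [h0E h0U]] := Vprod (fun i => phi (g i)).
have ph c : pullA h0 (lin pr c) = phi (lin g c).
  rewrite (lin_morph _ _ (pullAM h0)) (lin_morph _ _ phiM).
  by apply: eq_bigr => i _ /=; rewrite h0E.
have [|h [hE hU]] := @Zeq _ h0; first by move=> r rs; rewrite !ph s_rel.
have comp (k : hom Y Z) i : pullA k (z (g i)) = pullA (l ∘ k) (pr i).
  by rewrite zg /pullA compmA.
exists h; split=> [p|h' h'E].
  rewrite -{2}(coefE p) -ph -hE zE (lin_morph _ _ (pullAM h)) (lin_morph _ _ (pullAM (l ∘ h))).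
  by apply: eq_bigr => i _ /=; rewrite -zg comp.
apply: hU; apply/esym/h0U => i.
by rewrite -comp h'E.
Qed.

End AffineData.

Section Transport.
Variables (E E' : space_data) (F : one_morphism E E').

(** The action of [F] on functions, with [F A1] identified with [A1]. *)
Definition transA (X : E) (f : homA E X) : homA E' (F X) :=
  eq_hom (om_A1 F) ∘ fmap F f.

Lemma transAM X : GRing.nmod_morphism (@transA X).
Proof.
split=> [|f g]; first exact: (om_mzero F).
exact: (om_madd F f g).
Qed.

Lemma transA_pull (X Y : E) (h : hom Y X) (f : homA E X) :
  transA (pullA h f) = pullA (fmap F h) (transA f).
Proof. by rewrite /transA /pullA fmapM compmA. Qed.

Lemma eq_hom_iso (C : category) (X Y : C) (e : X = Y) :
  inverses (eq_hom e) (eq_hom (esym e)).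
Proof. by case: _ / e; split; exact: comp1m. Qed.

End Transport.

(** As [P] is finitely generated, it is finitely presented by [redei], so that
    the space is a finite limit. Hence every 1-morphism maps it to a space with
    the same universal property. *)
Lemma affine_model (E : space_data) (P : nmodType) : finite_limits_axiom E ->
  finitely_generated P -> exists (Q : E) (z : P -> homA E Q), affine_univ z /\
    forall (E' : space_data) (F : one_morphism E E'),
      affine_univ (fun p => transA F (z p)).
Proof.
move=> lim [n [g /choice[coef gcoef]]].
have coefE p : lin g (coef p) = p by rewrite /lin -gcoef.
have [s [s_rel s_pres]] := redei g.
have DVM (i j k : discrete_category n) (v : hom j k) (u : hom i j) :
    idm (A1 E) = idm (A1 E) ∘ idm (A1 E) by rewrite comp1m.
pose DV : functor (discrete_category n) E :=
  @Functor (discrete_category n) E (fun _ => A1 E) (fun i j _ => idm _) (fun _ => erefl) DVM.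
have [cV limV] := lim _ DV (discrete_finite n).
pose V := apex cV; pose pr i : homA E V := leg cV i.
have Vprod Y (f : 'I_n -> homA E Y) : exists! h : hom Y V, forall i, pullA h (pr i) = f i.
  exact: (discrete_limit limV f).
pose m := size s.
pose r (k : 'I_m) := tnth (in_tuple s) k.
pose DZ_obj (i : option 'I_m) : E := if i is Some _ then A1 E else V.
pose DZ_map (i j : option 'I_m) : star_hom i j -> hom (DZ_obj i) (DZ_obj j) :=
  match i, j return star_hom i j -> hom (DZ_obj i) (DZ_obj j) with
  | None, None => fun _ => idm V
  | None, Some k => fun b => if b then lin pr (r k).1 else lin pr (r k).2
  | Some k, Some l => fun _ => idm (A1 E)
  | Some _, None => fun e => match e with end
  end.
have DZ1 i : DZ_map i i (star_id i) = idm _ by case: i.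
have DZM i j k (v : star_hom j k) (u : star_hom i j) :
    DZ_map i k (star_comp v u) = DZ_map j k v ∘ DZ_map i j u.
  move: i j k v u => [a|] [b|] [c|] //= v u; rewrite ?comp1m ?compm1 //;
    first [by subst c | by case: v | by case: u].
pose DZ : functor (star_category m) E := @Functor (star_category m) E DZ_obj DZ_map DZ1 DZM.
have [cZ limZ] := lim _ DZ (star_finite m).
pose Z := apex cZ; pose l : hom Z V := leg cZ None.
have rs k : r k \in s by exact: mem_tnth.
have sr q : q \in s -> exists k, r k = q.
  by move=> /(tnthP (in_tuple s))[k ->]; exists k.
have leq_ q : q \in s -> pullA l (lin pr q.1) = pullA l (lin pr q.2).
  by move=> /sr[k <-]; exact: (star_limit_eq cZ k).
pose z p := lin (fun i => pullA l (pr i)) (coef p).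
exists Z, z; split.
  apply: (affine_data_univ coefE s_rel s_pres Vprod leq_) => // Y f fE.
  by apply: (star_limit limZ) => k; exact: fE.
move=> E' F; have tM X := transAM F X.
have [eF1 eF2] := eq_hom_iso (om_A1 F).
have tlin X (w : 'I_n -> homA E X) c : transA F (lin w c) = lin (fun i => transA F (w i)) c.
  by rewrite (lin_morph _ _ (tM X)).
apply: (@affine_data_univ P n g s coef coefE s_rel s_pres E' (F V) (F Z)
  (fun i => transA F (pr i)) (fmap F l)).
- move=> Y f.
  have [h [hE hU]] := discrete_limit (om_lim (discrete_finite n) limV)
    (fun i => (eq_hom (esym (om_A1 F)) ∘ f i : hom Y (comp_functor F DV i))).
  exists h; split=> [i|h' h'E].
    by rewrite /pullA /transA -compmA [X in _ ∘ X]hE compmA eF2 comp1m.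
  apply: hU => i; rewrite -h'E /pullA /transA !compmA eF1 comp1m.
  by [].
- by move=> q qs; rewrite -!tlin -!transA_pull leq_.
- move=> Y f fE; apply: (star_limit (om_lim (star_finite m) limZ)) => k.
  have := fE _ (rs k); rewrite -!tlin /pullA /transA -!compmA.
  move=> /(congr1 (fun u => eq_hom (esym (om_A1 F)) ∘ u)).
  by rewrite ![eq_hom _ ∘ (eq_hom _ ∘ _)]compmA eF1 !comp1m.
- move=> p; rewrite /z tlin; apply: eq_bigr => i _.
  by rewrite transA_pull.
Qed.

(** * Existence of the 1-morphism *)
Lemma nat_univ (E : space_data) :
  affine_univ (fun n : nat => (idm (A1 E) : homA E (A1 E)) *+ n).
Proof.
have pullMn X Y (h : hom Y X) (f : homA E X) n : pullA h (f *+ n) = pullA h f *+ n.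
  by elim: n => [|n IHn]; rewrite ?mulr0n ?(pullAM h).1 // !mulrS (pullAM h).2 IHn.
split=> [|Y phi phiM]; first by split=> // m n; exact: mulrnDr.
exists (phi 1%N); split=> [n|h hE].
  rewrite pullMn /pullA comp1m; elim: n => [|n IHn]; first by rewrite mulr0n phiM.1.
  by rewrite mulrS IHn -phiM.2.
by have := hE 1%N; rewrite /pullA /= comp1m.
Qed.

Section Existence.
Variable E : space_data.
Hypothesis SE : category_of_spaces E.
Local Notation lms_of := (lms_of SE).
Local Notation lms_of_map := (lms_of_map SE).

Lemma fan_representable (X : fan) : representable SE (oT X).
Proof.
have [P [j jP]] := fan_atlas X; have J x : open_immersion (j x) by case: (jP x).
apply: (representable_cover (U := fun x => oe_img (J x) (oT _))) => x.
  by exists (closed_pt (P x)) => //; case: (jP x).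
have [[lim _ _ _] _ _ _ _] := SE; have fgP : finitely_generated (P x) by case: (jP x).
have [Q [z [zU _]]] := affine_model lim fgP.
by exists Q, (lms_comp (j x) (aff_map SE zU.1)); exact: universal_oe (affine_universal SE zU).
Qed.

Record fan_repr (X : fan) := FanRepr {
  rQ : E;
  re : lms_hom (lms_of rQ) X;
  rP : universal_over (oT X) re }.

Definition nat_repr : fan_repr SpecN :=
  @FanRepr SpecN _ _ (affine_universal SE (nat_univ E)).

Lemma fan_repr_ex (X : fan) : exists r : fan_repr X, True.
Proof. by have [Q [e R]] := fan_representable X; exists (FanRepr R). Qed.

(** A 1-morphism maps [Spec N] to [A1] by an equality of objects. So the space
    chosen over [Spec N] has to be [A1] itself and not merely isomorphic to
    it. *)
Definition the_repr (X : fan) : fan_repr X :=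
  match pselect (SpecN = X :> fan) with
  | left e => eq_rect SpecN fan_repr nat_repr X e
  | right _ => projT1 (cid (fan_repr_ex X))
  end.

Lemma the_reprN : the_repr SpecN = nat_repr.
Proof.
rewrite /the_repr; case: pselect => [e|]; last by case.
by rewrite (Prop_irrelevance e erefl).
Qed.

(** [Fobj] is a partial right adjoint of [lms_of], and [eps] is its counit. *)
Definition Fobj (X : fan) : E := rQ (the_repr X).
Definition eps (X : fan) : lms_hom (lms_of (Fobj X)) X := re (the_repr X).

Lemma epsP (X : fan) : universal_over (oT X) (eps X).
Proof. exact: rP. Qed.

Lemma Fmap_spec (X Y : fan) (f : lms_hom X Y) : exists h : hom (Fobj X) (Fobj Y),
  lms_comp (eps Y) (lms_of_map h) = lms_comp f (eps X).
Proof. exact: (universal_lift (epsP Y)). Qed.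

Definition Fmap (X Y : fan) (f : lms_hom X Y) := projT1 (cid (Fmap_spec f)).

Lemma FmapE (X Y : fan) (f : lms_hom X Y) :
  lms_comp (eps Y) (lms_of_map (Fmap f)) = lms_comp f (eps X).
Proof. exact: (projT2 (cid (Fmap_spec f))). Qed.

Lemma eps_mono (X : fan) (Y : E) (h h' : hom Y (Fobj X)) :
  lms_comp (eps X) (lms_of_map h) = lms_comp (eps X) (lms_of_map h') -> h = h'.
Proof. exact: (universal_mono (epsP X)). Qed.

Lemma Fmap1 (X : fan) : Fmap (lms_id X) = idm (Fobj X).
Proof. by apply: eps_mono; rewrite FmapE lms_of_map_id l1comp lcomp1. Qed.

Lemma FmapM (X Y Z : fan) (g : lms_hom Y Z) (f : lms_hom X Y) :
  Fmap (lms_comp g f) = Fmap g ∘ Fmap f.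
Proof.
by apply: eps_mono; rewrite FmapE lms_of_map_comp lcompA FmapE -!lcompA FmapE.
Qed.

Definition Ffun : functor FansSpecN E :=
  @Functor FansSpecN E Fobj Fmap Fmap1 FmapM.

Definition Feta : nat_trans (comp_functor (sp_top E) Ffun) (sp_top FansSpecN).
Proof.
refine (@NatTrans FansSpecN Top (comp_functor (sp_top E) Ffun) (sp_top FansSpecN)
  (fun X => lh_fun (eps X)) _) => X Y f.
exact: (congr1 (fun h : lms_hom _ _ => lh_fun h) (FmapE f)).
Defined.

(** Right adjoints preserve limits. The test objects are of the form [lms_of Y],
    which is why limits of fans must be limits of locally monoidal spaces. *)
Lemma F_lim : preserves_finite_limits Ffun.
Proof.
move=> J D c finJ /(is_limit_lms_limit finJ) lim c'.
have [|h [hE hU]] := lim (lms_of (apex c')) (fun j => lms_comp (eps (D j)) (lms_of_map (leg c' j))).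
  move=> i j u; rewrite lcompA -FmapE -lcompA -lms_of_map_comp.
  by congr (lms_comp _ (lms_of_map _)); exact: (@leg_nat _ _ _ c' i j u).
have [k kE] := universal_lift (epsP (apex c)) (g := h) (fun _ => Logic.I).
exists k; split=> [j|k' k'E].
  by apply: eps_mono; rewrite lms_of_map_comp lcompA FmapE -lcompA kE hE.
apply: eps_mono; rewrite kE; apply: hU => j.
by rewrite -k'E lms_of_map_comp [RHS]lcompA FmapE lcompA.
Qed.

Lemma F_emb (X U : fan) (j : lms_hom U X) (J : open_immersion j) :
  emb (opre (lh_fun (eps X)) (oe_img J (oT _))) (Fmap j).
Proof. exact: universal_emb (epsP X) (universal_oe J (epsP U)) (FmapE j). Qed.

(** The members of a coproduct form an open cover with empty overlaps, and an
    empty space is initial. *)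
Lemma F_coprod : preserves_coproducts Ffun.
Proof.
move=> I X Q inj /fans_coproductP[oe cov rel].
have J i := F_emb (oe i).
have covF (z : sp (Fobj Q)) : exists i, oset (opre (lh_fun (eps Q)) (oe_img (oe i) (oT _))) z.
  by have [i [a e]] := cov (lh_fun (eps Q) z); exists i, a.
move=> Y g; have [|h hE] := cover_glue (g := g) SE J covF.
  move=> i k T a b ab; have [ik|ik] := pselect (i = k).
    by subst k; congr (_ ∘ _); exact: emb_mono (J i) ab.
  have T0 : [set: sp T] = set0.
    apply/seteqP; split=> // t _; apply: ik.
    have [x _ xe] := emb_in (J i) (tf a t); have [y _ ye] := emb_in (J k) (tf b t).
    have : lh_fun (inj i : lms_hom _ _) x = lh_fun (inj k : lms_hom _ _) y.
      by rewrite xe ye -!tf_comp ab.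
    by move=> /rel /(congr1 (@projT1 _ _)).
  have [[_ _ _ [_ S4]] _ _ _ _] := SE.
  by have [t [_ tU]] := S4 T T0 Y; rewrite -(tU (g i ∘ a)) // -(tU (g k ∘ b)).
exists h; split=> // h' h'E; apply: (cover_epi SE J covF) => i.
by rewrite hE -h'E.
Qed.

Definition F_A1 : Ffun SpecN = A1 E := congr1 (@rQ SpecN) the_reprN.

Lemma nat_repr_section (r : fan_repr SpecN) (e : r = nat_repr) (Y : E) (h : hom Y (rQ r)) :
  global_section (lms_comp (re r) (lms_of_map h)) 1%N
  = glob SE (eq_hom (congr1 (@rQ SpecN) e : rQ r = A1 E) ∘ h : homA E Y).
Proof.
subst r; apply: etrans (aff_mapE SE (nat_univ E).1 h 1%N) _.
by rewrite mulr1n.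
Qed.

(** The identification of [Fobj SpecN] with [A1] is compatible with taking
    sections; additivity of [Fmap] on functions is deduced from this. *)
Lemma F_A1_section (Y : E) (h : hom Y (Fobj SpecN)) :
  global_section (lms_comp (eps SpecN) (lms_of_map h)) 1%N
  = glob SE (eq_hom F_A1 ∘ h : homA E Y).
Proof. exact: nat_repr_section. Qed.

Lemma F_hom_section (X : fan) (f : lms_hom X (spec_lms nat)) :
  glob SE (eq_hom F_A1 ∘ (Fmap (Y := SpecN) f) : homA E (Fobj X))
  = global_section (lms_comp f (eps X)) 1%N.
Proof. by rewrite -F_A1_section FmapE. Qed.

Lemma glob_inj (X : E) : injective (@glob E SE X).
Proof. by have [g _ [gK _]] := glob_bij SE X; exact: can_inj gK. Qed.

Lemma F_madd (X : fan) (f g : lms_hom X (spec_lms nat)) :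
  eq_hom F_A1 ∘ Fmap (Y := SpecN) (spec_add f g)
  = madd (A1_monoid E) (eq_hom F_A1 ∘ Fmap (Y := SpecN) f) (eq_hom F_A1 ∘ Fmap (Y := SpecN) g).
Proof.
apply: glob_inj; rewrite F_hom_section spec_add_comp global_section_spec_add.
by rewrite -homAD (globM SE _).2 !F_hom_section.
Qed.

Lemma F_mzero (X : fan) :
  eq_hom F_A1 ∘ Fmap (Y := SpecN) (spec_zero X nat) = mzero (A1_monoid E) (Fobj X).
Proof.
apply: glob_inj; rewrite F_hom_section spec_zero_comp global_section_spec_zero.
by rewrite -homA0 (globM SE _).1.
Qed.

Lemma F_open (X : FansSpecN) (O : set (X : fan)) (U : FansSpecN) (j : hom U X) :
  @open_embedding_onto FansSpecN X O U j ->
  open_embedding_onto ((Feta X : continuousType _ _) @^-1` O) (fmap Ffun j).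
Proof.
by move=> /embedding_oe[J <-]; exact: (F_emb J).
Qed.

Definition initial_morphism : one_morphism FansSpecN E :=
  @OneMorphism FansSpecN E Ffun Feta F_lim F_coprod F_A1 F_madd F_mzero F_open.

End Existence.

(** * The counit of a 1-morphism *)
Lemma global_section1_inj (X : lms) (f g : lms_hom X (spec_lms nat)) :
  global_section f 1%N = global_section g 1%N -> f = g.
Proof. exact: (bij_inj (global_section1_bij X)). Qed.

Section SectionMap.
Variables (X : lms) (V : opens X).

Lemma sec_hom_spec (s : lms_sh X V) : exists f : lms_hom (restr_lms V) (spec_lms nat),
  global_section f 1%N =
  @lh_sh _ _ (restr_incl V) V (oT _) (fun x _ => restr_incl_in x) s.
Proof. by have [g _ gK] := global_section1_bij (restr_lms V); eexists; exact: gK. Qed.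

(** Sections over [V] are morphisms from the fan [V] to [Spec N]; in this form a
    1-morphism can be applied to them. *)
Definition sec_hom (s : lms_sh X V) : lms_hom (restr_lms V) (spec_lms nat) :=
  projT1 (cid (sec_hom_spec s)).

Lemma sec_homE (s : lms_sh X V) : global_section (sec_hom s) 1%N =
  @lh_sh _ _ (restr_incl V) V (oT _) (fun x _ => restr_incl_in x) s.
Proof. exact: (projT2 (cid (sec_hom_spec s))). Qed.

Lemma sec_hom_eq (s : lms_sh X V) (f : lms_hom (restr_lms V) (spec_lms nat)) :
  global_section f 1%N =
    @lh_sh _ _ (restr_incl V) V (oT _) (fun x _ => restr_incl_in x) s ->
  sec_hom s = f.
Proof. by move=> e; apply: global_section1_inj; rewrite sec_homE e. Qed.

Lemma sec_homD (s t : lms_sh X V) : sec_hom (s + t) = spec_add (sec_hom s) (sec_hom t).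
Proof.
apply: sec_hom_eq; rewrite global_section_spec_add !sec_homE.
by rewrite (lh_add (p := restr_incl V) _).2.
Qed.

Lemma sec_hom0 : sec_hom 0 = spec_zero _ nat.
Proof.
apply: sec_hom_eq; rewrite global_section_spec_zero.
by rewrite (lh_add (p := restr_incl V) _).1.
Qed.

Lemma sec_hom_unit (s : lms_sh X V) x (Vx : oset V x) (y : restr_lms V) :
  lh_fun (restr_incl V) y = x -> oset (basic_open 1%N) (lh_fun (sec_hom s) y) ->
  unit (germ Vx s).
Proof.
move=> yx; case: _ / yx Vx => Vx ny; apply: (stalk_unit (f := restr_incl V)).
rewrite -(germ_pull s (fun x _ => restr_incl_in x) (Logic.I : oset (oT _) y)) -sec_homE.
apply: contrapT => /(prime_global_section (sec_hom s)); exact: ny.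
Qed.

End SectionMap.

Lemma sec_hom_comp (X Y : lms) (f : lms_hom X Y) (V : opens Y) (W : opens X)
    (WV : W `<=` lh_fun f @^-1` V) (s : lms_sh Y V) (r : lms_hom (restr_lms W) (restr_lms V)) :
  lms_comp (restr_incl V) r = lms_comp f (restr_incl W) ->
  sec_hom (lh_sh WV s) = lms_comp (sec_hom s) r.
Proof.
move=> e; apply: sec_hom_eq; rewrite global_section_comp sec_homE.
apply: germ_ext => x [].
rewrite (germ_pull _ _ _ (restr_incl_in x)) (germ_pull _ _ _ (WV _ (restr_incl_in x))).
rewrite (germ_pull _ _ _ (Logic.I : oset (oT (restr_lms V)) (lh_fun r x))).
rewrite (germ_pull _ _ _ (restr_incl_in (lh_fun r x))).
rewrite -(@stalk_comp _ _ _ (restr_incl V) r x) -(@stalk_comp _ _ _ f (restr_incl W) x).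
exact: hom_eq_stalk.
Qed.

Section Uniqueness.
Variable E : space_data.
Hypothesis SE : category_of_spaces E.
Local Notation lms_of := (lms_of SE).
Local Notation lms_of_map := (lms_of_map SE).
Local Notation sub := (sub SE).
Local Notation inc := (inc SE).

Section Counit.
Variable F : one_morphism FansSpecN E.

Definition etaF (X : fan) : continuousType (sp (om_fun F X)) X := om_eta F X.

Lemma etaF_nat (X Y : fan) (f : lms_hom X Y) x :
  etaF Y (tf (@fmap _ _ F X Y f) x) = lh_fun f (etaF X x).
Proof.
exact: (congr1 (fun k : continuousType _ _ => k x) (@ncomp_nat _ _ _ _ (om_eta F) X Y f)).
Qed.

Lemma om_emb (X U : fan) (j : lms_hom U X) (J : open_immersion j) :
  emb (opre (etaF X) (oe_img J (oT _))) (@fmap _ _ F U X j).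
Proof. exact: om_open (oe_embedding J). Qed.

Lemma om_emb_incl (X : fan) (V : opens X) :
  emb (opre (etaF X) V) (@fmap _ _ F (fan_restr V) X (fan_incl V)).
Proof.
have := @om_emb X (fan_restr V) _ (restr_oe V); apply: emb_eq => y; split=> [[x _ /= <-]|Vy].
  exact: restr_incl_in.
by exists (SigSub (mem_set (Vy : oset V (etaF X y)))).
Qed.

Lemma om_sub_spec (X : fan) (V : opens X) (U : opens (sp (F X)))
    (UV : U `<=` etaF X @^-1` V) :
  exists k : hom (sub U) (F (fan_restr V)), fmap F (fan_incl V) ∘ k = inc U.
Proof.
apply: (emb_factor (om_emb_incl V)) => y; apply: UV.
exact: emb_in (inc_emb SE U) y.
Qed.

Definition om_sub (X : fan) (V : opens X) (U : opens (sp (F X)))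
  (UV : U `<=` etaF X @^-1` V) := projT1 (cid (om_sub_spec UV)).

Lemma om_subE (X : fan) (V : opens X) (U : opens (sp (F X)))
    (UV : U `<=` etaF X @^-1` V) : fmap F (fan_incl V) ∘ om_sub UV = inc U.
Proof. exact: (projT2 (cid (om_sub_spec UV))). Qed.

(** [F] preserves the finite limit [Q] representing homomorphisms from the
    localization of [N] at all of its elements, that is, from the integers. On
    the open subset [T] where the coordinate is invertible, it extends to such a
    homomorphism, so that the inclusion of [T] factors through [F Q]. As the
    coordinate is invertible on [Q], naturality of [eta] gives the claim. *)
Lemma Gm_eta (w : sp (F SpecN)) : oset (Gm SE) (tf (eq_hom (om_A1 F)) w) ->
  oset (basic_open 1%N) (etaF SpecN w).
Proof.
move=> Gw; pose T := opre (tf (eq_hom (om_A1 F))) (Gm SE).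
have [t <-] := sub_point SE (Gw : oset T w).
pose q : spec nat := @Spec nat set0 (fun _ _ h => h) (fun h => h) (fun _ _ _ _ h => h).
have fgL := @loc_fg nat q nat_finitely_generated.
have [Q [z [[zM _] zU]]] := affine_model fans_finite_limits fgL.
have [_ univ] := zU _ F.
pose u : homA E (sub T) := eq_hom (om_A1 F) ∘ inc T.
have uu : unit u.
  apply: (GmP SE u).2 => y; rewrite tf_comp.
  exact: emb_in (inc_emb SE T) y.
have [phi [phiM phiE]] : exists phi : localization (prime_compl q) -> homA E (sub T),
    GRing.nmod_morphism phi /\ forall n, phi (loc_in _ n) = u *+ n.
  apply: loc_lift => [|n _]; first by split=> // m n; exact: mulrnDr.
  elim: n => [|n IHn]; first by rewrite mulr0n; exact: unit0.
  by rewrite mulrS; apply/unitD.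
have [h [hE _]] := univ _ phi phiM.
pose z1 : lms_hom (Q : fan) (spec_lms nat) := z (loc_in _ 1%N).
have z1u y : oset (basic_open 1%N) (lh_fun z1 y).
  move: y; apply/(spec_unitP z1).
  have q1 : sm_set (prime_compl q) 1%N by [].
  by have [v e] := unit_hom zM (loc_in_unit q1); exists v.
suff -> : inc T = @fmap _ _ F Q SpecN z1 ∘ h by rewrite tf_comp etaF_nat; exact: z1u.
have [_ e2] := eq_hom_iso (om_A1 F); have [e1 _] := eq_hom_iso (om_A1 F).
have {e1}e1 : eq_hom (esym (om_A1 F)) ∘ eq_hom (om_A1 F) = idm _ by exact: e1.
have := hE (loc_in _ 1%N); rewrite phiE mulr1n /u /pullA /transA.
move=> /(congr1 (fun k => eq_hom (esym (om_A1 F)) ∘ k)).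
by rewrite !compmA e1 !comp1m.
Qed.

(** On points this is [eta]; a section over [V] is sent to its image under [F],
    a function on [F V], which is an open subspace of [F X]. *)
Definition pre_counit (X : fan) : pre_lms_hom (lms_of (F X)) X.
Proof.
refine (@PreLmsHom (lms_of (F X)) X (etaF X)
  (fun V U UV s => pullA (om_sub UV) (transA F (sec_hom s : homA FansSpecN (fan_restr V)))) _ _).
- move=> V U UV; have [p0 pD] := pullAM (om_sub UV).
  have [t0 tD] := @transAM _ _ F (fan_restr V).
  split=> [|s t]; first by rewrite sec_hom0 t0 p0.
  by rewrite sec_homD tD pD.
move=> V V' U U' UV UV' V'V U'U s.
have [r rE] : exists r : lms_hom (restr_lms V') (restr_lms V),
    lms_comp (restr_incl V) r = lms_comp (lms_id X) (restr_incl V').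
  by apply: restr_factor => y; apply: V'V; exact: restr_incl_in.
rewrite -[res V'V s]/(@lh_sh _ _ (lms_id X) V V' V'V s) (@sec_hom_comp _ _ (lms_id X) V V' V'V s r rE).
rewrite -[lms_comp (sec_hom s) r]/(@pullA FansSpecN (fan_restr V) (fan_restr V') r (sec_hom s)).
rewrite transA_pull /= /pullA -!compmA; do 2!congr (_ ∘ _).
apply: (emb_mono (om_emb_incl V)); rewrite !compmA om_subE sub_resE -fmapM.
by rewrite [X in fmap F X]rE l1comp om_subE.
Defined.

(** By [Gm_eta], a germ with an invertible image is invertible. *)
Lemma counit_local (X : fan) x : local (@stalk_map _ _ (pre_counit X) x).
Proof.
move=> g; have [V [Vx [s ->]]] := germ_surj g; apply: contra_not.
have Vx' : oset (opre (etaF X) V) x := Vx.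
rewrite (@stalk_mapE _ _ (pre_counit X) x V _ Vx Vx' (@subpre _ _ (etaF X) V)).
have [u ux] := sub_point SE Vx'.
move=> /(lms_of_germ_unit _ _ ux); rewrite /= /pullA /transA !tf_comp.
move=> /Gm_eta; rewrite (@etaF_nat (fan_restr V) SpecN (sec_hom s)).
apply: sec_hom_unit.
by rewrite -(@etaF_nat (fan_restr V) X (fan_incl V)) -tf_comp om_subE ux.
Qed.

Definition counit (X : fan) : lms_hom (lms_of (F X)) X := LmsHom (@counit_local X).

Lemma counit_section (X : fan) (f : lms_hom X (spec_lms nat)) :
  global_section (lms_comp f (counit X)) 1%N = glob SE (transA F (f : homA FansSpecN X)).
Proof.
rewrite global_section_comp /=.
have -> : sec_hom (global_section f 1%N) = lms_comp f (restr_incl (oT X)).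
  by apply: sec_hom_eq; rewrite global_section_comp; congr lh_sh; exact: Prop_irrelevance.
rewrite -[lms_comp f _]/(@pullA FansSpecN X (fan_restr (oT X)) (fan_incl (oT X)) f).
by rewrite transA_pull /glob /pullA -compmA om_subE.
Qed.

Lemma counit_nat (X Y : fan) (f : lms_hom X Y) :
  lms_comp (counit Y) (lms_of_map (@fmap _ _ F X Y f)) = lms_comp f (counit X).
Proof.
apply: lms_hom_eq => [x|V U UV UV' s] /=; first exact: etaF_nat.
pose W := opre (lh_fun f) V.
have [r rE] : exists r : lms_hom (restr_lms W) (restr_lms V),
    lms_comp (restr_incl V) r = lms_comp f (restr_incl W).
  by apply: restr_factor => y; exact: (restr_incl_in y).
rewrite (sec_hom_comp (@subpre _ _ (lh_fun f) V) s rE).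
rewrite -[lms_comp (sec_hom s) r]/(@pullA FansSpecN (fan_restr V) (fan_restr W) r (sec_hom s)).
rewrite transA_pull /= /pullA -!compmA; do 2!congr (_ ∘ _).
apply: (emb_mono (om_emb_incl V)); rewrite !compmA om_subE smapE -fmapM.
rewrite [X in _ = fmap F X ∘ _]rE.
by rewrite [X in _ = X ∘ _](fmapM F f (fan_incl W)) -compmA om_subE.
Qed.

End Counit.
End Uniqueness.

(** * Universality of the counit *)
Section AffineFans.
Variables (P : nmodType) (fgP : finitely_generated P).

Definition aff_fan : fan := Fan (spec_fan fgP).

Lemma mulrn_morph (p : P) : GRing.nmod_morphism (fun n : nat => p *+ n).
Proof. by split=> // m n; exact: mulrnDr. Qed.

Definition aff_coord (p : P) : homA FansSpecN aff_fan := spec_map (mulrn_morph p).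

Lemma aff_coord_section (X : lms) (h : lms_hom X (spec_lms P)) p :
  global_section (lms_comp (aff_coord p : lms_hom (spec_lms P) (spec_lms nat)) h) 1%N
  = global_section h p.
Proof. by rewrite (global_section_map (mulrn_morph p)) mulr1n. Qed.

Lemma aff_coord_univ : affine_univ aff_coord.
Proof.
split.
  have c1 p : global_section (aff_coord p : lms_hom (spec_lms P) (spec_lms nat)) 1%N
      = ssec_const (oT _) p.
    by rewrite (global_section_spec_hom (spec_map_subproof (mulrn_morph p))) mulr1n.
  split=> [|p q]; apply: global_section1_inj.
    apply: etrans (c1 0) _.
    by apply: etrans _ (esym (global_section_spec_zero (spec_lms P) (1%N : nat))).
  apply: etrans (c1 (p + q)) _.
  apply: etrans _ (esym (global_section_spec_add (aff_coord p) (aff_coord q) 1%N)).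
  by rewrite ssec_constD; congr (_ + _); apply/esym; exact: c1.
move=> Y phi phiM; pose psi p := global_section (phi p : lms_hom (Y : fan) (spec_lms nat)) 1%N.
have psiM : GRing.nmod_morphism psi.
  split=> [|p q]; rewrite /psi ?phiM.1 ?phiM.2; first exact: global_section_spec_zero.
  exact: global_section_spec_add.
exists (spec_hom psiM); split=> [p|h hE].
  apply: global_section1_inj; rewrite [LHS]aff_coord_section.
  exact: (global_section_spec_hom psiM).
apply: global_section_inj => p; rewrite (global_section_spec_hom psiM) /psi -hE.
exact: aff_coord_section.
Qed.

End AffineFans.

Section CounitUniversal.
Variable E : space_data.
Hypothesis SE : category_of_spaces E.
Variable F : one_morphism FansSpecN E.
Local Notation lms_of := (lms_of SE).
Local Notation lms_of_map := (lms_of_map SE).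
Local Notation counit := (counit SE F).

(** The fan [Spec P] is isomorphic to the finite limit of [affine_model], whose
    image under [F] is known. *)
Lemma transA_aff_univ (P : nmodType) (fgP : finitely_generated P) :
  affine_univ (fun p => transA F (aff_coord fgP p)).
Proof.
have [cM cU] := aff_coord_univ fgP.
have [Q [z [[zM zU] FU]]] := affine_model fans_finite_limits fgP.
have [FM {}FU] := FU _ F.
have [h [hE _]] := zU _ _ cM; have [k [kE _]] := cU _ _ zM.
have kh : k ∘ h = idm _.
  have [w [_ wU]] := cU _ _ cM; rewrite -(wU (k ∘ h)) => [|p].
    by apply: wU => p; rewrite /pullA compm1.
  by apply: etrans _ (hE p); rewrite -(kE p) /pullA compmA.
split=> [|Y phi phiM].
  split=> [|p q]; first by rewrite cM.1 (transAM F _).1.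
  by rewrite cM.2 (transAM F _).2.
have [m [mE mU]] := FU Y phi phiM.
exists (fmap F k ∘ m); split=> [p|m' m'E].
  by rewrite -mE -kE transA_pull /pullA compmA.
rewrite (mU (fmap F h ∘ m')) => [|p].
  by rewrite compmA -fmapM kh fmap1 comp1m.
by rewrite -m'E -hE transA_pull /pullA compmA.
Qed.

Lemma counit_affine (P : nmodType) (fgP : finitely_generated P) :
  universal_over (oT (spec_lms P)) (counit (aff_fan fgP)).
Proof.
have U := transA_aff_univ fgP.
suff -> : counit (aff_fan fgP) = aff_map SE U.1 by exact: affine_universal.
apply: global_section_inj => p; rewrite aff_map1 -counit_section.
by rewrite aff_coord_section.
Qed.

(** Universality is local, the affine charts of [X] are mapped to an open cover
    of [F X], and the counit is natural. *)
Lemma counit_univ (X : fan) : universal_over (oT X) (counit X).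
Proof.
have [P [j jP]] := fan_atlas X; have J x : open_immersion (j x) by case: (jP x).
have fgP x : finitely_generated (P x) by case: (jP x).
apply: (@universal_local E SE X X (fun x => oe_img (J x) (oT _)) (oT X) (F X) (counit X)
  (fun x => F (aff_fan (fgP x))) (fun x => @fmap _ _ F (aff_fan (fgP x)) X (j x))) => //.
- by move=> x _; exists x; exists (closed_pt (P x)) => //; case: (jP x).
- by move=> x; exact: (@om_emb E F X (aff_fan (fgP x)) (j x) (J x)).
- move=> x; rewrite (@counit_nat E SE F (aff_fan (fgP x)) X (j x)).
  exact: universal_oe (counit_affine (fgP x)).
Qed.

End CounitUniversal.

(** * The 2-morphism between two 1-morphisms *)

(** The objects [F X] and [G X] are both universal over [X], and so are uniquely
    isomorphic over [X]. *)
Section TwoMorphisms.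
Variable E : space_data.
Hypothesis SE : category_of_spaces E.
Local Notation lms_of := (lms_of SE).
Local Notation lms_of_map := (lms_of_map SE).

Section Pair.
Variables F G : one_morphism FansSpecN E.

Lemma comparison_spec (X : fan) : exists h : hom (om_fun F X) (om_fun G X),
  lms_comp (counit SE G X) (lms_of_map h) = counit SE F X.
Proof. exact: (universal_lift (counit_univ SE G X)). Qed.

Definition comparison (X : fan) := projT1 (cid (comparison_spec X)).

Lemma comparisonE (X : fan) : lms_comp (counit SE G X) (lms_of_map (comparison X)) = counit SE F X.
Proof. exact: (projT2 (cid (comparison_spec X))). Qed.

Lemma counit_mono (X : fan) (Y : E) (h h' : hom Y (om_fun G X)) :
  lms_comp (counit SE G X) (lms_of_map h) = lms_comp (counit SE G X) (lms_of_map h') -> h = h'.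
Proof. exact: (universal_mono (counit_univ SE G X)). Qed.

Lemma comparison_nat (X Y : FansSpecN) (f : hom X Y) :
  comparison Y ∘ fmap F f = fmap G f ∘ comparison X.
Proof.
apply: counit_mono; rewrite !lms_of_map_comp !lcompA comparisonE !counit_nat.
by rewrite -lcompA comparisonE.
Qed.

Definition comparison_trans : nat_trans F G := NatTrans comparison_nat.

Lemma comparison_A1 : eq_hom (om_A1 G) ∘ comparison_trans (A1 FansSpecN) = eq_hom (om_A1 F).
Proof.
have sec (H : one_morphism FansSpecN E) : glob SE (eq_hom (om_A1 H) : homA E (H SpecN))
    = global_section (counit SE H SpecN) 1%N.
  rewrite -[counit SE H SpecN]l1comp (counit_section SE H (X := SpecN)).
  by rewrite /transA (fmap1 H SpecN) compm1.
apply: (@glob_inj E SE); rewrite [RHS]sec -comparisonE.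
rewrite -[eq_hom _ ∘ _]/(pullA (comparison SpecN) (eq_hom (om_A1 G) : homA E (G SpecN))).
rewrite -(@glob_nat _ _ _ _ (comparison SpecN) _ (fun _ _ => Logic.I)) sec.
by rewrite global_section_comp.
Qed.

Lemma comparison_eta (X : FansSpecN) :
  om_eta G X ∘ fmap (sp_top E) (comparison_trans X) = om_eta F X.
Proof. exact: (congr1 (fun h : lms_hom _ _ => lh_fun h) (comparisonE X)). Qed.

Definition comparison_two : two_morphism F G := TwoMorphism comparison_A1 comparison_eta.

(** Compatibility with [eta] is the claim on points. On sections, it follows
    from naturality, applied to sections as morphisms to [Spec N], and from the
    normalization on [A1]. *)
Lemma two_morphism_counit (g : two_morphism F G) (X : fan) :
  lms_comp (counit SE G X) (lms_of_map (g X)) = counit SE F X.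
Proof.
apply: lms_hom_eq => [x|V U UV UV' s] /=.
  exact: (congr1 (fun k : continuousType _ _ => k x) (tm_eta g X)).
have tr (Y : fan) (f : homA FansSpecN Y) : pullA (g Y) (transA G f) = transA F f.
  rewrite /pullA /transA -compmA -(ncomp_nat g (f : @hom FansSpecN Y SpecN)) compmA.
  by rewrite (tm_A1 g).
rewrite -[in RHS]tr /pullA -!compmA; do 2!congr (_ ∘ _).
apply: (emb_mono (om_emb_incl G V)); rewrite !compmA om_subE smapE.
by rewrite -(ncomp_nat g (fan_incl V)) -compmA om_subE.
Qed.

Lemma two_morphism_eq (g g' : two_morphism F G) : (forall X, g X = g' X) -> g = g'.
Proof.
case: g g' => -[g gn] gA ge [[g' gn'] gA' ge'] /= e.
have {}e : g = g' by apply: functional_extensionality_dep.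
subst g'; rewrite (Prop_irrelevance gn' gn) in gA' ge' *.
by congr TwoMorphism; exact: Prop_irrelevance.
Qed.

Lemma two_morphism_uniq (g : two_morphism F G) : g = comparison_two.
Proof.
apply: two_morphism_eq => X; apply: counit_mono.
by rewrite two_morphism_counit [RHS]comparisonE.
Qed.

End Pair.

Lemma comparison_inv (F G : one_morphism FansSpecN E) (X : fan) :
  comparison G F X ∘ comparison F G X = idm _.
Proof.
apply: counit_mono; rewrite lms_of_map_comp lcompA !comparisonE lms_of_map_id.
by rewrite lcomp1.
Qed.

Lemma comparison_invertible (F G : one_morphism FansSpecN E) : invertible (comparison_two F G).
Proof. by exists (comparison_two G F) => X; split; exact: comparison_inv. Qed.

End TwoMorphisms.

Theorem theorem4p5p12 :
  category_of_spaces FansSpecN /\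
  forall E : space_data, category_of_spaces E ->
    inhabited (one_morphism FansSpecN E) /\
    forall F G : one_morphism FansSpecN E,
      exists gamma : two_morphism F G,
        invertible gamma /\ forall gamma' : two_morphism F G, gamma' = gamma.
Proof.
split=> [|E SE]; first exact: fans_category_of_spaces.
split=> [|F G]; first by constructor; exact: initial_morphism.
exists (comparison_two SE F G); split; first exact: comparison_invertible.
exact: two_morphism_uniq.
Qed.
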